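(* $$\lim_{X\to\infty}\frac{\sum_{0<n<X,\ n \text{ squarefree}} \#\mathcal{F}^{6n,\mathrm{sol}}_{n^2}}{\sum_{0<n<X,\ n\text{ squarefree}} \#\mathcal{F}^{6n,\mathrm{ls}}_{n^2}} =\lim_{X\to\infty}\frac{\sum_{0<n<X,\ n \text{ squarefree}} \#\mathcal{F}^{-6n,\mathrm{sol}}_{n^2}}{\sum_{0<n<X,\ n\text{ squarefree}} \#\mathcal{F}^{-6n,\mathrm{ls}}_{n^2}}= 1.$$
   Context: For integers $B,M$, $W^B_M(\mathbb{Z})$ is the set of binary quartic forms $ax^4+Bx^2y^2+cy^4$ with $a,c\in\mathbb{Z}$, $ac=M$, and $\mathcal{F}^B_M=\{ax^4+Bx^2y^2+cy^4\in W^B_M(\mathbb{Z}): 0\le\operatorname{ord}_pa\le1 \text{ for all primes } p\}$. A form $f$ is locally soluble if for every place $v$ of $\mathbb{Q}$ there are $x,y,z\in\mathbb{Q}_v$, $(x,y)\ne(0,0)$, with $z^2=f(x,y)$; it is soluble if such $x,y,z$ exist in $\mathbb{Q}$. $\mathcal{F}^{B,\mathrm{ls}}_M$ and $\mathcal{F}^{B,\mathrm{sol}}_M$ denote the locally soluble and soluble elements of $\mathcal{F}^B_M$. *)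

(* Defs.v *)
From Stdlib Require Import ZArith QArith Reals List Znumtheory ClassicalEpsilon.
Import ListNotations.

(* A binary quartic form a x^4 + B x^2 y^2 + c y^4 is given by (a, B, c). *)

(* ord_p a <= 1 for every prime p (and a <> 0, i.e. ord_p a finite):
   no square of a prime divides a.  Note a = 0 is excluded. *)
Definition sqfree (a : Z) : Prop :=
  forall p : Z, prime p -> ~ (p * p | a)%Z.

Definition real_soluble (a B c : Z) : Prop :=
  exists x y z : R, ~ (x = 0%R /\ y = 0%R) /\
    (z * z = IZR a * x ^ 4 + IZR B * x ^ 2 * y ^ 2 + IZR c * y ^ 4)%R.

(* p-adic integers modelled as the inverse limit of Z/p^k Z:
   coherent sequences u with u (k+1) = u k mod p^k. *)
Definition padic_coherent (p : Z) (u : nat -> Z) : Prop :=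
  forall k : nat, (p ^ Z.of_nat k | u (S k) - u k)%Z.

(* Solubility over Q_p.  Clearing denominators (x = X/p^e, y = Y/p^e,
   z = Z/p^(2e)), which is possible by homogeneity, solubility over Q_p with
   (x,y) <> (0,0) is the same as solubility over Z_p with (X,Y) <> (0,0);
   equations in Z_p = lim Z/p^k are checked componentwise. *)
Definition padic_soluble (p a B c : Z) : Prop :=
  exists X Y W : nat -> Z,
    padic_coherent p X /\ padic_coherent p Y /\ padic_coherent p W /\
    (exists k : nat, ~ ((p ^ Z.of_nat k | X k)%Z /\ (p ^ Z.of_nat k | Y k)%Z)) /\
    (forall k : nat,
       (p ^ Z.of_nat k | W k * W k
          - (a * X k ^ 4 + B * X k ^ 2 * Y k ^ 2 + c * Y k ^ 4))%Z).

Definition locally_soluble (a B c : Z) : Prop :=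
  real_soluble a B c /\ forall p : Z, prime p -> padic_soluble p a B c.

Definition rat_soluble (a B c : Z) : Prop :=
  exists x y z : Q, ~ (x == 0 /\ y == 0)%Q /\
    (z * z == inject_Z a * (x * x * x * x) + inject_Z B * (x * x) * (y * y)
              + inject_Z c * (y * y * y * y))%Q.

Definition decP (P : Prop) : bool :=
  if excluded_middle_informative P then true else false.

(* The integers -|M|, ..., |M|; for M <> 0 every a with a c = M lies here. *)
Definition Zrange (M : Z) : list Z :=
  map (fun i : nat => (Z.of_nat i - Z.abs M)%Z)
      (seq 0 (S (2 * Z.to_nat (Z.abs M)))).

(* Membership of a x^4 + B x^2y^2 + c y^4 in F^B_M (c is determined by a). *)
Definition in_F (M a : Z) : Prop :=
  (exists c : Z, (a * c = M)%Z) /\ sqfree a.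

(* # { f in F^B_M : prop f } for M <> 0. *)
Definition countF (prop : Z -> Z -> Z -> Prop) (B M : Z) : nat :=
  length (filter (fun a => decP (in_F M a /\ prop a B (M / a)%Z)) (Zrange M)).

Definition count_sol (B M : Z) : nat := countF rat_soluble B M.
Definition count_ls (B M : Z) : nat := countF locally_soluble B M.

Definition sqfree_below (X : R) : list nat :=
  filter (fun n => decP (sqfree (Z.of_nat n) /\ (INR n < X)%R))
         (seq 1 (Z.to_nat (up X))).

Definition sum_sqfree (g : nat -> nat) (X : R) : R :=
  INR (fold_right Nat.add 0%nat (map g (sqfree_below X))).

Definition ratio (s : Z) (X : R) : R :=
  (sum_sqfree (fun n => count_sol (s * 6 * Z.of_nat n) (Z.of_nat n ^ 2)) X
   / sum_sqfree (fun n => count_ls (s * 6 * Z.of_nat n) (Z.of_nat n ^ 2)) X)%R.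

Definition lim_infty (f : R -> R) (l : R) : Prop :=
  forall eps : R, (0 < eps)%R ->
    exists X0 : R, forall X : R, (X0 < X)%R -> (Rabs (f X - l) < eps)%R.

(* Main.v *)
(** A form with a = 1 is soluble, so every n contributes at least one soluble form, and it suffices
    that the forms with a <> 1 that are locally soluble number o(X) in total. Write a = u d and n =
    |u| v d e with d, e odd and u, v made of the sign and the powers of 2. For an odd prime p
    dividing n, local solubility at p makes u d a square modulo p when p | e, and both 2 and w e
    squares modulo p when p | d, where w = - s sgn(u) v for the middle coefficient 6 s n; the factor
    2 comes from the discriminant 36 n^2 - 4 n^2 = 32 n^2. If d or e is small, the other variable is
    confined to half of the primes, and a Hall-type inequality saves a power of log X. If both are
    large, the indicator of these conditions is an average over d = D1 D0, e = E1 E0 of products of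
    Jacobi symbols. Terms where two linked variables are large cancel, by Holder's inequality,
    periodicity and reciprocity; in the remaining ones D1 and E1, or D0 and E0, are small, and the
    condition that 2 is a square modulo every prime of d saves (log X)^(1/4). *)

Require Import Defs.
From Stdlib Require Import ZArith QArith Reals.
From Stdlib Require Import Znumtheory Qreals List FinFun Classical Lia Lra.
From mathcomp Require all_boot all_order all_algebra all_fingroup all_solvable all_field.
From mathcomp Require reals sequences exp Rstruct ring lra zify ssrZ.

(** * Local solubility *)

Section LocalSolubility.
Local Open Scope Z_scope.

(** Everything after the local conditions is an upper bound, and this shapes the tools. Characters
    of small conductor enter only through the bound [2 + ln q] for partial sums of [L(1, chi)],
    which periodicity gives: the square of the harmonic sum over integers whose primes all split is
    at most the sum of [r(n) / n], [r] the convolution of 1 with [chi], so that harmonic sum is of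
    order [sqrt (ln Y ln q)] and not [ln Y]. The indicator of admissible pairs is replaced by a
    nonnegative majorant, so the region [d e <= X] may be enlarged to dyadic rectangles, where
    bilinear estimates apply.

    The exponents arise as follows. Each prime of [e] counts 1/2 because of the weight [1 / tau],
    and the harmonic sum has order [(ln X)^(1/2)]; each prime of [d] counts 1/2 once more because 2
    must be a square, and the sum has order [(ln X)^(1/4)]. Hall's inequality divides by [ln X],
    which leaves [X (ln X)^(-1/4)]; without the condition on 2 the bound would be [X] itself. With
    [t = (ln X)^(1/16)] the gain is [t^4] and all exponents are integers; the unlinked variables up
    to [T], about [exp t], cost only a multiple of [t^2]. *)

Definition quart (a B c x y : Z) : Z := a * x ^ 4 + B * x ^ 2 * y ^ 2 + c * y ^ 4.

Lemma prime_sq_dvd (p w : Z) : prime p -> (p | w * w) -> (p | w).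
Proof. intros hp h. destruct (prime_mult p hp w w h); assumption. Qed.

Lemma prime_pow4_dvd (p w : Z) : prime p -> (p ^ 4 | w * w) -> (p ^ 2 | w).
Proof.
  intros hp [q hq]. assert (p0 : p <> 0) by (pose proof (prime_ge_2 p hp); lia).
  assert (h1 : (p | w)).
  { apply prime_sq_dvd; auto. exists (q * p ^ 3). rewrite hq. ring. }
  destruct h1 as [v hv]. subst w.
  assert (h2 : (p | v)).
  { apply prime_sq_dvd; auto. exists (q * p).
    apply (Z.mul_reg_l _ _ (p * p)); [nia|]. replace (p * p * (v * v)) with (v * p * (v * p)) by ring.
    rewrite hq. ring. }
  destruct h2 as [r hr]. exists r. subst v. ring.
Qed.

(* Common powers of p in (x, y) are cleared four at a time: the form has degree 4. *)
Lemma primitive_descent (p a B c : Z) : prime p -> forall (j : nat) (x y w : Z),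
  ~ ((p ^ Z.of_nat j | x) /\ (p ^ Z.of_nat j | y)) ->
  (p ^ (4 * Z.of_nat j + 3) | w * w - quart a B c x y) ->
  exists x y w, ~ ((p | x) /\ (p | y)) /\ (p ^ 3 | w * w - quart a B c x y).
Proof.
  intros hp. pose proof (prime_ge_2 p hp) as p2.
  induction j as [|j IH]; intros x y w hxy hw.
  (* [p^0] divides everything, so [j = 0] contradicts the first hypothesis. Hence [j] bounds the
     number of divisions by [p^4], and the exponent [4 j + 3] leaves at least [p^3] at the end. *)
  - exfalso. apply hxy. simpl. split; apply Z.divide_1_l.
  - destruct (Zdivide_dec p x) as [[x' hx]|hx].
    2:{ exists x, y, w. split; [tauto|]. eapply Z.divide_trans; [|exact hw].
        exists (p ^ (4 * Z.of_nat (S j))). rewrite <- Z.pow_add_r by lia. reflexivity. }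
    destruct (Zdivide_dec p y) as [[y' hy]|hy].
    2:{ exists x, y, w. split; [tauto|]. eapply Z.divide_trans; [|exact hw].
        exists (p ^ (4 * Z.of_nat (S j))). rewrite <- Z.pow_add_r by lia. reflexivity. }
    subst x y.
    assert (E : quart a B c (x' * p) (y' * p) = p ^ 4 * quart a B c x' y') by (unfold quart; ring).
    rewrite E in hw.
    assert (Epow : p ^ (4 * Z.of_nat (S j) + 3) = p ^ 4 * p ^ (4 * Z.of_nat j + 3)).
    { rewrite <- Z.pow_add_r by lia. f_equal. lia. }
    rewrite Epow in hw.
    assert (h4 : (p ^ 4 | w * w)).
    { destruct hw as [q hq]. exists (q * p ^ (4 * Z.of_nat j + 3) + quart a B c x' y'). lia. }
    apply prime_pow4_dvd in h4; auto. destruct h4 as [w' hw']. subst w.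
    apply (IH x' y' w').
    + intros [[r hr] [t ht]]. apply hxy. rewrite Nat2Z.inj_succ, Z.pow_succ_r by lia.
      split; [exists r; subst x'|exists t; subst y']; ring.
    + destruct hw as [q hq]. exists q.
      apply (Z.mul_reg_l _ _ (p ^ 4)). { apply Z.pow_nonzero; lia. }
      transitivity (w' * p ^ 2 * (w' * p ^ 2) - p ^ 4 * quart a B c x' y'); [ring|].
      rewrite hq. ring.
Qed.

Lemma coherent_ge (p : Z) (u : nat -> Z) : prime p -> padic_coherent p u ->
  forall k i : nat, (p ^ Z.of_nat k | u (i + k)%nat - u k).
Proof.
  intros hp h k. pose proof (prime_ge_2 p hp) as p2. induction i as [|i IH].
  - simpl. rewrite Z.sub_diag. apply Z.divide_0_r.
  - replace (u (S i + k)%nat - u k) with ((u (S (i + k)) - u (i + k)%nat) + (u (i + k)%nat - u k)) by (simpl; ring).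
    apply Z.divide_add_r; auto. eapply Z.divide_trans; [|apply h].
    exists (p ^ Z.of_nat i). rewrite <- Z.pow_add_r by lia. f_equal. lia.
Qed.

(** The precision [p^3] is chosen for [local_coprime], where [p^2] is cancelled from the congruence
    and a factor [p] must remain. *)
Lemma padic_primitive (p a B c : Z) : prime p -> padic_soluble p a B c ->
  exists x y w, ~ ((p | x) /\ (p | y)) /\ (p ^ 3 | w * w - quart a B c x y).
Proof.
  intros hp (X & Y & W & cX & cY & cW & [k hk] & hf).
  (* [K = 4 k + 3] is the precision that [primitive_descent] asks for, written as [i + k] so that
     [coherent_ge] compares level [K] with level [k]. *)
  set (K := (3 * k + 3 + k)%nat).
  apply (primitive_descent p a B c hp k (X K) (Y K) (W K)).
  - intros [h1 h2]. apply hk. split.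
    + replace (X k) with (X K - (X K - X k)) by ring.
      apply Z.divide_sub_r; auto. apply coherent_ge; auto.
    + replace (Y k) with (Y K - (Y K - Y k)) by ring.
      apply Z.divide_sub_r; auto. apply coherent_ge; auto.
  - replace (4 * Z.of_nat k + 3) with (Z.of_nat K) by (unfold K; lia). apply hf.
Qed.

(** Here [p^2] divides [c], because [a c = n^2], so the form is [a x^4] modulo [p]. If [p] does not
    divide [x], then [k = x^2] and [t = w] exhibit [a] as a square. If [p] divides [x], it divides
    [w] too, and cancelling [p^2] leaves [w1^2 = c2 y^4] modulo [p]; as [a c2 = n1^2], again
    [a w1^2] is a square. *)
Lemma local_coprime (p a n c B : Z) : prime p -> padic_soluble p a B c ->
  a * c = n * n -> (p | n) -> ~ (p * p | n) -> ~ (p | a) -> (p | B) ->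
  exists k t, ~ (p | k) /\ (p | a * (k * k) - t * t).
Proof.
  intros hp hs hac [n1 hn] hn2 ha [b hb]. pose proof (prime_ge_2 p hp) as p2.
  destruct (padic_primitive p a B c hp hs) as (x & y & w & hxy & [q hq]).
  unfold quart in hq. subst n B.
  assert (hc : (p * p | c)).
  { assert (h1 : (p | c)).
    { assert (h : (p | a * c)) by (exists (n1 * n1 * p); rewrite hac; ring).
      destruct (prime_mult p hp a c h); tauto. }
    destruct h1 as [c1 hc1]. subst c.
    assert (h : (p | a * c1)).
    { exists (n1 * n1). apply (Z.mul_reg_l _ _ p); [lia|].
      transitivity (a * (c1 * p)); [ring|]. rewrite hac. ring. }
    destruct (prime_mult p hp a c1 h) as [|[c2 hc2]]; [tauto|]. exists c2. subst c1. ring. }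
  destruct hc as [c2 hc2]. subst c.
  assert (hac2 : a * c2 = n1 * n1).
  { apply (Z.mul_reg_l _ _ (p * p)); [nia|]. transitivity (a * (c2 * (p * p))); [ring|]. rewrite hac. ring. }
  assert (n1p : ~ (p | n1)).
  { intros [m hm]. apply hn2. exists m. subst n1. ring. }
  destruct (Zdivide_dec p x) as [[x1 hx]|hx].
  - assert (hy : ~ (p | y)) by (intros h; apply hxy; split; [exists x1|]; assumption).
    subst x.
    assert (h1 : (p | w)).
    { apply prime_sq_dvd; auto.
      exists (q * p ^ 2 + (a * (x1 ^ 4 * p ^ 3) + b * x1 ^ 2 * p ^ 2 * y ^ 2 + c2 * p * y ^ 4)).
      transitivity (q * p ^ 3 + (a * (x1 * p) ^ 4 + b * p * (x1 * p) ^ 2 * y ^ 2 + c2 * (p * p) * y ^ 4)); [lia|ring]. }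
    destruct h1 as [w1 hw1]. subst w.
    assert (e : w1 * w1 - c2 * y ^ 4 = p * (q + a * x1 ^ 4 * p + b * x1 ^ 2 * y ^ 2)).
    { apply (Z.mul_reg_l _ _ (p * p)); [nia|].
      transitivity (w1 * p * (w1 * p) - (a * (x1 * p) ^ 4 + b * p * (x1 * p) ^ 2 * y ^ 2 + c2 * (p * p) * y ^ 4)
         + (a * (x1 * p) ^ 4 + b * p * (x1 * p) ^ 2 * y ^ 2)); [ring|]. rewrite hq. ring. }
    exists w1, (n1 * (y * y)). split.
    + intros h. assert (h2 : (p | a * (c2 * y ^ 4))).
      { apply Z.divide_mul_r. replace (c2 * y ^ 4) with (w1 * w1 - (w1 * w1 - c2 * y ^ 4)) by ring.
        apply Z.divide_sub_r. apply Z.divide_mul_l; auto. rewrite e. apply Z.divide_factor_l. }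
      replace (a * (c2 * y ^ 4)) with (n1 * y * (n1 * y) * (y * y)) in h2
        by (transitivity (n1 * n1 * y ^ 4); [ring|rewrite <- hac2; ring]).
      apply prime_mult in h2; auto. destruct h2 as [h2|h2]; apply prime_sq_dvd in h2; auto.
      apply prime_mult in h2; auto. tauto.
    + exists (a * (q + a * x1 ^ 4 * p + b * x1 ^ 2 * y ^ 2)).
      transitivity (a * (w1 * w1 - c2 * y ^ 4) + (a * c2 - n1 * n1) * y ^ 4); [ring|].
      rewrite e, hac2. ring.
  - exists (x * x), w. split.
    + intros h. apply prime_sq_dvd in h; auto.
    + exists (- (q * p ^ 2 + b * x ^ 2 * y ^ 2 + c2 * p * y ^ 4)).
      transitivity (- (w * w - (a * x ^ 4 + b * p * x ^ 2 * y ^ 2 + c2 * (p * p) * y ^ 4))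
         - (b * p * x ^ 2 * y ^ 2 + c2 * (p * p) * y ^ 4)); [ring|]. rewrite hq. ring.
Qed.

(* For p | a, dividing the form by p gives a1 g = z^2 - 2 t^2 with z = a1 x^2 + 3 s n1 y^2
   and t = 2 n1 y^2; since 3 - 2 sqrt 2 = (1 - sqrt 2)^2, also - s n1 a1 (2xy)^2 = (t - s z)^2. *)
Lemma local_dvd (p a n c m s : Z) : prime p -> p <> 2 -> s * s = 1 ->
  padic_soluble p a (s * 6 * n) c ->
  a * c = n * n -> n = a * m -> ~ (p * p | n) -> (p | a) ->
  exists t z k r, ~ (p | t) /\ (p | 2 * (t * t) - z * z) /\
    ~ (p | k) /\ (p | - s * m * (k * k) - r * r).
Proof.
  intros hp hp2 hss hs hac hn hn2 [a1 ha]. pose proof (prime_ge_2 p hp) as p2.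
  destruct (padic_primitive p a _ c hp hs) as (x & y & w & hxy & [q hq]).
  unfold quart in hq. subst a.
  set (n1 := a1 * m) in *.
  assert (hn1 : n = n1 * p) by (unfold n1; rewrite hn; ring).
  assert (n1p : ~ (p | n1)).
  { intros [v hv]. apply hn2. exists v. rewrite hn1, hv. ring. }
  assert (a1p : ~ (p | a1)) by (intros h; apply n1p; unfold n1; apply Z.divide_mul_l; exact h).
  assert (hc : exists c1, c = c1 * p /\ a1 * c1 = n1 * n1).
  { assert (e : a1 * c = p * (n1 * n1)).
    { apply (Z.mul_reg_l _ _ p); [lia|]. transitivity (a1 * p * c); [ring|]. rewrite hac, hn1. ring. }
    assert (h : (p | a1 * c)) by (exists (n1 * n1); rewrite e; ring).
    destruct (prime_mult p hp a1 c h) as [|[c1 hc1]]; [tauto|].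
    exists c1. split; auto. subst c. apply (Z.mul_reg_l _ _ p); [lia|].
    transitivity (a1 * (c1 * p)); [ring|exact e]. }
  destruct hc as (c1 & hc1 & hac1). subst c. rewrite hn1 in hq.
  assert (c1p : ~ (p | c1)).
  { intros h. assert (h2 : (p | n1 * n1)) by (rewrite <- hac1; apply Z.divide_mul_r; exact h).
    apply prime_sq_dvd in h2; auto. }
  set (g := a1 * x ^ 4 + 6 * s * n1 * x ^ 2 * y ^ 2 + c1 * y ^ 4).
  assert (hq' : w * w - p * g = q * p ^ 3) by (rewrite <- hq; unfold g; ring).
  (* [w^2] is [p g] modulo [p^3], so [p] divides [w], and then [p^2] divides [p g]. *)
  assert (hg : (p | g)).
  { assert (h1 : (p | w)).
    { apply prime_sq_dvd; auto. exists (g + q * p ^ 2). transitivity (p * g + q * p ^ 3); [lia|ring]. }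
    destruct h1 as [w1 hw]. exists (w1 * w1 - q * p).
    apply (Z.mul_reg_l _ _ p); [lia|]. subst w. transitivity (w1 * p * (w1 * p) - q * p ^ 3); [lia|ring]. }
  assert (hy : ~ (p | y)).
  { intros h. apply hxy. split; auto.
    assert (h2 : (p | a1 * (x * x * (x * x)))).
    { replace (a1 * (x * x * (x * x))) with (g - y * (6 * s * n1 * x ^ 2 * y + c1 * y ^ 3)) by (unfold g; ring).
      apply Z.divide_sub_r; auto. apply Z.divide_mul_l; auto. }
    apply prime_mult in h2; auto. destruct h2 as [|h2]; [tauto|].
    apply prime_sq_dvd in h2; auto. apply prime_sq_dvd in h2; auto. }
  assert (hx : ~ (p | x)).
  { intros h. apply hy.
    assert (h2 : (p | c1 * (y * y * (y * y)))).
    { replace (c1 * (y * y * (y * y))) with (g - x * (6 * s * n1 * y ^ 2 * x + a1 * x ^ 3)) by (unfold g; ring).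
      apply Z.divide_sub_r; auto. apply Z.divide_mul_l; auto. }
    apply prime_mult in h2; auto. destruct h2 as [|h2]; [tauto|].
    apply prime_sq_dvd in h2; auto. apply prime_sq_dvd in h2; auto. }
  assert (h2p : ~ (p | 2)).
  { intros h. apply Z.divide_pos_le in h; lia. }
  set (t := 2 * n1 * (y * y)). set (z := a1 * (x * x) + 3 * s * n1 * (y * y)).
  assert (E : z * z - 2 * (t * t) = a1 * g).
  { unfold z, t, g.
    transitivity (a1 * (a1 * x ^ 4 + 6 * s * n1 * x ^ 2 * y ^ 2) + (9 * (s * s) - 8) * (n1 * n1) * y ^ 4); [ring|].
    rewrite hss, <- hac1. ring. }
  destruct hg as [g1 hg1].
  exists t, z, (2 * a1 * x * y), (t - s * z). repeat split.
  - unfold t. intros h. apply prime_mult in h; auto. destruct h as [h|h].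
    + apply prime_mult in h; auto. tauto.
    + apply prime_sq_dvd in h; auto.
  - exists (- a1 * g1). transitivity (- (z * z - 2 * (t * t))); [ring|]. rewrite E, hg1. ring.
  - intros h. apply prime_mult in h; auto. destruct h as [h|h]; [|tauto].
    apply prime_mult in h; auto. destruct h as [h|h]; [|tauto].
    apply prime_mult in h; auto. tauto.
  - exists (- a1 * g1).
    transitivity (- (z * z - 2 * (t * t)) + ((z * z) * (1 - s * s)
       + 4 * y ^ 2 * (- s * (a1 * m) * (a1 * x ^ 2) + s * n1 * z) - 3 * (t * t)));
      [unfold t; ring|].
    rewrite E, hg1, hss. fold n1. unfold z, t.
    transitivity (- (a1 * (g1 * p)) + 12 * (s * s - 1) * n1 * n1 * y ^ 4); [ring|].
    rewrite hss. ring.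
Qed.

End LocalSolubility.

(** * Rational points: clearing denominators, local solubility, and the form with [a = 1] *)

Lemma rat_soluble_int (a B c : Z) : rat_soluble a B c ->
  exists x y z : Z, ~ (x = 0 /\ y = 0)%Z /\
    (z * z = a * x ^ 4 + B * x ^ 2 * y ^ 2 + c * y ^ 4)%Z.
Proof.
  intros ([x1 dx] & [y1 dy] & [z1 dz] & hxy & h).
  (* With [P] the product of the three denominators, this is the point [(P x, P y, P^2 z)]; the form
     has degree 4. *)
  exists (x1 * (Z.pos dy * Z.pos dz))%Z, (y1 * (Z.pos dx * Z.pos dz))%Z,
    (z1 * (Z.pos dx * Z.pos dy * (Z.pos dx * Z.pos dy * Z.pos dz)))%Z.
  split.
  - intros [hx hy]. apply hxy. unfold Qeq; simpl. nia.
  - apply eq_IZR.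
    apply Qeq_eqR in h.
    repeat rewrite ?Q2R_plus, ?Q2R_mult in h. unfold inject_Z, Q2R in h. simpl in h.
    rewrite !Rinv_1, !Rmult_1_r in h.
    rewrite !plus_IZR, !mult_IZR, <- !(pow_IZR _ 4), <- !(pow_IZR _ 2), !mult_IZR.
    assert (px : IZR (Z.pos dx) <> 0%R) by (apply not_0_IZR; lia).
    assert (py : IZR (Z.pos dy) <> 0%R) by (apply not_0_IZR; lia).
    assert (pz : IZR (Z.pos dz) <> 0%R) by (apply not_0_IZR; lia).
    revert h px py pz.
    generalize (IZR x1) (IZR y1) (IZR z1) (IZR (Z.pos dx)) (IZR (Z.pos dy)) (IZR (Z.pos dz)) (IZR a) (IZR B) (IZR c).
    intros x y z p q r a' B' c' h hp hq hr.
    transitivity ((z * / r * (z * / r)) * (p * q * r) ^ 4)%R; [field; auto|].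
    rewrite h. field; auto.
Qed.

Lemma rat_soluble_locally (a B c : Z) : rat_soluble a B c -> locally_soluble a B c.
Proof.
  intros h. destruct (rat_soluble_int a B c h) as (x & y & z & hxy & e). split.
  - exists (IZR x), (IZR y), (IZR z). split.
    + intros [hx hy]. apply hxy. split; apply eq_IZR; assumption.
    + rewrite <- mult_IZR, e, !plus_IZR, !mult_IZR, <- !(pow_IZR _ 4), <- !(pow_IZR _ 2). reflexivity.
  - intros p hp. pose proof (prime_ge_2 p hp) as p2.
    exists (fun _ => x), (fun _ => y), (fun _ => z).
    assert (K : forall u, padic_coherent p (fun _ => u)).
    { intros u k. rewrite Z.sub_diag. apply Z.divide_0_r. }
    repeat split; auto.
    (* [p^(|x| + |y|)] exceeds both [|x|] and [|y|], so it divides no nonzero coordinate. *)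
    + exists (Z.to_nat (Z.abs x + Z.abs y)). intros [h1 h2]. apply hxy.
      rewrite Z2Nat.id in h1, h2 by lia.
      pose proof (Z.pow_gt_lin_r p (Z.abs x + Z.abs y)) as hlt.
      split.
      * destruct (Z.eq_dec x 0) as [|nx]; auto. exfalso.
        apply Z.divide_abs_r, Z.divide_pos_le in h1; lia.
      * destruct (Z.eq_dec y 0) as [|ny]; auto. exfalso.
        apply Z.divide_abs_r, Z.divide_pos_le in h2; lia.
    + intros k. rewrite e, Z.sub_diag. apply Z.divide_0_r.
Qed.

Lemma filter_length_le (A : Type) (f g : A -> bool) (l : list A) :
  (forall x, f x = true -> g x = true) -> (length (filter f l) <= length (filter g l))%nat.
Proof.
  intros h. induction l as [|x l IH]; simpl; auto.
  destruct (f x) eqn:e; [rewrite (h x e); simpl; lia|].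
  destruct (g x); simpl; lia.
Qed.

Lemma decP_true (P : Prop) : decP P = true <-> P.
Proof.
  unfold decP. destruct (ClassicalEpsilon.excluded_middle_informative P); split; auto; discriminate.
Qed.

Lemma count_sol_le_ls (B M : Z) : (count_sol B M <= count_ls B M)%nat.
Proof.
  apply filter_length_le. intros a. rewrite !decP_true. intros [h1 h2].
  split; auto. apply rat_soluble_locally; assumption.
Qed.

Lemma count_sol_ge1 (B M : Z) : (0 < M)%Z -> (1 <= count_sol B M)%nat.
Proof.
  intros hM. unfold count_sol, countF.
  assert (h : In 1%Z (filter (fun a : Z => decP (in_F M a /\ rat_soluble a B (M / a))) (Zrange M))).
  { apply filter_In. split.
    - apply in_map_iff. exists (Z.to_nat (1 + M)). split; [lia|].
      apply in_seq. lia.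
    - apply decP_true. split; [split|].
      + exists M. lia.
      + intros p hp hd. pose proof (prime_ge_2 p hp). apply Z.divide_pos_le in hd; [nia|lia].
      + exists 1%Q, 0%Q, 1%Q. split; [intros [h _]; discriminate|]. change (inject_Z 1) with 1%Q. ring. }
  destruct (filter _ _); [destruct h|simpl; lia].
Qed.

Module LocallySolubleCount.
Import all_boot all_order all_algebra all_fingroup all_solvable all_field.
Import reals sequences exp ring lra zify ssrZ.
Set Implicit Arguments. Unset Strict Implicit. Unset Printing Implicit Defensive.
Import Order.TTheory GRing.Theory Num.Theory.
Local Open Scope ring_scope.
Delimit Scope Z_scope with ZZ.

(** * The Jacobi symbol *)

(* Euler's criterion; the junk value 0 is used for p <= 2. *)
Definition leg (a : int) (p : nat) : int :=
  if (p <= 2)%N then 0 else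
  let x := (a%:~R : 'F_p) ^+ p.-1./2 in
  if x == 0 then 0 else if x == 1 then 1 else -1.

Lemma intr_Fp_eq (p : nat) (a b : int) : prime p ->
  ((a%:~R : 'F_p) == b%:~R) = (p%:Z %| a - b)%Z.
Proof.
move=> pp; rewrite -subr_eq0 -rmorphB /=.
have [[z ->]|[z ->]] : (exists z : nat, a - b = z%:Z) \/ (exists z : nat, a - b = - z%:Z).
- by case: (a - b) => n; [left; exists n | right; exists n.+1].
- by rewrite -(dvdn_pcharf (pchar_Fp pp)).
- by rewrite rmorphN oppr_eq0 -(dvdn_pcharf (pchar_Fp pp)) dvdzE abszN.
Qed.

Lemma intr_pchar (F : fieldType) (p : nat) (a b : int) : p \in [pchar F] ->
  (p%:Z %| a - b)%Z -> (a%:~R : F) = b%:~R.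
Proof.
move=> cp /dvdzP [k hk]; apply/eqP; rewrite -subr_eq0 -rmorphB /= hk rmorphM /=.
by rewrite -[_%:~R in X in _ * X]/(p%:R) pcharf0 // mulr0.
Qed.

Lemma leg_val (a : int) (p : nat) : leg a p \in [:: 0; 1; -1].
Proof. by rewrite /leg; do 3?[case: ifP => _]. Qed.

Lemma leg_cases (a : int) (p : nat) : [\/ leg a p = 0, leg a p = 1 | leg a p = -1].
Proof.
by have := leg_val a p; rewrite !inE => /or3P[] /eqP->;
  [constructor 1|constructor 2|constructor 3].
Qed.

Lemma half_oddp (p : nat) : prime p -> (2 < p)%N -> (p.-1 = p.-1./2 * 2)%N.
Proof.
move=> pp p2; have : odd p by case: (even_prime pp) p2 => // ->.
by case: p {pp p2} => // p /= op; rewrite muln2 -[LHS]odd_double_half (negbTE op).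
Qed.

Lemma Fp_halfpow (p : nat) (x : 'F_p) : prime p -> (2 < p)%N ->
  x != 0 -> (x ^+ p.-1./2 == 1) || (x ^+ p.-1./2 == -1).
Proof.
move=> pp p2 x0; rewrite -sqrf_eq1 -exprM -half_oddp //.
have := expf_card x; rewrite card_Fp // => h.
by rewrite -(inj_eq (mulfI x0)) -exprS prednK ?prime_gt0 // h mulr1.
Qed.

Lemma leg_intr (a : int) (p : nat) : prime p -> (2 < p)%N ->
  ((leg a p)%:~R : 'F_p) = a%:~R ^+ p.-1./2.
Proof.
move=> pp p2; rewrite /leg leqNgt p2 /=.
case: eqP => [->//|/eqP x0]; case: eqP => [->//|/eqP x1].
have a0 : (a%:~R : 'F_p) != 0.
  by apply: contra x0 => /eqP ->; rewrite expr0n gtn_eqF //; have := half_oddp pp p2; lia.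
by have := Fp_halfpow pp p2 a0; rewrite (negbTE x1) /= => /eqP ->.
Qed.

(** Identities between symbols are proved in a field where 2 is nonzero, by Euler's criterion or a
    Gauss sum; this lifts them back to the integers. *)
Lemma small_inj (F : fieldType) (x y : int) : (2%:R : F) != 0 ->
  x \in [:: 0; 1; -1] -> y \in [:: 0; 1; -1] -> (x%:~R : F) = y%:~R -> x = y.
Proof.
move=> h2; have h1 : (1 : F) != 0 by apply: oner_neq0.
have h3 : (1 : F) != -1 by rewrite -subr_eq0 opprK -mulr2n.
rewrite !inE => /or3P[] /eqP-> /or3P[] /eqP-> //=; rewrite ?rmorphN ?rmorph1 ?rmorph0 => /eqP;
  rewrite ?oppr_eq0 ?(eq_sym 0) ?oppr_eq0 ?(negbTE h1) ?(negbTE h3) //.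
by rewrite eq_sym (negbTE h3).
Qed.

Lemma Fp2 (p : nat) : prime p -> (2 < p)%N -> (2%:R : 'F_p) != 0.
Proof.
move=> pp p2; rewrite -(dvdn_pcharf (pchar_Fp pp)).
by apply/negP => /(dvdn_leq (isT : (0 < 2)%N)); rewrite leqNgt p2.
Qed.

Lemma legM (a b : int) (p : nat) : prime p -> leg (a * b) p = leg a p * leg b p.
Proof.
move=> pp; have [p2|p2] := leqP p 2; first by rewrite /leg p2 mulr0.
apply: (small_inj (Fp2 pp p2)); rewrite ?leg_val //.
  by case: (leg_cases a p) => ->; case: (leg_cases b p) => ->.
by rewrite rmorphM /= !leg_intr // rmorphM /= exprMn.
Qed.

Lemma leg1 (p : nat) : prime p -> (2 < p)%N -> leg 1 p = 1.
Proof. by move=> pp p2; rewrite /leg leqNgt p2 /= expr1n oner_eq0 eqxx. Qed.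

Lemma leg_mod (a b : int) (p : nat) : prime p -> (p%:Z %| a - b)%Z -> leg a p = leg b p.
Proof. by move=> pp h; rewrite /leg; move: h; rewrite -intr_Fp_eq // => /eqP ->. Qed.

Lemma leg_eq0 (a : int) (p : nat) : prime p -> (2 < p)%N ->
  (leg a p == 0) = (p%:Z %| a)%Z.
Proof.
move=> pp p2; have h : (0 < p.-1./2)%N by have := half_oddp pp p2; lia.
have := intr_Fp_eq a 0 pp; rewrite subr0 => <-.
have := intr_Fp_eq (leg a p) 0 pp; rewrite subr0 leg_intr // expf_eq0 h /= => ->.
have p3 : (1 < p)%N by apply: prime_gt1.
by case: (leg_cases a p) => ->; rewrite ?dvdz0 // dvdzE /= dvdn1; lia.
Qed.

Lemma leg_sq (a x : int) (p : nat) : prime p -> (2 < p)%N ->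
  ~~ (p%:Z %| a)%Z -> (p%:Z %| a - x * x)%Z -> leg a p = 1.
Proof.
move=> pp p2 h0 h; rewrite (leg_mod pp h) legM //.
have : leg a p != 0 by rewrite leg_eq0.
by rewrite (leg_mod pp h) legM //; case: (leg_cases x p) => ->.
Qed.

(** The polynomial [x^((p-1)/2) - 1] has at most [(p-1)/2] roots, so some nonzero class is not a
    root, and its power is then -1. *)
Lemma leg_nonres (p : nat) : prime p -> (2 < p)%N -> exists a : nat, leg a%:Z p = -1.
Proof.
move=> pp p2; set h := p.-1./2; have hh := half_oddp pp p2.
have h0 : (0 < h)%N by rewrite /h; lia.
have [x x0 xh] : exists2 x : 'F_p, x != 0 & x ^+ h != 1.
  have [/existsP[x /andP[]]|/existsPn H] := boolP [exists x : 'F_p, (x != 0) && (x ^+ h != 1)].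
    by exists x.
  have U : all h.-unity_root [seq x <- enum 'F_p | x != 0].
    apply/allP => x; rewrite mem_filter => /andP[x0 _].
    by have := H x; rewrite x0 /= negbK unity_rootE.
  have := max_unity_roots h0 U (filter_uniq _ (enum_uniq _)).
  rewrite size_filter.
  have -> : count (fun x : 'F_p => x != 0) (enum 'F_p) = p.-1.
    have := count_predC (pred1 (0:'F_p)) (enum 'F_p).
    rewrite (count_uniq_mem _ (enum_uniq _)) mem_enum /= -cardE card_Fp //= => e.
    by rewrite -[in RHS]e add1n.
  by rewrite /h in h0 *; lia.
exists (x : nat).
rewrite /leg leqNgt p2 /= -pmulrn natr_Zp.
have /orP[/eqP e|/eqP ->] := Fp_halfpow pp p2 x0; first by rewrite e eqxx in xh.
rewrite oppr_eq0 oner_eq0; case: eqP => // e; have := Fp2 pp p2; by rewrite mulr2n -{1}e addNr eqxx.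
Qed.

(** In the field with [q^(p-1)] elements, Fermat's theorem makes [p] divide the order of the unit
    group, and Cauchy's theorem gives a [z] of order [p]. *)
Lemma exists_root_field (p q : nat) : prime p -> prime q -> p != q ->
  exists (K : finFieldType) (z : K), [/\ q \in [pchar K], z ^+ p = 1 & z != 1].
Proof.
move=> pp pq npq.
have p1 : (0 < p.-1)%N by have := prime_gt1 pp; lia.
have [K cK cardK] := pPrimePowerField pq p1.
exists K.
have dv : (p %| #|[set: {unit K}]|)%N.
  rewrite card_finField_unit cardK -subn1 -eqn_mod_dvd ?expn_gt0 ?prime_gt0 //.
  by rewrite -(totient_prime pp) Euler_exp_totient // prime_coprime // dvdn_prime2 // eq_sym.
have [x _ ox] := Cauchy pp dv.
exists (FinRing.uval x); split=> //.
- by rewrite -FinRing.val_unitX -ox expg_order.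
- apply/eqP => e; have xe : x = 1%g by apply: val_inj.
  by move: ox pp; rewrite xe order1 => <-.
Qed.

(** * Quadratic reciprocity from a Gauss sum in characteristic [q] *)

Section GaussSum.
Variables (p q : nat) (K : finFieldType) (z : K).
Hypotheses (pp : prime p) (pq : prime q) (p2 : (2 < p)%N) (q2 : (2 < q)%N).
Hypotheses (npq : p != q) (cK : q \in [pchar K]) (zp : z ^+ p = 1) (z1 : z != 1).

Let e (x : 'F_p) : K := z ^+ (x : nat).
Let chi (x : 'F_p) : K := (leg (x : nat)%:Z p)%:~R.

Let natFp (n : nat) : ((n%:R : 'F_p) : nat) = (n %% p)%N.
Proof. by rewrite val_Fp_nat. Qed.

Let eD x y : e (x + y) = e x * e y.
Proof.
rewrite /e -exprD -[in LHS](natr_Zp x) -[in LHS](natr_Zp y) -natrD natFp.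
by rewrite (expr_mod _ zp).
Qed.

Let chi_nat (n : nat) : chi n%:R = (leg n%:Z p)%:~R.
Proof.
rewrite /chi natFp; congr (_%:~R); apply: leg_mod => //.
by rewrite -intr_Fp_eq // -[X in X == _]/((n %% p)%:R) -natFp natr_Zp.
Qed.

Let chiM x y : chi (x * y) = chi x * chi y.
Proof.
by rewrite -(natr_Zp x) -(natr_Zp y) -natrM !chi_nat PoszM legM // rmorphM.
Qed.

Let chi0 : chi 0 = 0.
Proof. by rewrite -[0]/(0%:R) chi_nat; have /eqP -> : leg 0%:Z p == 0 by rewrite leg_eq0. Qed.

Let leg_n0 (x : 'F_p) : x != 0 -> leg (x : nat)%:Z p != 0.
Proof.
move=> x0; rewrite leg_eq0 // dvdzE /=; apply: contra x0.
by rewrite (dvdn_pcharf (pchar_Fp pp)) natr_Zp.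
Qed.

Let chisq x : x != 0 -> chi x * chi x = 1.
Proof.
move=> x0; rewrite /chi; case: (leg_cases (x:nat) p) (leg_n0 x0) => ->; rewrite ?eqxx // => _.
  by rewrite mulr1.
by rewrite rmorphN mulrNN mulr1.
Qed.

Let sum_chi : \sum_(x : 'F_p) chi x = 0.
Proof.
have [a ha] := leg_nonres pp p2.
have a0 : (a%:R : 'F_p) != 0.
  apply/eqP => h; have := chi_nat a; rewrite h chi0 ha => /eqP.
  by rewrite rmorphN eq_sym oppr_eq0 oner_eq0.
have E : \sum_(x : 'F_p) chi x = - \sum_(x : 'F_p) chi x.
  rewrite [LHS](reindex (fun x => a%:R * x)) /=; last first.
    by exists (fun x => a%:R^-1 * x) => x _; rewrite mulrA ?mulVf ?mulfV // mul1r.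
  by rewrite -sumrN; apply: eq_bigr => x _; rewrite chiM chi_nat ha rmorphN mulN1r.
have : (2%:R : K) * \sum_(x : 'F_p) chi x = 0 by rewrite mulr2n mulrDl mul1r {1}E addNr.
move/eqP; rewrite mulf_eq0 => /orP[|/eqP //].
rewrite -(dvdn_pcharf cK) => /(dvdn_leq (isT : (0 < 2)%N)); by rewrite leqNgt q2.
Qed.

Let e1 : e 1 = z.
Proof. by []. Qed.

Let sum_e : \sum_(x : 'F_p) e x = 0.
Proof.
have E : \sum_(x : 'F_p) e x = z * \sum_(x : 'F_p) e x.
  rewrite [LHS](reindex (fun x => 1 + x)) /=; last first.
    by exists (fun x => -1 + x) => x _; rewrite addrA ?addNr ?subrr add0r.
  rewrite mulr_sumr; apply: eq_bigr => x _; rewrite eD; congr (_ * _).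
have : (1 - z) * \sum_(x : 'F_p) e x = 0 by rewrite mulrBl mul1r -E subrr.
move/eqP; rewrite mulf_eq0 subr_eq0 eq_sym (negbTE z1).
by move/eqP.
Qed.

Let sum_eM (c : 'F_p) : \sum_(x : 'F_p | x != 0) e (x * c) = (if c == 0 then p%:R else 0) - 1.
Proof.
have -> : \sum_(x : 'F_p | x != 0) e (x * c) = \sum_(x : 'F_p) e (x * c) - 1.
  by rewrite [in RHS](bigD1 0) //= mul0r [X in _ = X + _ - _]/e expr0 addrAC subrr add0r.
congr (_ - 1); case: eqP => [->|/eqP c0].
  rewrite (eq_bigr (fun=> 1)) => [|x _]; last by rewrite mulr0 /e expr0.
  by rewrite sumr_const card_Fp.
rewrite -[RHS]sum_e [RHS](reindex (fun x => x * c)) //=.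
by exists (fun x => x / c) => x _; rewrite -mulrA ?mulVf ?mulfV // mulr1.
Qed.

Let g := \sum_(x : 'F_p) chi x * e x.

(** Replacing [y] by [x y] in the second factor turns [chi x * chi (x y)] into [chi y]. The sum over
    nonzero [x] is then -1, with an extra [p] when [y = -1]; the -1 disappears because [chi] sums to
    0. *)
Let g_sq : g * g = chi (-1) * p%:R.
Proof.
have -> : g * g = \sum_(x : 'F_p | x != 0) \sum_(y : 'F_p) chi y * e (x * (1 + y)).
  rewrite {1}/g mulr_suml (bigD1 0) //= chi0 !mul0r add0r; apply: eq_bigr => x x0.
  rewrite mulr_sumr (reindex (fun y => x * y)) /=; last first.
    by exists (fun y => x^-1 * y) => y _; rewrite mulrA ?mulVf ?mulfV // mul1r.
  apply: eq_bigr => y _; rewrite chiM mulrDr mulr1 eD.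
  by have := chisq x0; move: (chi x) (chi y) (e x) (e (x*y)) => a b c d h; rewrite -[RHS]mul1r -h; ring.
rewrite exchange_big /=.
under eq_bigr => y _ do rewrite -mulr_sumr sum_eM.
have -> : \sum_(i : 'F_p) chi i * ((if 1 + i == 0 then p%:R else 0) - 1) =
   \sum_(i : 'F_p) (if i == -1 then chi i * p%:R else 0) - \sum_(i : 'F_p) chi i.
  rewrite -sumrB; apply: eq_bigr => i _; rewrite mulrBr mulr1; congr (_ - _).
  by rewrite addrC addr_eq0; case: eqP => // _; rewrite mulr0.
by rewrite sum_chi subr0 -big_mkcond big_pred1_eq.
Qed.

Let chi_q (x : 'F_p) : chi x ^+ q = chi x.
Proof.
have oq : odd q by case: (even_prime pq) q2 => // ->.
by rewrite /chi; case: (leg_cases (x:nat) p) => ->; rewrite ?expr1n // ?expr0n ?gtn_eqF ?prime_gt0 //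
  rmorphN /= -signr_odd oq expr1.
Qed.

(** Frobenius is additive, fixes the values of [chi] since [q] is odd, and sends [e x] to [e (q x)];
    reindexing by [q x] pulls out [chi q]. *)
Let g_q : g ^+ q = chi q%:R * g.
Proof.
have q0 : (q%:R : 'F_p) != 0.
  by rewrite -(dvdn_pcharf (pchar_Fp pp)) dvdn_prime2.
rewrite -(pFrobenius_autE cK) raddf_sum /=.
rewrite /g mulr_sumr [RHS](reindex (fun x => q%:R * x)) /=; last first.
  by exists (fun x => q%:R^-1 * x) => x _; rewrite mulrA ?mulVf ?mulfV // mul1r.
apply: eq_bigr => x _; rewrite (pFrobenius_autE cK) exprMn chi_q chiM mulrA mulrA chisq // mul1r.
congr (_ * _); rewrite /e -exprM -[in RHS](natr_Zp x) -natrM natFp (expr_mod _ zp).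
by rewrite mulnC.
Qed.

(** Compare two evaluations of [g^q]: by Frobenius, and as [g (g^2)^((q-1)/2)]. Since [g^2] is
    nonzero, [g] can be cancelled. *)
Lemma gauss_recip : (leg q%:Z p)%:~R = (leg (-1) p)%:~R ^+ q.-1./2 * p%:R ^+ q.-1./2 :> K.
Proof.
have pK : (p%:R : K) != 0 by rewrite -(dvdn_pcharf cK) dvdn_prime2 // eq_sym.
have c1 : chi (-1) = (leg (-1) p)%:~R.
  rewrite /chi; congr (_%:~R); apply: leg_mod => //.
  rewrite -intr_Fp_eq // -pmulrn natr_Zp rmorphN.
  by [].
have n1 : (-1 : 'F_p) != 0 by rewrite oppr_eq0 oner_eq0.
have g0 : g != 0.
  apply/eqP => h; have := g_sq; rewrite h mul0r => /esym /eqP; rewrite mulf_eq0 (negbTE pK) orbF.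
  by move/eqP => h2; have := chisq n1; rewrite h2 mul0r => /esym/eqP; rewrite oner_eq0.
rewrite -chi_nat -c1 -exprMn -g_sq -expr2 -exprM mulnC -half_oddp //.
by apply: (mulIf g0); rewrite -exprSr prednK ?prime_gt0 // g_q.
Qed.
End GaussSum.

Opaque leg.

Definition recip_sign (m n : nat) : int := if (m %% 4 == 3)%N && (n %% 4 == 3)%N then -1 else 1.

Lemma leg_m1 (p : nat) : prime p -> (2 < p)%N -> leg (-1) p = (-1) ^+ (p %% 4 == 3)%N.
Proof.
move=> pp p2; apply: (small_inj (Fp2 pp p2)); rewrite ?leg_val ?leg_intr //.
  by case: eqP.
have op : odd p by case: (even_prime pp) p2 => // ->.
rewrite rmorphXn /= rmorphN /= rmorph1 -signr_odd; congr (_ ^+ nat_of_bool _).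
by move: op p2; lia.
Qed.

Lemma leg_recip (p q : nat) : prime p -> prime q -> (2 < p)%N -> (2 < q)%N ->
  leg q%:Z p = recip_sign q p * leg p%:Z q.
Proof.
move=> pp pq p2 q2; have [<-|/eqP npq] := p =P q.
  by have /eqP -> : leg p p == 0 by [rewrite leg_eq0 // dvdzz]; rewrite mulr0.
have [K [z [cK zp z1]]] := exists_root_field pp pq npq.
have K2 : (2%:R : K) != 0.
  by rewrite -(dvdn_pcharf cK); apply/negP => /(dvdn_leq (isT : (0 < 2)%N)); rewrite leqNgt q2.
have oq : odd q by case: (even_prime pq) q2 => // ->.
apply: (small_inj K2); rewrite ?leg_val //.
  by rewrite /recip_sign; case: ifP => _; case: (leg_cases p q) => ->.
rewrite (gauss_recip pp pq p2 q2 npq cK zp z1) rmorphM /=; congr (_ * _).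
  rewrite leg_m1 // /recip_sign.
  rewrite rmorphXn /= rmorphN /= rmorph1 -exprM -signr_odd oddM oddb andbC.
  have -> : odd q.-1./2 = (q %% 4 == 3)%N by move: oq q2; lia.
  by case: ifP.
(* Euler's criterion modulo [q], carried from ['F_q] to [K], identifies [p^((q-1)/2)] with the
   symbol of [p] at [q]. *)
have : ((leg p q)%:~R : 'F_q) == (p%:Z ^+ q.-1./2)%:~R.
  by rewrite leg_intr // rmorphXn.
rewrite intr_Fp_eq // => /(intr_pchar cK) ->.
by rewrite rmorphXn.
Qed.

Lemma prime_ind (P : nat -> Prop) : P 1%N ->
  (forall p m, prime p -> (0 < m)%N -> P m -> P (p * m)%N) ->
  forall n, (0 < n)%N -> P n.
Proof.
move=> P1 Pp n; elim/ltn_ind: n => n IH n0.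
have [n1|n1] := leqP n 1; first by have -> : n = 1%N by lia.
have pp := pdiv_prime n1; have := pdiv_dvd n => /dvdnP [k hk].
rewrite hk mulnC; have k0 : (0 < k)%N by move: n0; rewrite hk muln_gt0 => /andP[].
by apply: Pp => //; apply: IH => //; rewrite hk ltn_Pmulr // prime_gt1.
Qed.

Lemma oddprime_ind (P : nat -> Prop) : P 1%N ->
  (forall p m, prime p -> (2 < p)%N -> odd m -> P m -> P (p * m)%N) ->
  forall n, odd n -> P n.
Proof.
move=> P1 Pp n on; have n0 : (0 < n)%N by case: n on.
move: n n0 on; apply: prime_ind => // p m pp m0 IH; rewrite oddM => /andP[op om].
by apply: Pp => //; [have := prime_gt1 pp; move: op; lia | apply: IH].
Qed.

(* Extended by 0 to even n. *)
Definition jac (a : int) (n : nat) : int :=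
  if odd n then \prod_(p < n.+1 | prime p) leg a p ^+ logn p n else 0.

Lemma jac_even a n : ~~ odd n -> jac a n = 0.
Proof. by rewrite /jac => /negbTE ->. Qed.

Lemma jac_widen a (n N : nat) : odd n -> (n <= N)%N ->
  jac a n = \prod_(p < N.+1 | prime p) leg a p ^+ logn p n.
Proof.
move=> on nN; rewrite /jac on.
rewrite (big_ord_widen_cond N.+1 prime (fun p => leg a p ^+ logn p n)) //.
rewrite big_mkcondr /=; apply: eq_bigr => p _.
case: ifP => // /negbT; rewrite -leqNgt => h.
by rewrite lognE; case: and3P => // -[_ n0 /(dvdn_leq n0)]; lia.
Qed.

Lemma jacM a (m n : nat) : jac a (m * n) = jac a m * jac a n.
Proof.
have [om|em] := boolP (odd m); last by rewrite (jac_even a em) mul0r jac_even // oddM (negbTE em).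
have [on|en] := boolP (odd n); last by rewrite (jac_even a en) mulr0 jac_even // oddM (negbTE en) andbF.
have m0 : (0 < m)%N by case: m om.
have n0 : (0 < n)%N by case: n on.
rewrite (@jac_widen a (m * n) (m * n)) ?oddM ?om //.
rewrite (@jac_widen a m (m * n)) ?leq_pmulr // (@jac_widen a n (m * n)) ?leq_pmull //.
by rewrite -big_split; apply: eq_bigr => p _; rewrite /= lognM // exprD.
Qed.

Lemma jacMl (a b : int) (n : nat) : jac (a * b) n = jac a n * jac b n.
Proof.
rewrite /jac; case: (odd n); last by rewrite mul0r.
by rewrite -big_split; apply: eq_bigr => p pp; rewrite /= legM // exprMn.
Qed.

Lemma jac1 a : jac a 1 = 1.
Proof. by rewrite /jac /= big1 // => p pp; rewrite logn1. Qed.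

Lemma jac_prime a p : prime p -> (2 < p)%N -> jac a p = leg a p.
Proof.
move=> pp p2; have op : odd p by case: (even_prime pp) p2 => // ->.
rewrite /jac op (bigD1 (inord p)) /= ?inordK // logn_prime // eqxx expr1.
rewrite big1 ?mulr1 // => q /andP[pq qp]; rewrite logn_prime //.
by case: eqP => // e; case/negP: qp; apply/eqP/val_inj; rewrite /= inordK.
Qed.

Lemma jac_mod a b n : (n%:Z %| a - b)%Z -> jac a n = jac b n.
Proof.
move=> h; rewrite /jac; case on : (odd n); last by [].
apply: eq_bigr => p pp.
rewrite lognE; case: and3P => [[_ _ dv]|_]; last by rewrite !expr0.
have -> // : leg a p = leg b p; apply: (leg_mod pp).
by apply: dvdz_trans h; rewrite dvdzE.
Qed.

Lemma jac_cases a n : [\/ jac a n = 0, jac a n = 1 | jac a n = -1].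
Proof.
have [on|en] := boolP (odd n); last by constructor 1; rewrite jac_even.
move: n on; apply: oddprime_ind => [|p m pp p2 om]; first by rewrite jac1; constructor 2.
rewrite jacM (jac_prime a pp p2); case: (leg_cases a p) => -> [] ->; rewrite ?mul0r ?mulr0 ?mul1r ?mulN1r ?opprK;
 by [constructor 1|constructor 2|constructor 3].
Qed.

Lemma jac1l n : odd n -> jac 1 n = 1.
Proof.
move: n; apply: oddprime_ind => [|p m pp p2 om IH]; first by rewrite jac1.
by rewrite jacM (jac_prime _ pp p2) leg1 // IH.
Qed.

Lemma jac_m1 n : odd n -> jac (-1) n = if (n %% 4 == 3)%N then -1 else 1.
Proof.
move: n; apply: oddprime_ind => [|p m pp p2 om IH]; first by rewrite jac1.
have op : odd p by case: (even_prime pp) p2 => // ->.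
rewrite jacM (jac_prime _ pp p2) leg_m1 // IH -modnMm.
have : (p %% 4 == 1)%N || (p %% 4 == 3)%N by move: op; lia.
have : (m %% 4 == 1)%N || (m %% 4 == 3)%N by move: om; lia.
by move=> /orP[] /eqP -> /orP[] /eqP ->.
Qed.

Lemma recip_signM p m n : odd p -> odd m -> recip_sign (p * m) n = recip_sign p n * recip_sign m n.
Proof.
move=> op om; rewrite /recip_sign -modnMm.
have : (p %% 4 == 1)%N || (p %% 4 == 3)%N by move: op; lia.
have : (m %% 4 == 1)%N || (m %% 4 == 3)%N by move: om; lia.
by move=> /orP[] /eqP -> /orP[] /eqP ->; case: (n %% 4 == 3)%N.
Qed.

Lemma recip_signC m n : recip_sign m n = recip_sign n m.
Proof. by rewrite /recip_sign andbC. Qed.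

Opaque jac.

Lemma jac_recip (m n : nat) : odd m -> odd n -> jac m%:Z n = recip_sign m n * jac n%:Z m.
Proof.
move=> om; move: n; apply: oddprime_ind => [|p n pp p2 on IHn].
  by rewrite jac1 jac1l // /recip_sign andbF.
have op : odd p by case: (even_prime pp) p2 => // ->.
rewrite jacM IHn.
rewrite (jac_prime _ pp p2).
rewrite (recip_signC m (p * n)).
rewrite (recip_signM _ op on).
rewrite !(recip_signC _ m).
rewrite PoszM.
rewrite jacMl.
suff -> : leg m p = recip_sign m p * jac p m.
  by rewrite mulrACA.
move: m om {IHn on n}; apply: oddprime_ind => [|q m pq q2 om IHm].
  by rewrite leg1 // jac1 /recip_sign.
have oq : odd q by case: (even_prime pq) q2 => // ->.
rewrite PoszM legM // IHm jacM recip_signM // leg_recip // (jac_prime _ pq q2); ring.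
Qed.

(** The symbol of 2 follows from reciprocity. Write 2 as the product of -1 and -2. Modulo [n + 2]
    the factor -2 is [n]; the reciprocity sign of [n] and [n + 2] is 1, as one of them is 1 modulo
    4; and [n + 2] is 2 modulo [n]. *)
Lemma jac2_step n : odd n -> jac 2 n.+2 = jac (-1) n.+2 * jac 2 n.
Proof.
move=> on; have on2 : odd n.+2 by rewrite /= negbK.
have -> : jac 2 n.+2 = jac (-1) n.+2 * jac (-2) n.+2 by rewrite -jacMl.
congr (_ * _).
have -> : jac (-2) n.+2 = jac n%:Z n.+2.
  by apply: jac_mod; apply/dvdzP; exists (-1); lia.
rewrite jac_recip //.
have -> : recip_sign n n.+2 = 1 by rewrite /recip_sign; case: ifP => //; lia.
by rewrite mul1r; apply: jac_mod; apply/dvdzP; exists 1; lia.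
Qed.

Lemma jac2_period n k : odd n -> jac 2 (n + 8 * k) = jac 2 n.
Proof.
elim: k => [|k IH] on; first by rewrite muln0 addn0.
rewrite -IH //; set m := (n + 8 * k)%N; have om : odd m by rewrite oddD on oddM.
have -> : (n + 8 * k.+1 = m.+2.+2.+2.+2)%N by rewrite /m; lia.
(* Among four consecutive odd numbers exactly two are 3 modulo 4, so the four signs multiply to
   1. *)
rewrite !jac2_step ?jac_m1 ?oddS ?negbK //.
move: om => {IH on}; move: m => m om.
by case E1: (m.+4.+4 %% 4 == 3)%N; case E2: (m.+2.+4 %% 4 == 3)%N;
  case E3: (m.+4 %% 4 == 3)%N; case E4: (m.+2 %% 4 == 3)%N; first [exfalso; lia | ring].
Qed.

Definition unit2 (u : int) := u \in [:: 1; -1; 2; -2].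

Lemma jac_unit_period u n k : unit2 u -> odd n -> jac u (n + 8 * k) = jac u n.
Proof.
move=> hu on; have on' : odd (n + 8 * k) by rewrite oddD on oddM.
have hm1 : jac (-1) (n + 8 * k) = jac (-1) n.
  by rewrite !jac_m1 //; congr (if _ then _ else _); lia.
move: hu; rewrite /unit2 !inE => /or4P[] /eqP->.
- by rewrite !jac1l.
- by [].
- exact: jac2_period.
- have h m : jac (-2) m = jac (-1) m * jac 2 m by rewrite -jacMl.
  by rewrite !h hm1 (jac2_period k on).
Qed.

(** Reciprocity trades the symbol of [d] at [n] for that of [n] at [d], up to a sign depending on
    [n] modulo 4. With the period 8 of the units, the symbol can be summed over its lower argument
    as a character modulo [8 d]. *)
Lemma jac_period u d n : unit2 u -> odd d -> jac (u * d%:Z) (n + 8 * d) = jac (u * d%:Z) n.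
Proof.
move=> hu od; have [on|en] := boolP (odd n); last first.
  by rewrite !jac_even // oddD (negbTE en) oddM.
have on' : odd (n + 8 * d) by rewrite oddD on oddM.
rewrite !jacMl (jac_unit_period d hu on) (jac_recip od on) (jac_recip od on'); congr (_ * (_ * _)).
  by rewrite /recip_sign; congr (if _ && _ then _ else _); lia.
by apply: jac_mod; apply/dvdzP; exists 8; lia.
Qed.

(** * Squarefree integers and nontrivial Jacobi symbols *)

Definition sqf (n : nat) := (0 < n)%N && all (fun p => logn p n == 1%N) (primes n).

Lemma sqf_gt0 n : sqf n -> (0 < n)%N. Proof. by case/andP. Qed.

Lemma sqf_logn n p : sqf n -> prime p -> (logn p n <= 1)%N.
Proof.
move=> /andP[n0 /allP h] pp; have [dv|nd] := boolP (p \in primes n).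
  by rewrite (eqP (h _ dv)).
by rewrite -logn_gt0 in nd; case: (logn p n) nd.
Qed.

Lemma sqfP n : (0 < n)%N -> (forall p, prime p -> (logn p n <= 1)%N) -> sqf n.
Proof.
move=> n0 h; rewrite /sqf n0; apply/allP => p; rewrite -logn_gt0 => l.
have pp : prime p by move: l; rewrite lognE; case: and3P => // -[].
by have := h p pp; lia.
Qed.

Lemma sqf_dvd d n : sqf n -> (d %| n)%N -> sqf d.
Proof.
move=> sn dv; have n0 := sqf_gt0 sn; apply: sqfP; first exact: dvdn_gt0 dv.
by move=> p pp; apply: leq_trans (sqf_logn sn pp); apply: dvdn_leq_log.
Qed.

Lemma sqf_coprime p m : prime p -> sqf (p * m) -> coprime p m.
Proof.
move=> pp s; rewrite prime_coprime //; apply/negP => dv.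
have m0 : (0 < m)%N by have := sqf_gt0 s; rewrite muln_gt0 => /andP[].
have e : logn p (p * m) = (1 + logn p m)%N.
  by rewrite (lognM p (prime_gt0 pp) m0) (logn_prime p pp) eqxx.
have l : (0 < logn p m)%N by rewrite logn_gt0 mem_primes pp m0.
by have := sqf_logn s pp; rewrite e; lia.
Qed.

Lemma leg_coprime a p : prime p -> (2 < p)%N -> leg a%:Z p = -1 -> coprime p a.
Proof.
move=> pp p2 h; rewrite prime_coprime //; apply/negP => dv.
by have := leg_eq0 a%:Z pp p2; rewrite dvdzE /= dv h.
Qed.

(* A single prime q of odd multiplicity suffices to make the symbol nontrivial. *)
Lemma jac_nonres_crt (q N : nat) : prime q -> (2 < q)%N -> (0 < N)%N -> coprime q N ->
  exists b : nat, [/\ coprime b (q * N), (b = 1 %[mod N])%N & leg b%:Z q = -1].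
Proof.
move=> pq q2 N0 co; have [r hr] := leg_nonres pq q2.
exists (chinese q N r 1).
have e1 : (chinese q N r 1 = 1 %[mod N])%N by rewrite chinese_modr.
have e2 : (chinese q N r 1 = r %[mod q])%N by rewrite chinese_modl.
have l2 : leg (chinese q N r 1)%:Z q = -1.
  rewrite -hr; apply: leg_mod => //; rewrite -eqz_mod_dvd !modz_nat; exact/eqP/(congr1 Posz).
split=> //; rewrite coprimeMr (coprime_sym _ q) leg_coprime //=.
by rewrite -coprime_modl e1 coprime_modl coprime1n.
Qed.

(** For [d = 1] the witnesses are 3, 3 and 5. Otherwise take [b] congruent to 1 modulo 8, which
    trivialises [u] and the reciprocity sign, a nonresidue at one prime of [d], and 1 modulo the
    rest of [d]. *)
Lemma jac_nonprincipal u d : unit2 u -> odd d -> sqf d -> u * d%:Z != 1 ->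
  exists b, coprime b (8 * d) /\ jac (u * d%:Z) b = -1.
Proof.
move=> hu od sd; have [d1|d1] := leqP d 1.
  have -> : d = 1%N by case: d od d1 {sd} => // -[].
  have j3 : jac 2 3 = -1 by rewrite jac2_step // jac1 jac_m1.
  move: hu; rewrite /unit2 !inE mulr1 => /or4P[] /eqP-> // _.
  - by exists 3; rewrite jac_m1.
  - by exists 3; rewrite j3.
  - by exists 5; rewrite (_ : (-2)%R = (-1 * 2)%R :> int) // (jacMl (-1) 2) jac_m1 // jac2_step // j3 jac_m1.
move=> _; have pq := pdiv_prime d1; have /dvdnP [k hk] := pdiv_dvd d.
move: (pdiv d) pq hk => q pq; rewrite mulnC => hk.
have oq : odd q by move: od; rewrite hk oddM => /andP[].
have ok : odd k by move: od; rewrite hk oddM => /andP[].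
have q2 : (2 < q)%N by have := prime_gt1 pq; move: oq; lia.
have k0 : (0 < k)%N by case: (k) ok.
have cqk : coprime q k by apply: sqf_coprime => //; rewrite -hk.
have cq8 : coprime q (8 * k).
  rewrite coprimeMr cqk andbT prime_coprime // (_ : 8 = 2 ^ 3)%N // Euclid_dvdX // andbT.
  by rewrite dvdn_prime2 //; apply/eqP => e; rewrite e in q2.
have [|b [cb b1 lb]] := jac_nonres_crt pq q2 _ cq8; first by rewrite muln_gt0.
exists b; split; first by rewrite hk mulnCA.
have b8 : (b = 1 %[mod 8])%N.
  by rewrite -(modn_dvdm b (dvdn_mulr k (dvdnn 8))) b1 modn_dvdm // dvdn_mulr.
have ob : odd b by move: b8; lia.
have -> : jac (u * d) b = jac u b * jac d b by rewrite jacMl.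
have [j hj] : exists j, b = (1 + 8 * j)%N by exists (b %/ 8)%N; move: b8; lia.
rewrite {1}hj jac_unit_period // jac1 mul1r jac_recip //.
have b4 : (b %% 4 == 3)%N = false by clear -b8; move: b8; lia.
have -> : recip_sign d b = 1 by rewrite /recip_sign b4 andbF.
rewrite mul1r hk jacM (jac_prime _ pq q2) lb (_ : jac b k = 1) ?mulr1 // -(jac1l ok).
apply: jac_mod; apply: dvdz_trans (_ : ((8 * k)%N%:Z %| _)%Z); first by rewrite dvdzE /= dvdn_mull.
by rewrite -eqz_mod_dvd !modz_nat b1.
Qed.

Lemma sqf_neq_prime n1 n2 : sqf n1 -> sqf n2 -> n1 != n2 ->
  exists p, prime p /\ (p %| n1)%N != (p %| n2)%N.
Proof.
move=> s1 s2 ne; have [/hasP [p hp hd]|/hasPn H] :=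
  boolP (has (fun p => prime p && ((p %| n1)%N != (p %| n2)%N)) (iota 0 (maxn n1 n2).+1)).
  by exists p; case/andP: hd.
case/negP: ne; apply/eqP; apply: eqn_from_log => [||p]; [exact: sqf_gt0|exact: sqf_gt0|].
have [pp|np] := boolP (prime p); last by rewrite (lognE p n1) (lognE p n2) (negbTE np).
have E : (p %| n1)%N = (p %| n2)%N.
  have [lp|lp] := ltnP p (maxn n1 n2).+1.
    by have := H p; rewrite mem_iota /= lp pp negbK => /(_ isT)/eqP.
  have l1 : (n1 < p)%N by apply: leq_ltn_trans lp; apply: leq_maxl.
  have l2 : (n2 < p)%N by apply: leq_ltn_trans lp; apply: leq_maxr.
  by rewrite !gtnNdvd // sqf_gt0.
have l1 := sqf_logn s1 pp; have l2 := sqf_logn s2 pp.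
have e1 : (0 < logn p n1)%N = (p %| n1)%N by rewrite logn_gt0 mem_primes pp sqf_gt0.
have e2 : (0 < logn p n2)%N = (p %| n2)%N by rewrite logn_gt0 mem_primes pp sqf_gt0.
by move: e1 e2 l1 l2; rewrite E => <-; case: (logn p n1) => [|[|?]]; case: (logn p n2) => [|[|?]].
Qed.

(** The product need not be squarefree, but a prime dividing exactly one of the two squarefree
    factors divides it exactly once; [b] is a nonresidue there and 1 modulo the cofactor. *)
Lemma jac_pair_nonprincipal n1 n2 : sqf n1 -> sqf n2 -> odd n1 -> odd n2 -> n1 != n2 ->
  exists b, coprime b (n1 * n2) /\ jac b%:Z (n1 * n2) = -1.
Proof.
move=> s1 s2 o1 o2 ne; have [p [pp hp]] := sqf_neq_prime s1 s2 ne.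
wlog : n1 n2 s1 s2 o1 o2 {ne} hp / (p %| n1)%N && ~~ (p %| n2)%N.
  move=> W; have [h1|h1] := boolP (p %| n1)%N.
    by apply: W => //; rewrite h1; move: hp; rewrite h1; case: (p %| n2)%N.
  rewrite mulnC; apply: W => //; first by rewrite eq_sym.
  by rewrite h1 andbT; move: hp; rewrite (negbTE h1); case: (p %| n2)%N.
move=> /andP[/dvdnP [k hk] nd]; rewrite mulnC in hk.
have op : odd p by move: o1; rewrite hk oddM => /andP[].
have ok : odd (k * n2) by move: o1; rewrite hk !oddM o2 => /andP[_ ->].
have p2 : (2 < p)%N by have := prime_gt1 pp; move: op; lia.
have cp : coprime p (k * n2) by rewrite coprimeMr sqf_coprime -?hk //= prime_coprime.
have [|b [cb b1 lb]] := jac_nonres_crt pp p2 _ cp; first by case: (k * n2)%N ok.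
exists b; rewrite hk -mulnA; split=> //.
rewrite jacM (jac_prime _ pp p2) lb (_ : jac b _ = 1) ?mulr1 // -(jac1l ok).
by apply: jac_mod; rewrite -eqz_mod_dvd !modz_nat b1.
Qed.

(** * Periodic characters and the sieve *)

Section PeriodSums.
Variables (R : realFieldType) (chi : nat -> R) (q : nat).
Hypotheses (q0 : (0 < q)%N) (per : forall n, chi (n + q) = chi n).

Lemma periodic_mod n : chi (n %% q) = chi n.
Proof.
rewrite [in RHS](divn_eq n q) addnC; elim: (n %/ q)%N => [|k IH]; first by rewrite mul0n addn0.
by rewrite mulSn addnCA [(q + _)%N]addnC per.
Qed.

(** Multiplication by [b] permutes the residues modulo [q], so the sum equals its own negative. *)
Lemma period_sum0 b : coprime b q -> (forall n, chi (b * n) = - chi n) ->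
  \sum_(0 <= i < q) chi i = 0.
Proof.
move=> cb hb; rewrite big_mkord.
pose h (i : 'I_q) := Ordinal (ltn_pmod (b * i) q0).
have hi : injective h.
  move=> i j [] e; apply: val_inj => /=.
  have : (i == j %[mod q])%N.
    wlog : i j e / (j <= i)%N.
      by move=> W; case: (leqP j i) => [|/ltnW] l; [apply: W|rewrite eq_sym; apply: W].
    move=> ji; rewrite eqn_mod_dvd // -(Gauss_dvdr (m := q) (n := b)) 1?coprime_sym //.
    by rewrite mulnBr -eqn_mod_dvd ?leq_mul2l ?ji ?orbT // e.
  by rewrite !modn_small // => /eqP.
have E : \sum_(i < q) chi i = - \sum_(i < q) chi i.
  rewrite {1}(reindex_inj hi) /= -sumrN; apply: eq_bigr => i _.
  by rewrite periodic_mod hb.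
lra.
Qed.

Hypotheses (chi1 : forall n, `|chi n| <= 1) (sum0 : \sum_(0 <= i < q) chi i = 0).

Lemma period_sum_shift u : \sum_(u <= i < u + q) chi i = 0.
Proof.
elim: u => [|u IH]; first by rewrite add0n.
rewrite addSn -[RHS]IH.
rewrite big_nat_recr /=; last by lia.
rewrite [RHS]big_ltn ?per; last by lia.
by rewrite addrC.
Qed.

Lemma period_sum_le u n : `|\sum_(u <= i < u + n) chi i| <= q%:R.
Proof.
have B k m : \sum_(u <= i < u + (k * q + m)) chi i = \sum_(u + k * q <= i < u + k * q + m) chi i.
  elim: k => [|k IH]; first by rewrite mul0n addn0 add0n.
  rewrite (big_cat_nat _ (n := (u + k * q)%N)) /=; [|by lia|by rewrite mulSn; lia].
  have := IH; rewrite (_ : u + (k.+1 * q + m) = u + k * q + (q + m))%N; last by rewrite mulSn; lia.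
  move=> _; rewrite (_ : u + k.+1 * q = u + k * q + q)%N; last by rewrite mulSn; lia.
  rewrite (big_cat_nat _ (m := (u + k * q)%N) (n := (u + k * q + q)%N)) /=; [|by lia|by lia].
  rewrite period_sum_shift add0r addnA.
  have := IH; rewrite (_ : (u + (k * q + m)) = (u + k * q + m))%N; last by lia.
  rewrite (big_cat_nat _ (n := (u + k * q)%N)) /=; [|by lia|by lia].
  by move=> /(canRL (addrK _)); rewrite subrr => ->; rewrite add0r.
rewrite (divn_eq n q) B; apply: le_trans (ler_norm_sum _ _ _) _.
apply: le_trans (ler_sum _ (fun i _ => chi1 i)) _.
by rewrite big_const_nat iter_addr_0 ler_nat addKn ltnW // ltn_pmod.
Qed.
End PeriodSums.

(** * Divisor sums and harmonic sums *)

Lemma sum_multiples (V : nmodType) (a N : nat) (G : nat -> V) : (0 < a)%N ->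
  \sum_(1 <= n < N.+1 | (a %| n)%N) G n = \sum_(1 <= b < (N %/ a).+1) G (a * b)%N.
Proof.
move=> a0; elim: N => [|N IH]; first by rewrite div0n !big_geq.
rewrite big_mkcond big_nat_recr //= -big_mkcond IH divnS //.
case: ifP => dv; last by rewrite addr0 add0n.
rewrite add1n [RHS]big_nat_recr //=; congr (_ + G _).
by move: (divnS N a0); rewrite dv add1n => <-; rewrite mulnC divnK.
Qed.

Lemma sum_divisors (V : nmodType) (N : nat) (F : nat -> nat -> V) :
  \sum_(1 <= n < N.+1) \sum_(a <- divisors n) F a (n %/ a)%N =
  \sum_(1 <= a < N.+1) \sum_(1 <= b < (N %/ a).+1) F a b.
Proof.
transitivity (\sum_(1 <= n < N.+1) \sum_(1 <= a < N.+1 | (a %| n)%N) F a (n %/ a)%N).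
  apply: eq_big_nat => n /andP[n0 nN].
  rewrite -[RHS]big_filter; apply: perm_big; apply: uniq_perm.
  - exact: divisors_uniq.
  - by rewrite filter_uniq ?iota_uniq.
  move=> a; rewrite mem_filter mem_index_iota -dvdn_divisors //.
  have [dv|//] := boolP (a %| n)%N.
  by rewrite (dvdn_gt0 n0 dv) (leq_ltn_trans (dvdn_leq n0 dv) nN).
rewrite (exchange_big_dep_nat xpredT) //=; apply: eq_big_nat => a /andP[a0 aN].
rewrite (sum_multiples _ (fun n => F a (n %/ a)%N)) //.
by apply: eq_bigr => b _; rewrite mulKn.
Qed.

Lemma sum_nat_le (R : numDomainType) (m n n' : nat) (F : nat -> R) :
  (n <= n')%N -> (forall i, 0 <= F i) -> \sum_(m <= i < n) F i <= \sum_(m <= i < n') F i.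
Proof.
move=> nn F0; have [mn|nm] := leqP m n; last by rewrite big_geq 1?ltnW // sumr_ge0.
by rewrite (big_cat_nat _ (n := n) (p := n')) //= lerDl sumr_ge0.
Qed.

(** The rectangle [a <= A], [b <= B] lies under the hyperbola [a b <= A B]. *)
Lemma conv2_ge (R : numDomainType) (A B : nat) (F : nat -> nat -> R) :
  (forall m n, 0 <= F m n) ->
  \sum_(1 <= a < A.+1) \sum_(1 <= b < B.+1) F a b <=
  \sum_(1 <= n < (A * B).+1) \sum_(a <- divisors n) F a (n %/ a)%N.
Proof.
move=> F0; rewrite (sum_divisors _ F).
have [->|B0] := posnP B.
  rewrite muln0 [leRHS]big_geq // big1 // => a _; exact: big_geq.
apply: (@le_trans _ _ (\sum_(1 <= a < A.+1) \sum_(1 <= b < ((A * B) %/ a).+1) F a b)).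
  apply: ler_sum_nat => a /andP[a0 aA].
  by apply: sum_nat_le => //; rewrite ltnS leq_divRL // mulnC leq_mul2r -ltnS aA orbT.
by apply: sum_nat_le => [|a]; [rewrite ltnS leq_pmulr | apply: sumr_ge0].
Qed.

Lemma conv_ge (R : numDomainType) (A B : nat) (f g : nat -> R) :
  (forall n, 0 <= f n) -> (forall n, 0 <= g n) ->
  (\sum_(1 <= a < A.+1) f a) * (\sum_(1 <= b < B.+1) g b) <=
  \sum_(1 <= n < (A * B).+1) \sum_(a <- divisors n) f a * g (n %/ a)%N.
Proof.
move=> f0 g0; rewrite mulr_suml; under eq_bigr do rewrite mulr_sumr.
by apply: (conv2_ge A B (F := fun a b => f a * g b)) => a b; apply: mulr_ge0.
Qed.

Section Harmonic.
Variable R : realType.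
Implicit Types n N : nat.

Lemma ln_step n : (0 < n)%N -> n.+1%:R^-1 <= ln n.+1%:R - ln n%:R :> R.
Proof.
move=> n0; have p0 : (0 : R) < n%:R by rewrite ltr0n.
have p1 : (0 : R) < n.+1%:R by rewrite ltr0n.
have e : 1 - n.+1%:R^-1 = n%:R / n.+1%:R :> R.
  by rewrite -natr1; field; rewrite natr1 pnatr_eq0.
have := @le_ln1Dx R (- n.+1%:R^-1).
rewrite e ln_div ?posrE // ltrN2 invf_lt1 // ltr1n ltnS n0 => /(_ isT).
by rewrite -[X in _ -> _ <= X]opprB lerNr.
Qed.

Lemma harmonic_le N : (0 < N)%N -> \sum_(1 <= n < N.+1) n%:R^-1 <= 1 + ln N%:R :> R.
Proof.
elim: N => // -[|N] IH _; first by rewrite big_nat1 invr1 ln1 addr0.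
rewrite big_nat_recr //=; apply: le_trans (lerD (IH isT) (@ln_step N.+1 isT)) _.
by rewrite -addrA [ln N.+1%:R + _]addrC subrK.
Qed.

Lemma ln_nat_ge0 n : 0 <= ln n%:R :> R.
Proof. by case: n => [|n]; [rewrite ln0 | rewrite ln_ge0 // ler1n]. Qed.

Lemma ler_ln_nat m n : (0 < m)%N -> (m <= n)%N -> ln m%:R <= ln n%:R :> R.
Proof. by move=> m0 mn; rewrite ler_ln ?posrE ?ltr0n ?ler_nat // (leq_trans m0). Qed.

Lemma ln_natM m n : (0 < m)%N -> (0 < n)%N -> ln (m * n)%:R = ln m%:R + ln n%:R :> R.
Proof. by move=> m0 n0; rewrite natrM lnM // posrE ltr0n. Qed.

Variables (chi : nat -> R) (q : nat).
Hypotheses (q0 : (0 < q)%N) (per : forall n, chi (n + q) = chi n).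
Hypotheses (chi1 : forall n, `|chi n| <= 1) (sum0 : \sum_(0 <= i < q) chi i = 0).

(** The partial sums of [L(1, chi)] are bounded uniformly in [Z]: the first [q] terms trivially, and
    the tail by 1 through Abel summation, since incomplete character sums never exceed [q]. *)
Lemma harmonic_chi_le Z : `|\sum_(1 <= a < Z.+1) chi a / a%:R| <= 2 + ln q%:R.
Proof.
have qR : (0 : R) < q%:R by rewrite ltr0n.
have short Y : (Y <= q)%N -> `|\sum_(1 <= a < Y.+1) chi a / a%:R| <= 1 + ln q%:R.
  move=> Yq; apply: le_trans (ler_norm_sum _ _ _) _; apply: le_trans (harmonic_le q0).
  apply: le_trans (_ : _ <= \sum_(1 <= i < Y.+1) i%:R^-1) _; last first.
    by apply: sum_nat_le => // i; rewrite invr_ge0.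
  apply: ler_sum => i _; rewrite normrM normfV normr_nat ler_piMl ?invr_ge0 //.
have [Zq|qZ] := leqP Z q; first by apply: le_trans (short _ Zq) _; lra.
rewrite (big_cat_nat _ (n := q.+1)) //=; last by lia.
apply: le_trans (ler_normD _ _) _; rewrite addrC -[2]/(1 + 1) -addrA lerD ?short //.
have [n ->] : exists n, Z = (q + n)%N by exists (Z - q)%N; lia.
pose S n := \sum_(q.+1 <= a < (q + n).+1) chi a.
pose T n := \sum_(q.+1 <= a < (q + n).+1) chi a / a%:R.
have Sq m : `|S m| <= q%:R by rewrite /S -addSn; apply: period_sum_le.
(* Abel summation as an induction: one more term changes the left side by [S m] times a difference
   of consecutive reciprocals, and the bounds telescope to the right side. *)
have key m : `|T m - S m / (q + m)%:R| <= 1 - q%:R / (q + m)%:R.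
  elim: m => [|m IH].
    by rewrite /T /S addn0 !big_geq // mul0r subrr normr0 divff ?subrr // gt_eqF.
  have -> : T m.+1 - S m.+1 / (q + m.+1)%:R =
     (T m - S m / (q + m)%:R) + S m * ((q + m)%:R^-1 - (q + m.+1)%:R^-1).
    have lq : (q.+1 <= (q + m).+1)%N by rewrite ltnS leq_addr.
    rewrite /T /S addnS !(big_nat_recr _ _ _ lq) /=; move: (\sum_(_ <= _ < _) _) (\sum_(_ <= _ < _) _) => x y.
    by move: (_ %:R^-1) (_%:R^-1) => u v; ring.
  apply: le_trans (ler_normD _ _) _.
  have d0 : 0 <= (q + m)%:R^-1 - (q + m.+1)%:R^-1 :> R.
    by rewrite subr_ge0 lef_pV2 ?posrE ?ltr0n ?ler_nat; lia.
  apply: le_trans (lerD IH _) (_ : _ + q%:R * ((q + m)%:R^-1 - (q + m.+1)%:R^-1) <= _).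
    by rewrite normrM (ger0_norm d0) ler_wpM2r.
  by rewrite mulrBr; lra.
have := key n; have := Sq n; have p : (0 : R) < (q + n)%:R by rewrite ltr0n; lia.
have : `|S n / (q + n)%:R| <= q%:R / (q + n)%:R.
  by rewrite normrM normfV normr_nat ler_wpM2r ?invr_ge0.
have := ler_normD (T n - S n / (q + n)%:R) (S n / (q + n)%:R).
rewrite subrK /T; lra.
Qed.
End Harmonic.

Lemma eq_imp_le (R : numDomainType) (x y : R) : x = y -> x <= y. Proof. by move=> ->. Qed.

(** * Chebyshev's bound for primes and a Hall-type inequality *)

Lemma bin_half_le m : ('C(2 * m + 1, m) <= 4 ^ m)%N.
Proof.
have h : (2 * 'C(2 * m + 1, m) <= 2 ^ (2 * m + 1))%N.
  rewrite -[(2 * m + 1)%N]/(2 * m + 1)%N -[X in (_ <= X ^ _)%N]/(1 + 1)%N expnDn.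
  have mm : (m < (2 * m + 1).+1)%N by lia.
  have mm1 : (m.+1 < (2 * m + 1).+1)%N by lia.
  rewrite (bigD1 (Ordinal mm)) //= (bigD1 (Ordinal mm1)) /=; last by rewrite -val_eqE /=; lia.
  rewrite !exp1n !muln1 -[X in (_ <= _ + (X + _))%N]bin_sub; last by lia.
  rewrite (_ : 2 * m + 1 - m.+1 = m)%N; last by lia.
  by rewrite addnA mul2n -addnn leq_addr.
move: h; rewrite addn1 expnS leq_pmul2l // => h; apply: leq_trans h _.
by rewrite expnM.
Qed.

Lemma prime_dvd_fact p n : prime p -> (p %| n`!)%N -> (p <= n)%N.
Proof.
move=> pp; elim: n => [|n IH]; first by rewrite fact0 dvdn1 => /eqP e; rewrite e in pp.
by rewrite factS Euclid_dvdM // => /orP[/dvdn_leq -> //|/IH]; apply: leqW.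
Qed.

Lemma prod_primes_dvd (s : seq nat) (N : nat) : uniq s -> all prime s ->
  (forall p, p \in s -> (p %| N)%N) -> ((\prod_(p <- s) p) %| N)%N.
Proof.
elim: s => [|p s IH] /=; first by rewrite big_nil dvd1n.
move=> /andP[ps us] /andP[pp ap] h; rewrite big_cons Gauss_dvd.
  by rewrite h ?mem_head //= IH // => q qs; apply: h; rewrite in_cons qs orbT.
rewrite prime_coprime //; apply: contra ps => {h IH us}; elim: s ap => [|q s IH] /=.
  by rewrite big_nil dvdn1 => _ /eqP e; rewrite e in pp.
move=> /andP[pq ap]; rewrite big_cons Euclid_dvdM // dvdn_prime2 // in_cons.
by case/orP => [->//|/(IH ap) ->]; rewrite orbT.
Qed.

(** Erdos's induction. For [n = 2 m + 1] the primes from [m + 2] to [n] divide a binomial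
    coefficient that is at most [4^m], and the smaller ones contribute at most [4^(m+1)]. An even
    [n > 2] adds no prime. *)
Lemma primorial_le n : ((\prod_(1 <= p < n.+1 | prime p) p) <= 4 ^ n)%N.
Proof.
elim/ltn_ind: n => n IH; have [n2|n2] := leqP n 2.
  by case: n n2 {IH} => [|[|[|]]] // _; rewrite /index_iota /= ?(big_cons, big_nil).
have [on|en] := boolP (odd n); last first.
  rewrite big_mkcond; case: n IH n2 en => // n IH n2 en; rewrite big_nat_recr //= -big_mkcond.
  case: ifP => [/even_prime [] e|_]; [by rewrite e in n2|by rewrite e in en|].
  by rewrite muln1 (leq_trans (IH _ _)) // leq_exp2l.
pose m := n./2; have hn : n = (2 * m + 1)%N by rewrite /m; lia.
rewrite (big_cat_nat _ (n := m.+2)) /=; [|lia|lia].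
have -> : (4 ^ n = 4 ^ m.+1 * 4 ^ m)%N by rewrite -expnD; congr (_ ^ _)%N; lia.
apply: leq_mul; first by apply: IH; lia.
apply: leq_trans (bin_half_le m); rewrite -big_filter; apply: dvdn_leq.
  by rewrite bin_gt0; lia.
apply: prod_primes_dvd; first by rewrite filter_uniq ?iota_uniq.
  by apply/allP => p; rewrite mem_filter => /andP[].
move=> p; rewrite mem_filter mem_index_iota => /and3P[pp l1 l2].
have : (p %| (2 * m + 1)`!)%N by rewrite dvdn_fact // prime_gt0 //= -hn -ltnS.
rewrite -(@bin_fact (2 * m + 1) m); last by lia.
rewrite !Euclid_dvdM // => /or3P[//|/(prime_dvd_fact pp)|/(prime_dvd_fact pp)]; lia.
Qed.

Lemma sqf_prod_primes m : sqf m -> m = (\prod_(p <- primes m) p)%N.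
Proof.
move=> s; rewrite [LHS](prod_prime_decomp (sqf_gt0 s)) prime_decompE big_map /=.
apply: eq_big_seq => p hp; case/andP: s => _ /allP /(_ p hp) /eqP ->.
by rewrite expn1.
Qed.

Lemma sum_hyperbola (V : nmodType) (N : nat) (F : nat -> nat -> V) :
  \sum_(1 <= a < N.+1) \sum_(1 <= b < (N %/ a).+1) F a b =
  \sum_(1 <= b < N.+1) \sum_(1 <= a < (N %/ b).+1) F a b.
Proof.
have W (G : nat -> nat -> V) : \sum_(1 <= a < N.+1) \sum_(1 <= b < (N %/ a).+1) G a b =
    \sum_(1 <= a < N.+1) \sum_(1 <= b < N.+1 | (a * b <= N)%N) G a b.
  apply: eq_big_nat => a /andP[a0 aN].
  rewrite (big_nat_widen _ _ N.+1); last by rewrite ltnS leq_div.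
  by apply: eq_bigl => b; rewrite ltnS leq_divRL // mulnC.
rewrite W (W (fun b a => F a b)) (exchange_big_dep_nat xpredT) //=.
by apply: eq_bigr => a _; apply: eq_bigl => b; rewrite mulnC.
Qed.

Section Hall.
Variable R : realType.

Lemma ln_prod_nat (s : seq nat) : all (fun p => 0 < p)%N s ->
  ln ((\prod_(p <- s) p)%N%:R) = \sum_(p <- s) ln (p%:R : R).
Proof.
elim: s => [|p s IH] /=; first by rewrite !big_nil ln1.
move=> /andP[p0 ps]; rewrite !big_cons ln_natM ?IH //.
by elim: s ps {IH} => [|q s IH] /=; rewrite ?big_nil // big_cons muln_gt0 => /andP[-> /IH].
Qed.

Lemma chebyshev_le n : \sum_(1 <= p < n.+1 | prime p) ln (p%:R : R) <= n%:R * ln 4.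
Proof.
rewrite -big_filter -ln_prod_nat; last first.
  by apply/allP => p; rewrite mem_filter => /andP[/prime_gt0].
rewrite big_filter mulr_natl -lnXn // -natrX; apply: ler_ln_nat; last exact: primorial_le.
by rewrite big_seq_cond prodn_cond_gt0 // => p /andP[_ /prime_gt0].
Qed.

Variable w : nat -> R.
Hypotheses (w0 : forall m, 0 <= w m) (wsqf : forall m, w m != 0 -> sqf m).
Hypothesis wp : forall p m, prime p -> (0 < m)%N -> w (p * m)%N <= w m.

(* Expand ln m = \sum_(p | m) ln p over the squarefree m and sum over p first, by Chebyshev. *)
Lemma hall_le Y : (0 < Y)%N ->
  (\sum_(1 <= m < Y.+1) w m) * ln Y%:R <= (1 + ln 4) * Y%:R * \sum_(1 <= m < Y.+1) w m / m%:R.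
Proof.
move=> Y0.
have P1 : \sum_(1 <= m < Y.+1) w m * ln m%:R <= ln 4 * Y%:R * \sum_(1 <= m < Y.+1) w m / m%:R.
  have -> : \sum_(1 <= m < Y.+1) w m * ln m%:R =
      \sum_(1 <= m < Y.+1) \sum_(1 <= p < Y.+1 | prime p && (p %| m)%N) w m * ln p%:R.
    apply: eq_big_nat => m /andP[m0 mY]; rewrite -mulr_sumr.
    have [->|wm] := eqVneq (w m) 0; first by rewrite !mul0r.
    congr (_ * _); rewrite {1}(sqf_prod_primes (wsqf wm)) ln_prod_nat; last first.
      by apply/allP => p; rewrite mem_primes => /and3P[/prime_gt0].
    rewrite -[RHS]big_filter; apply: perm_big; apply: uniq_perm.
    - exact: primes_uniq.
    - by rewrite filter_uniq ?iota_uniq.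
    move=> p; rewrite mem_filter mem_index_iota mem_primes m0 /=.
    have [/andP[pp dv]|//] := boolP (prime p && (p %| m)%N).
    by rewrite prime_gt0 //= (leq_ltn_trans (dvdn_leq m0 dv) mY).
  rewrite (exchange_big_dep_nat prime) /=; last by move=> i j _ _ _ /andP[].
  apply: (@le_trans _ _ (\sum_(1 <= p < Y.+1) \sum_(1 <= k < (Y %/ p).+1)
             (if prime p then w k * ln p%:R else 0))).
    rewrite big_mkcond; apply: ler_sum_nat => p /andP[p0 _]; case: ifP => pp; last first.
      by rewrite big1.
    under eq_bigl do rewrite pp /=.
    (* With [m = p k], the hypothesis [wp] replaces [w m] by [w k], so that [p] can run over all
       primes up to [Y / k]. *)
    rewrite (sum_multiples _ (fun m => w m * ln p%:R)) // big_nat [leRHS]big_nat.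
    apply: ler_sum => k /andP[k0 _]; rewrite ler_wpM2r ?wp //; exact: ln_nat_ge0.
  rewrite (sum_hyperbola _ (fun p k => if prime p then w k * ln p%:R else 0)) mulr_sumr; apply: ler_sum_nat => k /andP[k0 kY].
  rewrite -big_mkcond /= -mulr_sumr [leRHS](_ : _ = w k * (ln 4 * (Y%:R / k%:R))); last by ring.
  rewrite ler_wpM2l //.
  apply: le_trans (chebyshev_le _) _.
  have k1 : (0 : R) < k%:R by rewrite ltr0n.
  have ln4 : (0 : R) <= ln 4 by apply: ln_nat_ge0.
  rewrite mulrC; apply: ler_wpM2l => //; rewrite ler_pdivlMr // -natrM ler_nat.
  exact: leq_divM.
(* Replacing [ln m] by [ln Y] costs [ln (Y / m)], which is at most [Y / m]. *)
have P2 : (\sum_(1 <= m < Y.+1) w m) * ln Y%:R - \sum_(1 <= m < Y.+1) w m * ln m%:R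
     <= Y%:R * \sum_(1 <= m < Y.+1) w m / m%:R.
  rewrite mulr_suml -sumrB mulr_sumr; apply: ler_sum_nat => m /andP[m0 mY].
  have m1 : (0 : R) < m%:R by rewrite ltr0n.
  have Y1 : (0 : R) < Y%:R by rewrite ltr0n.
  rewrite -mulrBr mulrCA ler_wpM2l // -ln_div ?posrE //.
  by apply: ltW; apply: ln_sublinear; rewrite divr_gt0.
move: P1 P2; move: (\sum_(_ <= _ < _) _) (\sum_(_ <= _ < _) _) (\sum_(_ <= _ < _) _) (ln _) (ln _) => A B C D E; lra.
Qed.
End Hall.

Lemma sum_divisors_prime (V : nmodType) (F : nat -> V) p n : prime p -> (0 < n)%N ->
  \sum_(d <- divisors (p * n)) F d =
  \sum_(d <- divisors n | ~~ (p %| d)%N) F d + \sum_(d <- divisors n) F (p * d)%N.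
Proof.
move=> pp n0; have pn0 : (0 < p * n)%N by rewrite muln_gt0 prime_gt0.
rewrite (bigID (fun d => ~~ (p %| d)%N)) /=; congr (_ + _).
  rewrite -big_filter -[RHS]big_filter; apply: perm_big; apply: uniq_perm.
  - by rewrite filter_uniq // divisors_uniq.
  - by rewrite filter_uniq // divisors_uniq.
  move=> d; rewrite !mem_filter -!dvdn_divisors //; case: (boolP (p %| d)%N) => //= nd.
  by rewrite Gauss_dvdr // coprime_sym prime_coprime.
rewrite -big_filter -[RHS](big_map (fun d => p * d)%N xpredT F); apply: perm_big; apply: uniq_perm.
- by rewrite filter_uniq // divisors_uniq.
- rewrite map_inj_uniq ?divisors_uniq // => x y /eqP.
  by rewrite eqn_mul2l gtn_eqF ?prime_gt0 //= => /eqP.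
move=> d; rewrite mem_filter negbK -dvdn_divisors //; apply/andP/mapP.
  case=> /dvdnP [k ->] dv; exists k; last by rewrite mulnC.
  by rewrite -dvdn_divisors // -(dvdn_pmul2l (prime_gt0 pp)) mulnC.
by case=> k; rewrite -dvdn_divisors // => dk ->; rewrite dvdn_mulr // dvdn_pmul2l ?prime_gt0.
Qed.

(** * Integers all of whose primes split *)

Section Split.
Variable R : realType.
Variable chi : nat -> R.
Hypotheses (chiM : forall m n, chi (m * n)%N = chi m * chi n) (chi_1 : chi 1%N = 1).
Hypothesis chi_val : forall n, [\/ chi n = 0, chi n = 1 | chi n = -1].

Let r n := \sum_(d <- divisors n) chi d.

(** The convolution of 1 with [chi] is multiplicative, and its factor at [p] is
    [1 + chi p + ... + (chi p)^k], which is nonnegative for values 0, 1 and -1. The induction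
    removes one prime with its full power. *)
Lemma conv_one_ge0 n : (0 < n)%N -> 0 <= r n.
Proof.
elim/ltn_ind: n => n IH n0; have [n1|n1] := leqP n 1.
  have -> : n = 1%N by lia.
  by rewrite /r big_seq1 chi_1.
have pp := pdiv_prime n1; set p := pdiv n in pp.
have [m /= cm] := pfactor_coprime pp n0.
rewrite mulnC => en; set k := logn p n in en.
have m0 : (0 < m)%N by move: n0; rewrite en muln_gt0 => /andP[].
have k0 : (0 < k)%N by rewrite logn_gt0 mem_primes pp n0 pdiv_dvd.
have rm : 0 <= r m.
  by apply: IH => //; rewrite en -[X in (X < _)%N]mul1n ltn_mul2r m0 -(exp1n k) ltn_exp2r // prime_gt1.
have pm : ~~ (p %| m)%N by rewrite -prime_coprime.
have A j : \sum_(d <- divisors (p ^ j * m) | ~~ (p %| d)%N) chi d = r m.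
  rewrite /r -big_filter; apply: perm_big; apply: uniq_perm; rewrite ?filter_uniq ?divisors_uniq //.
  have q0 : (0 < p ^ j * m)%N by rewrite muln_gt0 expn_gt0 prime_gt0.
  move=> d; rewrite mem_filter -!dvdn_divisors //.
  have [dv|nd] /= := boolP (p %| d)%N.
    by apply/esym/negbTE; apply: contra pm => /(dvdn_trans dv).
  by rewrite Gauss_dvdr // coprimeXr // coprime_sym prime_coprime.
have S j : r (p ^ j.+1 * m)%N = r m + chi p * r (p ^ j * m)%N.
  rewrite {1}/r expnS -mulnA sum_divisors_prime ?A //; last by rewrite muln_gt0 expn_gt0 prime_gt0.
  by rewrite mulr_sumr; congr (_ + _); apply: eq_bigr => d _; rewrite chiM.
(* For [chi p = -1] the recursion subtracts, so the induction also carries the upper bound [r m]. *)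
rewrite en; suff : 0 <= r (p ^ k * m)%N /\ (chi p = -1 -> r (p ^ k * m)%N <= r m) by case.
elim: (k) => [|j [I1 I2]]; first by rewrite mul1n.
rewrite S; case: (chi_val p) => e; rewrite e ?mul0r ?mul1r ?mulN1r; split; move: I1 I2; rewrite ?e; lra.
Qed.

Definition split_only n := (0 < n)%N && all (fun p => chi p == 1) (primes n).

Lemma split_dvd n d : split_only n -> (d %| n)%N -> chi d = 1.
Proof.
move=> /andP[n0 /allP h] dv; have d0 := dvdn_gt0 n0 dv; move: d d0 dv.
apply: prime_ind => [_|p m pp m0 IH dv]; first exact: chi_1.
rewrite chiM IH ?mulr1; last by apply: dvdn_trans dv; apply: dvdn_mull.
apply/eqP/h; rewrite mem_primes pp n0; apply: dvdn_trans dv; exact: dvdn_mulr.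
Qed.

Lemma split_mul m n : split_only m -> split_only n -> split_only (m * n).
Proof.
move=> /andP[m0 /allP hm] /andP[n0 /allP hn]; rewrite /split_only muln_gt0 m0 n0.
by apply/allP => p; rewrite primesM // => /orP[/hm|/hn].
Qed.

Variable q : nat.
Hypotheses (q0 : (0 < q)%N) (per : forall n, chi (n + q) = chi n).
Hypothesis (sum0 : \sum_(0 <= i < q) chi i = 0).

(* The square of the sum is dominated by the sum of (1 * chi)(n) / n, since 1 * chi >= 0 equals
   tau on products of split primes. *)
Lemma split_sum_le Y : (0 < Y)%N ->
  (\sum_(1 <= k < Y.+1) (split_only k)%:R / (k%:R : R)) ^+ 2 <= (1 + ln ((Y * Y)%:R : R)) * (2 + ln (q%:R : R)).
Proof.
move=> Y0; have YY : (0 < Y * Y)%N by rewrite muln_gt0 Y0.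
rewrite expr2; apply: le_trans (conv_ge _ _ _ _) _ => [n|n|]; rewrite ?divr_ge0 //.
have chi1 n : `|chi n| <= 1 by case: (chi_val n) => ->; rewrite ?normr0 ?normrN ?normr1.
apply: (@le_trans _ _ (\sum_(1 <= n < (Y * Y).+1) \sum_(a <- divisors n) chi a / a%:R / (n %/ a)%:R)).
  apply: ler_sum_nat => n /andP[n0 nY].
  have -> : \sum_(a <- divisors n) chi a / a%:R / (n %/ a)%:R = r n / n%:R.
    rewrite /r mulr_suml; apply: eq_big_seq => a; rewrite -dvdn_divisors // => dv.
    by rewrite -mulrA -invfM -natrM mulnC divnK.
  have [sn|sn] := boolP (split_only n).
    rewrite /r mulr_suml big_seq [leRHS]big_seq; apply: ler_sum => a; rewrite -dvdn_divisors // => dv.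
    rewrite (split_dvd sn dv) mulrACA -invfM -[X in X^-1]natrM [(a * _)%N]mulnC divnK //.
    rewrite ler_wpM2r ?invr_ge0 //; case: (split_only _); case: (split_only _); by rewrite ?mulr1 ?mulr0.
  apply: le_trans (_ : 0 <= _); last by rewrite divr_ge0 // conv_one_ge0.
  rewrite big_seq big1 // => a; rewrite -dvdn_divisors // => dv.
  case: (boolP (split_only a)) => sa; last by rewrite !mul0r.
  case: (boolP (split_only (n %/ a))) => sb; last by rewrite mul0r mulr0.
  by case/negP: sn; rewrite -(divnK dv); apply: split_mul.
(* For each [b] the inner sum over [a] becomes a partial sum of [chi a / a], to which
   [harmonic_chi_le] applies. *)
rewrite (sum_divisors _ (fun a b => chi a / a%:R / b%:R)) sum_hyperbola.
apply: (@le_trans _ _ (\sum_(1 <= b < (Y * Y).+1) b%:R^-1 * (2 + ln (q%:R : R)))).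
  apply: ler_sum => b _; rewrite -mulr_suml mulrC ler_wpM2l ?invr_ge0 //.
  by apply: le_trans (ler_norm _) _; apply: harmonic_chi_le.
rewrite -mulr_suml ler_wpM2r ?harmonic_le //.
by rewrite addr_ge0 // ln_nat_ge0.
Qed.
End Split.

(** * Moments of the divisor function and weights [1 / tau] *)

Definition tau n := size (divisors n).

Lemma tau_gt0 n : (0 < n)%N -> (0 < tau n)%N.
Proof. by move=> n0; rewrite /tau; case: (divisors n) (divisors_id n0). Qed.

(** A divisor [d] of [m n] is recovered from [gcd d m] and [d / gcd d m], which divide [m] and
    [n]. *)
Lemma tauM m n : (0 < m)%N -> (0 < n)%N -> (tau (m * n) <= tau m * tau n)%N.
Proof.
move=> m0 n0; rewrite /tau -(size_allpairs muln); apply: uniq_leq_size; first exact: divisors_uniq.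
move=> d; rewrite -dvdn_divisors ?muln_gt0 ?m0 // => dv.
have g0 : (0 < gcdn d m)%N by rewrite gcdn_gt0 m0 orbT.
apply/allpairsP; exists (gcdn d m, d %/ gcdn d m)%N; split=> /=.
- by rewrite -dvdn_divisors // dvdn_gcdr.
- rewrite -dvdn_divisors // -(@Gauss_dvdr _ (m %/ gcdn d m)).
    rewrite -(dvdn_pmul2l g0) mulnC divnK ?dvdn_gcdl // mulnA [(gcdn d m * _)%N]mulnC divnK ?dvdn_gcdr //.
  by rewrite /coprime -(eqn_pmul2l g0) muln1 muln_gcdr ![(gcdn d m * _)%N]mulnC !divnK ?dvdn_gcdl ?dvdn_gcdr.
- by rewrite mulnC divnK // dvdn_gcdl.
Qed.

Lemma tau_dvd d n : (0 < n)%N -> (d %| n)%N -> (tau d <= tau n)%N.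
Proof.
move=> n0 dv; apply: uniq_leq_size; first exact: divisors_uniq.
move=> e; rewrite -!dvdn_divisors ?(dvdn_gt0 n0 dv) // => h; exact: dvdn_trans h dv.
Qed.

Section Tau.
Variable R : realType.

(** One factor [tau u] counts the factorisations [u = a b], and submultiplicativity separates the
    others. So raising the exponent by 1 at most squares the sum, whence [2^j]. *)
Lemma tau_pow_sum j U : (0 < U)%N ->
  \sum_(1 <= u < U.+1) (tau u ^ j)%:R / u%:R <= (1 + ln U%:R) ^+ (2 ^ j) :> R.
Proof.
move=> U0; elim: j => [|j IH].
  rewrite expr1; apply: le_trans (harmonic_le R U0); apply: ler_sum => i _.
  by rewrite expn0 mul1r.
rewrite expnS mulnC exprM.
set s := \sum_(1 <= u < U.+1) (tau u ^ j)%:R / u%:R in IH.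
have s0 : 0 <= s by apply: sumr_ge0 => i _; rewrite divr_ge0.
apply: (@le_trans _ _ (s ^+ 2)); last by rewrite ler_pXn2r // nnegrE exprn_ge0 // addr_ge0 // ln_nat_ge0.
have -> : \sum_(1 <= u < U.+1) (tau u ^ j.+1)%:R / u%:R =
   \sum_(1 <= u < U.+1) \sum_(a <- divisors u) (tau (a * (u %/ a)) ^ j)%:R / (a * (u %/ a))%:R :> R.
  apply: eq_big_nat => u /andP[u0 _]; rewrite big_seq (eq_bigr (fun=> (tau u ^ j)%:R / u%:R)); last first.
    by move=> a; rewrite -dvdn_divisors // => dv; rewrite mulnC divnK.
  by rewrite -big_seq big_const_seq count_predT iter_addr_0 -[RHS]mulr_natl mulrA -natrM expnS.
rewrite (sum_divisors _ (fun a b => (tau (a * b) ^ j)%:R / (a * b)%:R)) expr2 {1}/s mulr_suml.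
apply: ler_sum_nat => a /andP[a0 _].
apply: (@le_trans _ _ (\sum_(1 <= b < (U %/ a).+1) (tau a ^ j)%:R / a%:R * ((tau b ^ j)%:R / b%:R))).
  apply: ler_sum_nat => b /andP[b0 _]; rewrite mulrACA -invfM -!natrM ler_wpM2r ?invr_ge0 //.
  by rewrite ler_nat -expnMn; have [->|j0] := posnP j; rewrite ?expn0 // leq_exp2r // tauM.
rewrite -mulr_sumr ler_wpM2l ?divr_ge0 //; apply: sum_nat_le; first by rewrite ltnS leq_div.
by move=> i; rewrite divr_ge0.
Qed.

Lemma tau_pow_sum_le j U : (0 < U)%N ->
  \sum_(1 <= u < U.+1) (tau u ^ j)%:R <= U%:R * (1 + ln U%:R) ^+ (2 ^ j) :> R.
Proof.
move=> U0; apply: le_trans (ler_wpM2l _ (tau_pow_sum j U0)) => //.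
rewrite mulr_sumr; apply: ler_sum_nat => u /andP[u0 uU].
have u1 : (0 : R) < u%:R by rewrite ltr0n.
by rewrite mulrCA ler_peMr // ler_pdivlMr // mul1r ler_nat -ltnS.
Qed.

(** In the square, each of the [tau n] factorisations [n = a b] has weight at most [1 / tau n]. Thus
    [1 / tau] acts as a square root on harmonic sums and halves the power of the logarithm. *)
Lemma tau_weight_sum (G : pred nat) Y :
  (forall m n, G m -> G n -> G (m * n)%N) ->
  (\sum_(1 <= k < Y.+1) (G k)%:R / (tau k)%:R / k%:R) ^+ 2 <=
  \sum_(1 <= n < (Y * Y).+1) (G n)%:R / n%:R :> R.
Proof.
move=> GM; rewrite expr2; apply: le_trans (conv_ge _ _ _ _) _ => [n|n|]; rewrite ?divr_ge0 //.
apply: ler_sum_nat => n /andP[n0 _].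
apply: (@le_trans _ _ (\sum_(a <- divisors n) (G n)%:R / n%:R / (tau n)%:R)); last first.
  rewrite big_const_seq count_predT iter_addr_0 -[leLHS]mulr_natl mulrCA divff ?mulr1 //.
  by rewrite pnatr_eq0 -lt0n tau_gt0.
rewrite big_seq [leRHS]big_seq; apply: ler_sum => a; rewrite -dvdn_divisors // => dv.
have [Ga|] := boolP (G a); last by rewrite !mul0r !divr_ge0.
have [Gb|] := boolP (G (n %/ a)%N); last by rewrite !mul0r mulr0 !divr_ge0.
rewrite -[n in G n](divnK dv) GM //= !mul1r mulrACA -!invfM -!natrM lef_pV2 ?posrE ?ltr0n; last first.
- by rewrite muln_gt0 n0 tau_gt0.
- by rewrite !muln_gt0 !tau_gt0 ?divn_gt0 ?(dvdn_gt0 n0 dv) ?(dvdn_leq n0 dv).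
have a0 := dvdn_gt0 n0 dv.
have b0 : (0 < n %/ a)%N by rewrite divn_gt0 // dvdn_leq.
have := tauM a0 b0; rewrite [in tau (_ * _)]mulnC divnK // => h.
by rewrite ler_nat [(a * _)%N]mulnC divnK // mulnC leq_mul2r h orbT.
Qed.
End Tau.

(** * Bilinear sums of Jacobi symbols *)

Opaque jac leg.

Lemma cauchy_schwarz (R : realFieldType) (I : Type) (r : seq I) (P : pred I) (x y : I -> R) :
  (\sum_(i <- r | P i) x i * y i) ^+ 2 <=
  (\sum_(i <- r | P i) x i ^+ 2) * (\sum_(i <- r | P i) y i ^+ 2).
Proof.
elim: r => [|i r IH]; first by rewrite !big_nil expr0n mulr0.
rewrite !big_cons; case: ifP => // _.
set A := \sum_(i <- r | P i) x i * y i in IH *.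
set X := \sum_(i <- r | P i) x i ^+ 2 in IH *; set Y := \sum_(i <- r | P i) y i ^+ 2 in IH *.
have X0 : 0 <= X by apply: sumr_ge0 => j _; apply: sqr_ge0.
have Y0 : 0 <= Y by apply: sumr_ge0 => j _; apply: sqr_ge0.
move: IH X0 Y0 (x i) (y i); move: A X Y => A X Y h X0 Y0 u v.
have D0 : 0 <= X * v ^+ 2 + Y * u ^+ 2 by apply: addr_ge0; apply: mulr_ge0 => //; apply: sqr_ge0.
have : 2 * A * (u * v) <= X * v ^+ 2 + Y * u ^+ 2.
  apply: le_trans (ler_norm _) _; rewrite -(ler_pXn2r (n := 2)) ?nnegrE //.
  rewrite real_normK ?num_real //.
  have := mulr_ge0 (sqr_ge0 (u * v)) (_ : 0 <= X * Y - A ^+ 2); rewrite subr_ge0 h => /(_ isT).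
  have := sqr_ge0 (X * v ^+ 2 - Y * u ^+ 2); nra.
move: h; nra.
Qed.

(** The cube lies above its tangent at the mean [mu = A / n]: the difference is
    [(x - mu)^2 (x + 2 mu)]. *)
Lemma power_mean3 (R : realFieldType) (I : eqType) (r : seq I) (x : I -> R) (n : nat) :
  (forall i, 0 <= x i) -> (size r <= n)%N -> (0 < n)%N ->
  (\sum_(i <- r) x i) ^+ 3 <= n%:R ^+ 2 * \sum_(i <- r) x i ^+ 3.
Proof.
move=> x0 sn n0; have n1 : (0 : R) < n%:R by rewrite ltr0n.
set A := \sum_(i <- r) x i; have A0 : 0 <= A by apply: sumr_ge0.
pose mu := A / n%:R; have mu0 : 0 <= mu by rewrite divr_ge0.
have h : \sum_(i <- r) (3 * mu ^+ 2 * x i - 2 * mu ^+ 3) <= \sum_(i <- r) x i ^+ 3.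
  apply: ler_sum => i _; have xi := x0 i.
  have := mulr_ge0 (sqr_ge0 (x i - mu)) (addr_ge0 xi (mulr_ge0 (ler0n R 2) mu0)); nra.
rewrite big_split /= -mulr_sumr -/A sumrN big_const_seq count_predT iter_addr_0 -mulr_natr in h.
have h2 : 2 * mu ^+ 3 * (size r)%:R <= 2 * mu ^+ 3 * n%:R.
  by rewrite ler_wpM2l ?ler_nat // mulr_ge0 // exprn_ge0.
apply: (@le_trans _ _ (n%:R ^+ 2 * (3 * mu ^+ 2 * A - 2 * mu ^+ 3 * n%:R))); last first.
  rewrite ler_wpM2l ?exprn_ge0 //; move: h h2; rewrite ?mulNr; lra.
apply: eq_imp_le; rewrite /mu; field; rewrite gt_eqF //.
Qed.

Section Bilinear.
Variable R : realType.
Definition J (m n : nat) : R := (jac m%:Z n)%:~R.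

Lemma J_le1 m n : `|J m n| <= 1.
Proof. by rewrite /J; case: (jac_cases m%:Z n) => ->; rewrite ?normr0 ?normr1 // rmorphN normrN normr1. Qed.

Lemma JMl m m' n : J (m * m') n = J m n * J m' n.
Proof. by rewrite /J PoszM jacMl rmorphM. Qed.

Lemma JMr m n n' : J m (n * n') = J m n * J m n'.
Proof. by rewrite /J jacM rmorphM. Qed.

Lemma J_pair_sum U n1 n2 : sqf n1 -> odd n1 -> sqf n2 -> odd n2 -> n1 != n2 ->
  `|\sum_(1 <= u < U.+1) J u (n1 * n2)| <= (n1 * n2)%:R.
Proof.
move=> s1 o1 s2 o2 ne; have q0 : (0 < n1 * n2)%N by rewrite muln_gt0 !sqf_gt0.
have per u : J (u + n1 * n2) (n1 * n2) = J u (n1 * n2).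
  rewrite /J; have -> // : jac (u + n1 * n2)%N%:Z (n1 * n2) = jac u%:Z (n1 * n2).
  by apply: jac_mod; apply/dvdzP; exists 1; rewrite PoszD mul1r [u%:Z + _]addrC addrK.
have [b [cb hb]] := jac_pair_nonprincipal s1 s2 o1 o2 ne.
have z0 := period_sum0 q0 per cb.
rewrite -[U.+1]add1n; apply: period_sum_le => //; first by move=> n; apply: J_le1.
by apply: z0 => n; rewrite JMl {1}/J hb rmorphN mulN1r.
Qed.

(** An integer [u] has at most [(tau u)^2] factorisations into three factors. *)
Lemma triple_sum_le M (h : nat -> R) : (forall u, 0 <= h u) ->
  \sum_(1 <= m1 < M.+1) \sum_(1 <= m2 < M.+1) \sum_(1 <= m3 < M.+1) h (m1 * (m2 * m3))%N <=
  \sum_(1 <= u < (M * (M * M)).+1) (tau u ^ 2)%:R * h u.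
Proof.
move=> h0.
apply: (@le_trans _ _ (\sum_(1 <= m1 < M.+1) \sum_(1 <= v < (M * M).+1) (tau v)%:R * h (m1 * v)%N)).
  apply: ler_sum => m1 _.
  apply: le_trans (conv2_ge M M (F := fun a b => h (m1 * (a * b))%N) _) _ => //.
  apply: ler_sum_nat => v /andP[v0 _]; rewrite big_seq (eq_bigr (fun=> h (m1 * v)%N)); last first.
    by move=> a; rewrite -dvdn_divisors // => ad; rewrite [(a * _)%N]mulnC divnK.
  by rewrite -big_seq big_const_seq count_predT iter_addr_0 mulr_natl.
apply: le_trans (conv2_ge M (M * M) (F := fun m v => (tau v)%:R * h (m * v)%N) _) _.
  by move=> m n; rewrite mulr_ge0.
apply: ler_sum_nat => u /andP[u0 _].
apply: (@le_trans _ _ (\sum_(a <- divisors u) (tau u)%:R * h u)).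
  rewrite big_seq [leRHS]big_seq; apply: ler_sum => a; rewrite -dvdn_divisors // => ad.
  rewrite [(a * _)%N]mulnC divnK // ler_wpM2r // ler_nat tau_dvd //.
  by apply/dvdnP; exists a; rewrite mulnC divnK.
by rewrite big_const_seq count_predT iter_addr_0 -[leLHS]mulr_natl mulrA -natrM mulnn.
Qed.

Definition sqo n := sqf n && odd n.

(* Cubing the inner sum makes its variable u = m1 m2 m3 run up to M ^ 3, longer than the period
   n1 n2 <= N ^ 2 of the characters that Cauchy-Schwarz leaves. *)
Lemma bilinear_aux M N (a b : nat -> R) : (0 < N)%N -> (N <= M)%N ->
  (forall m, `|a m| <= 1) -> (forall n, `|b n| <= 1) -> (forall n, b n != 0 -> sqo n) ->
  `|\sum_(1 <= m < M.+1) \sum_(1 <= n < N.+1) a m * b n * J m n| ^+ 6 <=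
  2 * (M * N)%:R ^+ 6 * (1 + 3 * ln M%:R) ^+ 16 / N%:R.
Proof.
move=> N0 NM a1 b1 bs; have M0 := leq_trans N0 NM.
pose S n := \sum_(1 <= m < M.+1) a m * J m n.
pose r := [seq n <- index_iota 1 N.+1 | sqo n].
have ur : uniq r by rewrite filter_uniq // iota_uniq.
have rP n : n \in r -> [/\ sqf n, odd n & (n <= N)%N].
  by rewrite mem_filter mem_index_iota => /and3P[/andP[]].
have sr : (size r <= N)%N.
  by rewrite size_filter (leq_trans (count_size _ _)) // size_iota subn1.
pose A1 := \sum_(n <- r) `|S n|; pose A3 := \sum_(n <- r) `|S n| ^+ 3.
have A10 : 0 <= A1 by apply: sumr_ge0.
have A30 : 0 <= A3 by apply: sumr_ge0 => n _; rewrite exprn_ge0.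
have BA : `|\sum_(1 <= m < M.+1) \sum_(1 <= n < N.+1) a m * b n * J m n| <= A1.
  rewrite exchange_big /=.
  have -> : \sum_(1 <= n < N.+1) \sum_(1 <= m < M.+1) a m * b n * J m n = \sum_(n <- r) b n * S n.
    rewrite big_filter [RHS]big_mkcond; apply: eq_bigr => n _; case: ifP => sn.
      by rewrite mulr_sumr; apply: eq_bigr => m _; ring.
    have [bn|/bs] := eqVneq (b n) 0; last by rewrite sn.
    by rewrite big1 // => m _; rewrite bn; ring.
  apply: le_trans (ler_norm_sum _ _ _) _; apply: ler_sum => n _.
  by rewrite normrM ler_piMl.
have HA : A1 ^+ 3 <= N%:R ^+ 2 * A3 by apply: power_mean3.
(* The sign turns [|S n|^3] into a product of three copies of [S n], which opens into a sum over
   [m1, m2, m3] with one symbol at [m1 m2 m3]. *)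
pose eps n : R := Num.sg (S n).
have eps1 n : `|eps n| <= 1 by rewrite /eps normr_sg lern1 leq_b1.
pose G u := \sum_(n <- r) eps n * J u n.
pose U := (M * (M * M))%N.
have U0 : (0 < U)%N by rewrite !muln_gt0 M0.
have T1 : A3 <= \sum_(1 <= u < U.+1) (tau u ^ 2)%:R * `|G u|.
  apply: le_trans (triple_sum_le M (h := fun u => `|G u|) _) => [|//].
  have -> : A3 = \sum_(1 <= m1 < M.+1) \sum_(1 <= m2 < M.+1) \sum_(1 <= m3 < M.+1)
      a m1 * a m2 * a m3 * G (m1 * (m2 * m3))%N.
    have E n : `|S n| ^+ 3 = \sum_(1 <= m1 < M.+1) \sum_(1 <= m2 < M.+1) \sum_(1 <= m3 < M.+1)
       a m1 * a m2 * a m3 * (eps n * J (m1 * (m2 * m3)) n).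
      have -> : `|S n| ^+ 3 = eps n * (S n * (S n * S n)).
        rewrite -[`|_| ^+ 3]normrX normrEsg sgrX /eps; case: (sgrP (S n)) => h; rewrite ?h; ring.
      have ES (c : R) : c * S n = \sum_(1 <= m < M.+1) c * (a m * J m n) by rewrite /S mulr_sumr.
      rewrite [LHS](_ : _ = (eps n * S n * S n) * S n); last by rewrite !mulrA.
      rewrite ES.
      apply: eq_bigr => m1 _.
      rewrite [LHS](_ : _ = (eps n * (a m1 * J m1 n) * S n) * S n); last by rewrite mulrAC [X in X * _]mulrAC.
      rewrite ES.
      apply: eq_bigr => m2 _.
      rewrite [LHS](_ : _ = (eps n * (a m1 * J m1 n) * (a m2 * J m2 n)) * S n); last by rewrite mulrAC.
      rewrite ES.
      apply: eq_bigr => m3 _.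
      by rewrite !JMl; move: (J m1 n) (J m2 n) (J m3 n) (eps n) (a m1) (a m2) (a m3) => *; ring.
    rewrite /A3 (eq_bigr _ (fun n _ => E n)) exchange_big /=; apply: eq_bigr => m1 _.
    rewrite exchange_big /=; apply: eq_bigr => m2 _.
    rewrite exchange_big /=; apply: eq_bigr => m3 _.
    by rewrite /G mulr_sumr.
  apply: ler_sum => m1 _; apply: ler_sum => m2 _; apply: ler_sum => m3 _.
  apply: le_trans (ler_norm _) _; rewrite normrM ler_piMl // !normrM.
  by rewrite !mulr_ile1 // mulr_ge0.
have T2 : A3 ^+ 2 <= (\sum_(1 <= u < U.+1) (tau u ^ 4)%:R) * \sum_(1 <= u < U.+1) G u ^+ 2.
  apply: le_trans (_ : (\sum_(1 <= u < U.+1) (tau u ^ 2)%:R * `|G u|) ^+ 2 <= _).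
    by rewrite ler_pXn2r // nnegrE // sumr_ge0 // => u _; rewrite mulr_ge0.
  apply: le_trans (cauchy_schwarz _ _ (fun u => (tau u ^ 2)%:R) (fun u => `|G u|)) _.
  apply: eq_imp_le; congr (_ * _); apply: eq_bigr => u _; last by rewrite real_normK ?num_real.
  by rewrite -natrX -expnM.
(* The diagonal [n1 = n2] contributes at most [N U]. The other pairs contribute at most [N^2] each,
   [N^4] in total, which is again at most [N U] because [U = M^3] and [N <= M]. *)
have T3 : \sum_(1 <= u < U.+1) G u ^+ 2 <= 2 * N%:R * U%:R.
  have -> : \sum_(1 <= u < U.+1) G u ^+ 2 =
     \sum_(n1 <- r) \sum_(n2 <- r) eps n1 * eps n2 * \sum_(1 <= u < U.+1) J u (n1 * n2).
    rewrite [RHS](eq_bigr (fun n1 => \sum_(1 <= u < U.+1) \sum_(n2 <- r) eps n1 * eps n2 * J u (n1 * n2))).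
      rewrite [RHS]exchange_big /=; apply: eq_bigr => u _; rewrite expr2 {1}/G mulr_suml.
      apply: eq_bigr => n1 _; rewrite mulr_sumr; apply: eq_bigr => n2 _; rewrite JMr; ring.
    by move=> n1 _; rewrite exchange_big; apply: eq_bigr => n2 _; rewrite mulr_sumr.
  apply: (@le_trans _ _ (\sum_(n1 <- r) \sum_(n2 <- r) ((n1 == n2)%:R * U%:R + N%:R ^+ 2))).
    rewrite big_seq [leRHS]big_seq; apply: ler_sum => n1 /rP[s1 o1 l1].
    rewrite big_seq [leRHS]big_seq; apply: ler_sum => n2 /rP[s2 o2 l2].
    apply: le_trans (ler_norm _) _; rewrite !normrM.
    apply: le_trans (_ : `|\sum_(1 <= u < U.+1) J u (n1 * n2)| <= _).
      by rewrite ler_piMl // mulr_ile1.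
    have [e|ne] := eqVneq n1 n2.
      rewrite mul1r; apply: le_trans (ler_norm_sum _ _ _) _.
      apply: le_trans (ler_sum _ (fun i _ => J_le1 _ _)) _.
      by rewrite big_const_nat iter_addr_0 subn1 /= lerDl exprn_ge0.
    rewrite mul0r add0r; apply: le_trans (J_pair_sum _ s1 o1 s2 o2 ne) _.
    by rewrite -natrX ler_nat; apply: leq_mul.
  have step n1 : n1 \in r -> \sum_(n2 <- r) ((n1 == n2)%:R * U%:R + N%:R ^+ 2) <= 2 * U%:R :> R.
    move=> n1r; rewrite big_split /= -mulr_suml.
    have -> : \sum_(i <- r) (n1 == i)%:R = 1 :> R.
      rewrite (bigD1_seq n1) //= eqxx big1 ?addr0 // => i ni; by rewrite eq_sym (negbTE ni).
    rewrite big_const_seq count_predT iter_addr_0 -mulr_natl mul1r.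
    suff : (size r)%:R * N%:R ^+ 2 <= U%:R :> R by lra.
    by rewrite -natrX -natrM ler_nat /U; apply: leq_mul; [exact: leq_trans sr NM|apply: leq_mul].
  rewrite big_seq; apply: le_trans (ler_sum _ step) _.
  rewrite -big_seq big_const_seq count_predT iter_addr_0 -mulr_natl.
  have : (size r)%:R <= N%:R :> R by rewrite ler_nat.
  have : 0 <= U%:R :> R by []. 
  by nra.
have T4 := @tau_pow_sum_le R 4 U U0.
have lnU : ln U%:R = 3 * ln M%:R :> R.
  by rewrite /U !ln_natM ?muln_gt0 ?M0 //; ring.
rewrite lnU in T4.
have l0 : 0 <= 1 + 3 * ln M%:R :> R.
  by rewrite addr_ge0 // mulr_ge0 // ln_nat_ge0.
have T5 : A3 ^+ 2 <= U%:R * (1 + 3 * ln M%:R) ^+ 16 * (2 * N%:R * U%:R).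
  apply: le_trans T2 _; apply: ler_pM => //; apply: sumr_ge0 => u _ //; exact: sqr_ge0.
have N1 : (0 : R) < N%:R by rewrite ltr0n.
apply: (@le_trans _ _ (A1 ^+ 6)); first by rewrite ler_pXn2r // nnegrE.
apply: (@le_trans _ _ ((N%:R ^+ 2 * A3) ^+ 2)).
  rewrite (_ : A1 ^+ 6 = (A1 ^+ 3) ^+ 2); last by rewrite -exprM.
  by rewrite ler_pXn2r // nnegrE ?mulr_ge0 ?exprn_ge0.
(* With [U = M^3], the product [N^4 U (2 N U)] is [2 (M N)^6 / N]: the saving [1 / N] in the sixth
   power. *)
apply: (@le_trans _ _ (N%:R ^+ 4 * (U%:R * (1 + 3 * ln M%:R) ^+ 16 * (2 * N%:R * U%:R)))).
  by rewrite exprMn -exprM ler_wpM2l // exprn_ge0.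
apply: eq_imp_le; rewrite /U !natrM; move: (1 + _) => l; field; by rewrite gt_eqF.
Qed.

(* Quadratic reciprocity exchanges the variables when M < N. *)
Lemma bilinear M N T (a b : nat -> R) : (0 < T)%N ->
  (forall m, `|a m| <= 1) -> (forall n, `|b n| <= 1) ->
  (forall m, a m != 0 -> sqo m /\ (T < m)%N) -> (forall n, b n != 0 -> sqo n /\ (T < n)%N) ->
  `|\sum_(1 <= m < M.+1) \sum_(1 <= n < N.+1) a m * b n * J m n| ^+ 6 <=
  128 * (M * N)%:R ^+ 6 * (1 + 3 * ln (M * N)%:R) ^+ 16 / T%:R.
Proof.
move=> T0 a1 b1 sa sb.
have T1 : (0 : R) < T%:R by rewrite ltr0n.
have pos : 0 <= 128 * (M * N)%:R ^+ 6 * (1 + 3 * ln (M * N)%:R) ^+ 16 / T%:R :> R.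
  rewrite divr_ge0 // mulr_ge0 //; first by rewrite mulr_ge0 // exprn_ge0.
  by rewrite exprn_ge0 // addr_ge0 // mulr_ge0 // ln_nat_ge0.
have [MT|TM] := leqP M T.
  rewrite big_nat big1 ?normr0 ?expr0n // => m /andP[_ mM]; rewrite big1 // => n _.
  have [->|/sa[_]] := eqVneq (a m) 0; first by rewrite !mul0r.
  by rewrite ltnNge (leq_trans _ MT).
have [NT|TN] := leqP N T.
  rewrite big1 ?normr0 ?expr0n // => m _; rewrite big_nat big1 // => n /andP[_ nN].
  have [->|/sb[_]] := eqVneq (b n) 0; first by rewrite mulr0 mul0r.
  by rewrite ltnNge (leq_trans _ NT).
have M0 : (0 < M)%N by lia. have N0 : (0 < N)%N by lia.
have mono (K K' : nat) (c : R) : (0 < K)%N -> (K <= M * N)%N -> (T < K')%N -> 0 <= c -> c <= 128 ->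
    c * (M * N)%:R ^+ 6 * (1 + 3 * ln K%:R) ^+ 16 / K'%:R <=
    128 * (M * N)%:R ^+ 6 * (1 + 3 * ln (M * N)%:R) ^+ 16 / T%:R.
  move=> K0 KM TK c0 c1; have lnn (n : nat) : 0 <= 1 + 3 * ln n%:R :> R by rewrite addr_ge0 // mulr_ge0 // ln_nat_ge0.
  have T' : K'%:R^-1 <= T%:R^-1 :> R.
    by rewrite lef_pV2 ?posrE ?ltr0n ?ler_nat //; [exact: ltnW|exact: leq_ltn_trans TK].
  have e1 : (1 + 3 * ln K%:R) ^+ 16 <= (1 + 3 * ln (M * N)%:R) ^+ 16 :> R.
    by rewrite ler_pXn2r ?nnegrE // lerD2l ler_wpM2l // ler_ln_nat.
  have p6 : 0 <= (M * N)%:R ^+ 6 :> R by rewrite exprn_ge0.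
  have e2 : c * (M * N)%:R ^+ 6 <= 128 * (M * N)%:R ^+ 6 by rewrite ler_wpM2r.
  have p16 := exprn_ge0 16 (lnn K).
  apply: ler_pM T' => //; first by apply: mulr_ge0 => //; apply: mulr_ge0.
    by rewrite invr_ge0.
  by apply: ler_pM => //; apply: mulr_ge0.
have [NM|/ltnW MN] := leqP N M.
  apply: le_trans (bilinear_aux N0 NM a1 b1 (fun n h => proj1 (sb n h))) _.
  by apply: mono; rewrite ?leq_pmulr // ler_nat.
(* Splitting [n] by its class modulo 4 makes the reciprocity sign depend on [m] alone: it is 1 or
   [recip_sign m 3], which the coefficient of [m] absorbs. *)
pose b' i n := if (n %% 4 == i)%N then b n else 0.
pose a' i m := if i == 3%N then (recip_sign m 3)%:~R * a m else a m.
have hs m : `|(recip_sign m 3)%:~R : R| <= 1.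
  by rewrite /recip_sign; case: ifP => _; rewrite ?normr1 // rmorphN normrN normr1.
have B i : `|\sum_(1 <= n < N.+1) \sum_(1 <= m < M.+1) b' i n * a' i m * J n m| ^+ 6 <=
    2 * (N * M)%:R ^+ 6 * (1 + 3 * ln N%:R) ^+ 16 / M%:R.
  apply: bilinear_aux => //.
  - by move=> n; rewrite /b'; case: ifP; rewrite // normr0.
  - by move=> m; rewrite /a'; case: ifP => // _; rewrite normrM mulr_ile1.
  - move=> m; rewrite /a'; case: ifP => _ h; apply: (proj1 (sa m _)) => //.
    by apply: contra h => /eqP ->; rewrite mulr0.
set X := \sum_(1 <= m < M.+1) _.
have XE : X = (\sum_(1 <= n < N.+1) \sum_(1 <= m < M.+1) b' 1%N n * a' 1%N m * J n m) +
              (\sum_(1 <= n < N.+1) \sum_(1 <= m < M.+1) b' 3%N n * a' 3%N m * J n m).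
  rewrite /X exchange_big -big_split; apply: eq_bigr => n _.
  rewrite /= -big_split; apply: eq_bigr => m _ /=.
  have [am|/sa[/andP[sm om] _]] := eqVneq (a m) 0; first by rewrite /a' /= am !(mulr0, mul0r) addr0.
  have [bn|/sb[/andP[sn on] _]] := eqVneq (b n) 0.
    by rewrite /b' bn !if_same !(mulr0, mul0r) addr0.
  rewrite {1}/J jac_recip // rmorphM /= -/(J n m) /b' /a' /=.
  have : (n %% 4 == 1)%N || (n %% 4 == 3)%N by move: on; lia.
  case/orP => /eqP e; rewrite e /=.
    by rewrite /recip_sign e andbF; ring.
  by rewrite /recip_sign e; case: (m %% 4 == 3)%N; rewrite /= ?rmorphN; ring.
(* Adding the two classes costs [2^6 = 64]; with the factor 2 of [bilinear_aux] this makes 128. *)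
have max6 (x y Q : R) : `|x| ^+ 6 <= Q -> `|y| ^+ 6 <= Q -> `|x + y| ^+ 6 <= 64 * Q.
  move=> hx hy; wlog : x y hx hy / `|y| <= `|x|.
    by move=> W; case: (leP `|y| `|x|) => [|/ltW] l; [apply: W|rewrite addrC; apply: W].
  move=> yx; apply: le_trans (_ : (2 * `|x|) ^+ 6 <= _).
    rewrite ler_pXn2r ?nnegrE ?mulr_ge0 //; apply: le_trans (ler_normD _ _) _; lra.
  by rewrite exprMn (_ : 2 ^+ 6 = 64) ?ler_wpM2l //; ring.
rewrite XE; apply: le_trans (max6 _ _ _ (B 1%N) (B 3%N)) _.
have MN128 := mono N M 128 N0 (leq_pmull _ M0) TM (ler0n R _) (lexx _).
apply: le_trans MN128; rewrite mulnC; apply: eq_imp_le.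
move: ((M * N)%:R ^+ 6) (_ ^+ 16) (_^-1) => x y z; ring.
Qed.
End Bilinear.

(** * Sieve bounds for split integers and for the weights [wA] and [wB] *)

Section Sieve.
Variable R : realType.

Definition jacR (a : int) (n : nat) : R := (jac a n)%:~R.

Lemma jacR_M a m n : jacR a (m * n) = jacR a m * jacR a n.
Proof. by rewrite /jacR jacM rmorphM. Qed.

Lemma jacR_Ml a b n : jacR (a * b) n = jacR a n * jacR b n.
Proof. by rewrite /jacR jacMl rmorphM. Qed.

Lemma jacR_1 a : jacR a 1 = 1.
Proof. by rewrite /jacR jac1. Qed.

Lemma jacR_cases a n : [\/ jacR a n = 0, jacR a n = 1 | jacR a n = -1].
Proof.
by rewrite /jacR; case: (jac_cases a n) => ->; [constructor 1|constructor 2|constructor 3; rewrite rmorphN].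
Qed.

Lemma jacR_le1 a n : `|jacR a n| <= 1.
Proof. by case: (jacR_cases a n) => ->; rewrite ?normr0 ?normrN ?normr1. Qed.

Lemma split_only_dvd (chi : nat -> R) m n : split_only chi n -> (m %| n)%N -> split_only chi m.
Proof.
move=> /andP[n0 /allP h] dv; have m0 := dvdn_gt0 n0 dv; rewrite /split_only m0.
apply/allP => p; rewrite mem_primes => /and3P[pp _ pm]; apply: h.
by rewrite mem_primes pp n0 (dvdn_trans pm).
Qed.

Lemma sqo_dvd m n : sqo n -> (m %| n)%N -> sqo m.
Proof.
move=> /andP[sn on] dv; rewrite /sqo (sqf_dvd sn dv); move: on.
by rewrite -(divnK dv) oddM => /andP[].
Qed.

Lemma jacR_split_sum u d Y : unit2 u -> sqo d -> u * d%:Z != 1 -> (0 < Y)%N ->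
  (\sum_(1 <= k < Y.+1) (split_only (jacR (u * d%:Z)) k)%:R / (k%:R : R)) ^+ 2 <=
  (1 + ln (Y * Y)%:R) * (2 + ln (8 * d)%:R).
Proof.
move=> hu /andP[sd od] nu Y0.
have q0 : (0 < 8 * d)%N by rewrite muln_gt0 (sqf_gt0 sd).
have per n : jacR (u * d%:Z) (n + 8 * d) = jacR (u * d%:Z) n by rewrite /jacR jac_period.
have [b [cb hb]] := jac_nonprincipal hu od sd nu.
apply: (split_sum_le (jacR_M _) (jacR_1 _) (jacR_cases _) q0 per _ Y0).
by apply: (period_sum0 q0 per cb) => n; rewrite jacR_M /jacR hb rmorphN mulN1r.
Qed.

(** Hall's inequality with an indicator as weight. Since the harmonic sum of split integers loses
    half a power of the logarithm, the count is of order [Y sqrt (ln (8 d) / ln Y)]. *)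
Lemma sieve_count u d Y : unit2 u -> sqo d -> u * d%:Z != 1 -> (0 < Y)%N ->
  (\sum_(1 <= m < Y.+1) (sqo m && split_only (jacR (u * d%:Z)) m)%:R) * ln Y%:R <=
  (1 + ln 4) * Y%:R * Num.sqrt ((1 + ln (Y * Y)%:R) * (2 + ln (8 * d)%:R)) :> R.
Proof.
move=> hu sd nu Y0; set chi := jacR _.
pose w m : R := (sqo m && split_only chi m)%:R.
apply: (le_trans (hall_le (w := w) _ _ _ Y0)) => [m|m|p m pp m0|].
- by [].
- by rewrite /w pnatr_eq0 eqb0 negbK => /andP[/andP[]].
- rewrite /w ler_nat; case: (boolP (sqo _ && _)) => // /andP[s1 s2].
  by rewrite (sqo_dvd s1 (dvdn_mull _ (dvdnn m))) (split_only_dvd s2 (dvdn_mull _ (dvdnn m))).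
rewrite ler_wpM2l //; first by rewrite mulr_ge0 // addr_ge0 // (ln_nat_ge0 R 4).
apply: (@le_trans _ _ (\sum_(1 <= k < Y.+1) (split_only chi k)%:R / k%:R)).
  apply: ler_sum => k _; rewrite ler_wpM2r ?invr_ge0 // /w ler_nat.
  by case: (sqo k); case: split_only.
rewrite -[leLHS]ger0_norm -?sqrtr_sqr; last by apply: sumr_ge0 => k _; rewrite divr_ge0.
rewrite ler_sqrt; first exact: jacR_split_sum.
by rewrite mulr_ge0 // addr_ge0 // ln_nat_ge0.
Qed.

(* The weights 1 / tau turn the divisor sums of Jacobi symbols in VV into an indicator. *)
Definition wA (d : nat) : R := (sqo d && split_only (jacR 2) d)%:R / (tau d)%:R.
Definition wB (e : nat) : R := (sqo e)%:R / (tau e)%:R.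

Lemma wA_ge0 d : 0 <= wA d. Proof. by rewrite divr_ge0. Qed.
Lemma wB_ge0 d : 0 <= wB d. Proof. by rewrite divr_ge0. Qed.

Lemma wB_dvd m n : (0 < n)%N -> (m %| n)%N -> wB n <= wB m.
Proof.
move=> n0 dv; rewrite /wB; case: (boolP (sqo n)) => [s|]; last by rewrite mul0r divr_ge0.
rewrite (sqo_dvd s dv) !mul1r lef_pV2 ?posrE ?ltr0n ?tau_gt0 ?(dvdn_gt0 n0 dv) //.
by rewrite ler_nat tau_dvd.
Qed.

Lemma wA_dvd m n : (0 < n)%N -> (m %| n)%N -> wA n <= wA m.
Proof.
move=> n0 dv; rewrite /wA; case: (boolP (_ && _)) => [/andP[s1 s2]|]; last by rewrite mul0r divr_ge0.
rewrite (sqo_dvd s1 dv) (split_only_dvd s2 dv) !mul1r lef_pV2 ?posrE ?ltr0n ?tau_gt0 ?(dvdn_gt0 n0 dv) //.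
by rewrite ler_nat tau_dvd.
Qed.

Definition KA Q : R := \sum_(1 <= d < Q.+1) wA d / d%:R.
Definition KB Q : R := \sum_(1 <= d < Q.+1) wB d / d%:R.

Lemma KA_ge0 Q : 0 <= KA Q.
Proof. by apply: sumr_ge0 => d _; rewrite divr_ge0 ?wA_ge0. Qed.
Lemma KB_ge0 Q : 0 <= KB Q.
Proof. by apply: sumr_ge0 => d _; rewrite divr_ge0 ?wB_ge0. Qed.

Lemma KB_le Q : (0 < Q)%N -> KB Q ^+ 2 <= 1 + 2 * ln Q%:R.
Proof.
move=> Q0; have := @tau_weight_sum R xpredT Q (fun _ _ _ _ => isT).
move=> /le_trans /(_ (_ : _ <= 1 + 2 * ln Q%:R)) h; apply: le_trans (h _).
  rewrite ler_pXn2r ?nnegrE ?KB_ge0 //; last by apply: sumr_ge0 => k _; rewrite !divr_ge0.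
  apply: ler_sum => k _; rewrite ler_wpM2r ?invr_ge0 // ler_wpM2r ?invr_ge0 //.
  by case: (sqo k).
under eq_bigr do rewrite mul1r.
by apply: le_trans (harmonic_le _ _) _; rewrite ?muln_gt0 ?Q0 // ln_natM //; lra.
Qed.

(** Two halvings, one for the weight [1 / tau] and one for splitting with respect to 2, so [KA] has
    order at most [(ln Q)^(1/4)], against [(ln Q)^(1/2)] for [KB]. *)
Lemma KA_le Q : (0 < Q)%N -> KA Q ^+ 4 <= (1 + 4 * ln Q%:R) * (2 + ln 8).
Proof.
move=> Q0; have QQ : (0 < Q * Q)%N by rewrite muln_gt0 Q0.
pose G := split_only (jacR 2).
have GM m n : G m -> G n -> G (m * n)%N by apply: split_mul.
have h1 := @tau_weight_sum R G Q GM.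
have h2 := @jacR_split_sum 2 1 (Q * Q) isT isT isT QQ; rewrite mulr1 muln1 in h2.
have h3 : KA Q ^+ 2 <= \sum_(1 <= n < (Q * Q).+1) (G n)%:R / n%:R.
  apply: le_trans h1; rewrite ler_pXn2r ?nnegrE ?KA_ge0 //; last by apply: sumr_ge0 => k _; rewrite !divr_ge0.
  apply: ler_sum => k _; rewrite ler_wpM2r ?invr_ge0 // ler_wpM2r ?invr_ge0 //.
  by rewrite /G; case: (sqo k); case: (split_only _ k).
rewrite (_ : 4 = 2 * 2)%N // exprM; apply: le_trans (_ : (\sum_(1 <= n < (Q * Q).+1) (G n)%:R / n%:R) ^+ 2 <= _).
  by rewrite ler_pXn2r ?nnegrE ?exprn_ge0 ?KA_ge0 //; apply: sumr_ge0 => k _; rewrite divr_ge0.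
apply: le_trans h2 _; rewrite !ln_natM //.
by apply: eq_imp_le; congr (_ * _); ring.
Qed.

(** When [d^2 <= Y], the range [Y / d] has length about [sqrt Y] or more, so the logarithm by which
    Hall's inequality divides is at least [ln Y / 4]; [Y >= 16] pays for the rounding. *)
Lemma hall_half (w : nat -> R) Q Y d :
  (forall m, 0 <= w m) -> (forall m, w m != 0 -> sqf m) ->
  (forall p m, prime p -> (0 < m)%N -> w (p * m)%N <= w m) ->
  (0 < d)%N -> (d * d <= Y)%N -> (16 <= Y)%N -> (Y <= Q)%N ->
  \sum_(1 <= m < (Y %/ d).+1) w m <=
  4 * (1 + ln 4) * (Y%:R / d%:R) / ln Y%:R * \sum_(1 <= m < Q.+1) w m / m%:R.
Proof.
move=> w0 ws wp d0 dY Y16 YQ; set Z := (Y %/ d)%N.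
have dZ : (d <= Z)%N by rewrite leq_divRL.
have Z0 : (0 < Z)%N := leq_trans d0 dZ.
have Y0 : (0 < Y)%N by lia.
have YZ : (Y < (Z.+1) * Z.+1)%N.
  by apply: leq_trans (ltn_ceil Y d0) _; rewrite leq_mul2l ltnW ?orbT // ltnS.
have Z2 : (Y <= (2 * Z) * (2 * Z))%N by apply: leq_trans (ltnW YZ) _; apply: leq_mul; lia.
have lnZ : ln Y%:R <= 2 * (ln 2 + ln Z%:R) :> R.
  apply: le_trans (ler_ln_nat R Y0 Z2) _.
  by rewrite !ln_natM ?muln_gt0 ?Z0 //; lra.
have l16 : 4 * ln 2 <= ln Y%:R :> R.
  apply: le_trans (ler_ln_nat R (isT : (0 < 16)%N) Y16).
  by rewrite (_ : 16 = 2 * (2 * (2 * 2)))%N // !ln_natM //; lra.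
have l2 : 0 < ln 2 :> R by rewrite ln_gt0 // ltr1n.
have lZ : ln Y%:R / 4 <= ln Z%:R :> R by lra.
have lY : 0 < ln Y%:R :> R by lra.
have c0 : 0 <= 1 + ln 4 :> R by rewrite addr_ge0 // (ln_nat_ge0 R 4).
have h := hall_le w0 ws wp Z0.
set S := \sum_(1 <= m < Z.+1) w m in h *.
set K := \sum_(1 <= m < Q.+1) w m / m%:R.
have K0 : 0 <= K by apply: sumr_ge0 => m _; rewrite divr_ge0.
have S0 : 0 <= S by apply: sumr_ge0.
have h2 : S * (ln Y%:R / 4) <= (1 + ln 4) * (Y%:R / d%:R) * K.
  apply: le_trans (ler_wpM2l S0 lZ) _; apply: le_trans h _.
  apply: ler_pM.
  - by rewrite mulr_ge0.
  - by apply: sumr_ge0 => m _; rewrite divr_ge0.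
  - by rewrite ler_wpM2l // ler_pdivlMr ?ltr0n // -natrM ler_nat; exact: leq_divM.
  - apply: sum_nat_le => [|m]; last by rewrite divr_ge0.
    by rewrite ltnS (leq_trans (leq_div _ _)).
rewrite -(ler_pM2r (x := ln Y%:R / 4)) ?divr_gt0 //; apply: le_trans h2 _.
by apply: eq_imp_le; field; rewrite !gt_eqF // ltr0n.
Qed.

Lemma wA_hall : [/\ (forall m, 0 <= wA m), (forall m, wA m != 0 -> sqf m) &
  (forall p m, prime p -> (0 < m)%N -> wA (p * m)%N <= wA m)].
Proof.
split; first exact: wA_ge0.
  by move=> m; rewrite /wA; case: (boolP (sqo m)) => [/andP[]|] //; rewrite mul0r eqxx.
by move=> p m pp m0; apply: wA_dvd; [rewrite muln_gt0 prime_gt0 | exact: dvdn_mull].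
Qed.

Lemma wB_hall : [/\ (forall m, 0 <= wB m), (forall m, wB m != 0 -> sqf m) &
  (forall p m, prime p -> (0 < m)%N -> wB (p * m)%N <= wB m)].
Proof.
split; first exact: wB_ge0.
  by move=> m; rewrite /wB; case: (boolP (sqo m)) => [/andP[]|] //; rewrite mul0r eqxx.
by move=> p m pp m0; apply: wB_dvd; [rewrite muln_gt0 prime_gt0 | exact: dvdn_mull].
Qed.

Definition HAB Y : R := \sum_(1 <= d < Y.+1) \sum_(1 <= e < (Y %/ d).+1) wA d * wB e.

(** Dirichlet's hyperbola method: [d e <= Y] forces [d^2 <= Y] or [e^2 <= Y], and [hall_half] sums
    the other variable. *)
Lemma HAB_le Q Y : (16 <= Y)%N -> (Y <= Q)%N ->
  HAB Y <= 8 * (1 + ln 4) * Y%:R / ln Y%:R * (KA Q * KB Q).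
Proof.
move=> Y16 YQ; have [a1 a2 a3] := wA_hall; have [b1 b2 b3] := wB_hall.
have lY : 0 < ln Y%:R :> R by rewrite ln_gt0 // ltr1n; lia.
have c0 : 0 <= 1 + ln 4 :> R by rewrite addr_ge0 // (ln_nat_ge0 R 4).
pose c : R := 4 * (1 + ln 4) * Y%:R / ln Y%:R.
have half (w v : nat -> R) : (forall m, 0 <= v m) ->
   (forall m, 0 <= w m) -> (forall m, w m != 0 -> sqf m) ->
   (forall p m, prime p -> (0 < m)%N -> w (p * m)%N <= w m) ->
   \sum_(1 <= d < Y.+1) \sum_(1 <= e < (Y %/ d).+1) (d * d <= Y)%N%:R * (v d * w e) <=
   c * ((\sum_(1 <= d < Q.+1) v d / d%:R) * \sum_(1 <= m < Q.+1) w m / m%:R).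
  move=> v0 w0 ws wp; set K := \sum_(1 <= m < Q.+1) w m / m%:R.
  have K0 : 0 <= K by apply: sumr_ge0 => m _; rewrite divr_ge0.
  have cc : 0 <= c by rewrite /c divr_ge0 ?mulr_ge0 // ltW.
  apply: (@le_trans _ _ (\sum_(1 <= d < Y.+1) c * (v d / d%:R * K))); last first.
    rewrite -mulr_sumr -mulr_suml ler_wpM2l // ler_wpM2r //.
    by apply: sum_nat_le => // m; rewrite divr_ge0.
  apply: ler_sum_nat => d /andP[d0 _].
  have [dY|dY] := leqP (d * d) Y; last first.
    rewrite big1 => [|e _]; last by rewrite mul0r.
    by apply: mulr_ge0 => //; apply: mulr_ge0 => //; apply: divr_ge0.
  under eq_bigr do rewrite mul1r.
  rewrite -mulr_sumr; apply: le_trans (ler_wpM2l (v0 d) (hall_half w0 ws wp d0 dY Y16 YQ)) _.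
  by apply: eq_imp_le; rewrite -/K /c; field; rewrite !gt_eqF // ltr0n.
have hA := half wA wB b1 a1 a2 a3; have hB := half wB wA a1 b1 b2 b3.
apply: (@le_trans _ _ (c * (KA Q * KB Q) + c * (KB Q * KA Q))); last first.
  by apply: eq_imp_le; rewrite /c; field; rewrite gt_eqF.
apply: le_trans (lerD hB hA); rewrite [X in _ <= _ + X](sum_hyperbola _ (fun d e => (d * d <= Y)%N%:R * (wB d * wA e))).
rewrite /HAB -big_split; apply: ler_sum_nat => d /andP[d0 dY] /=.
rewrite -big_split; apply: ler_sum_nat => e /andP[e0 eY] /=.
have ed : (d * e <= Y)%N by rewrite mulnC -leq_divRL //.
have AB0 : 0 <= wA d * wB e by rewrite mulr_ge0.
have [//|dd] := leqP (d * d) Y; first by rewrite mul1r lerDl mulr_ge0 // mulr_ge0.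
have -> : (e * e <= Y)%N by nia.
by rewrite mul0r add0r mul1r mulrC.
Qed.
End Sieve.

(** A twin of [split_only (jacR a)] that mentions no real field, for the statements about counts. *)
Definition spl (a : int) (n : nat) : bool := (0 < n)%N && all (fun p => jac a p == 1) (primes n).

Lemma split_only_spl (R : realType) a n : split_only (@jacR R a) n = spl a n.
Proof.
rewrite /split_only /spl; congr (_ && _); apply: eq_all => p.
by rewrite /jacR -[1]/(1%:~R : R) eqr_int.
Qed.

Lemma sum_shrink (V : nmodType) (N N' : nat) (F : nat -> V) :
  (N <= N')%N -> (forall i, (N < i)%N -> F i = 0) ->
  \sum_(1 <= i < N'.+1) F i = \sum_(1 <= i < N.+1) F i.
Proof.
move=> NN h; rewrite (big_cat_nat _ (n := N.+1)) //= [X in _ + X]big_nat [X in _ + X]big1 ?addr0 //.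
by move=> i /andP[l _]; apply: h.
Qed.

Lemma sum_prod_le (R : numDomainType) (A B Y : nat) (F : nat -> nat -> R) :
  (forall a b, 0 <= F a b) ->
  \sum_(1 <= a < A.+1) \sum_(1 <= b < B.+1) (a * b <= Y)%N%:R * F a b <=
  \sum_(1 <= a < Y.+1) \sum_(1 <= b < (Y %/ a).+1) F a b.
Proof.
move=> F0.
apply: (@le_trans _ _ (\sum_(1 <= a < A.+1) \sum_(1 <= b < (Y %/ a).+1) F a b)).
  apply: ler_sum_nat => a /andP[a0 _].
  apply: (@le_trans _ _ (\sum_(1 <= b < (maxn B (Y %/ a)).+1) (a * b <= Y)%N%:R * F a b)).
    by apply: sum_nat_le => [|b]; [rewrite ltnS leq_maxl | rewrite mulr_ge0].
  rewrite (sum_shrink (N := (Y %/ a)%N)) ?leq_maxr // => [|b].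
    by apply: ler_sum => b _; rewrite ler_piMl // lern1 leq_b1.
  by rewrite ltn_divLR // mulnC => l; rewrite leqNgt l mul0r.
apply: (@le_trans _ _ (\sum_(1 <= a < (maxn A Y).+1) \sum_(1 <= b < (Y %/ a).+1) F a b)).
  by apply: sum_nat_le => [|a]; [rewrite ltnS leq_maxl | apply: sumr_ge0].
rewrite (sum_shrink (N := Y)) ?leq_maxr // => a l.
by rewrite divn_small // big_geq.
Qed.

(** * Admissible pairs *)

Section Boxes.
Variable R : realType.
Local Notation jacR := (@jacR R).
Local Notation wA := (@wA R).
Local Notation wB := (@wB R).
Local Notation J := (@J R).

(** Sixth root of [bilinear] for a rectangle shrunk by fixed divisors [x] and [y]. Here [kappa]
    bounds [T^(-1/6)] times logarithms at the top size [Z], and the reciprocals of [x] and [y] stay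
    available for harmonic sums. *)
Lemma bil_bound A B x y T Z (kappa : R) (a b : nat -> R) : (0 < T)%N -> (0 < x)%N -> (0 < y)%N ->
  (A * B <= Z)%N -> 0 <= kappa -> 128 * (1 + 3 * ln Z%:R) ^+ 16 / T%:R <= kappa ^+ 6 ->
  (forall m, `|a m| <= 1) -> (forall n, `|b n| <= 1) ->
  (forall m, a m != 0 -> sqo m /\ (T < m)%N) -> (forall n, b n != 0 -> sqo n /\ (T < n)%N) ->
  `|\sum_(1 <= m < (A %/ x).+1) \sum_(1 <= n < (B %/ y).+1) a m * b n * J m n| <=
  (A * B)%:R * kappa * (x%:R^-1 * y%:R^-1).
Proof.
move=> T0 x0 y0 ABZ k0 hk a1 b1 sa sb.
have xR : (0 : R) < x%:R by rewrite ltr0n. have yR : (0 : R) < y%:R by rewrite ltr0n.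
have rhs0 : 0 <= (A * B)%:R * kappa * (x%:R^-1 * y%:R^-1) by rewrite !mulr_ge0 ?invr_ge0.
have [e|MN0] := posnP ((A %/ x) * (B %/ y))%N.
  move/eqP: e; rewrite muln_eq0 => /orP[] /eqP ->; first by rewrite big_geq // normr0.
  by rewrite big1 ?normr0 // => m _; rewrite big_geq.
rewrite -(ler_pXn2r (n := 6)) ?nnegrE //.
apply: le_trans (bilinear (A %/ x) (B %/ y) T0 a1 b1 sa sb) _.
have TR : (0 : R) < T%:R by rewrite ltr0n.
have MN : ((A %/ x) * (B %/ y))%:R <= (A * B)%:R * (x%:R^-1 * y%:R^-1) :> R.
  rewrite !natrM mulrACA; apply: ler_pM => //; rewrite ler_pdivlMr // -natrM ler_nat; exact: leq_divM.
have MZ : ((A %/ x) * (B %/ y) <= Z)%N.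
  by apply: leq_trans ABZ; apply: leq_mul; apply: leq_div.
have -> : ((A * B)%:R * kappa * (x%:R^-1 * y%:R^-1)) ^+ 6 =
   ((A * B)%:R * (x%:R^-1 * y%:R^-1)) ^+ 6 * kappa ^+ 6 by rewrite -exprMn mulrAC.
have lnn (n : nat) : 0 <= 1 + 3 * ln n%:R :> R by rewrite addr_ge0 // mulr_ge0 // ln_nat_ge0.
have -> : 128 * ((A %/ x) * (B %/ y))%:R ^+ 6 * (1 + 3 * ln ((A %/ x) * (B %/ y))%:R) ^+ 16 / T%:R =
   ((A %/ x) * (B %/ y))%:R ^+ 6 * (128 * (1 + 3 * ln ((A %/ x) * (B %/ y))%:R) ^+ 16 / T%:R) :> R.
  by move: (_ ^+ 6) (_ ^+ 16) (_^-1) => p q r; ring.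
apply: ler_pM; rewrite ?exprn_ge0 //.
- by rewrite divr_ge0 // mulr_ge0 // exprn_ge0.
- by rewrite ler_pXn2r ?nnegrE // mulr_ge0 // mulr_ge0 // invr_ge0.
apply: le_trans hk; rewrite ler_wpM2r ?invr_ge0 // ler_wpM2l //.
by rewrite ler_pXn2r ?nnegrE // lerD2l ler_wpM2l // ler_ln_nat.
Qed.

Variables (u w : int) (X T : nat).
Hypotheses (T0 : (0 < T)%N) (X0 : (0 < X)%N).

(* What local solubility at odd primes leaves for a = u d and n = |u| v d e, with w = - s sgn(u) v. *)
Definition pairOK (d e : nat) : bool :=
  [&& sqo d, sqo e, split_only (jacR 2) d, split_only (jacR (w * e%:Z)) d &
      split_only (jacR (u * d%:Z)) e].

Let lam := trunc_log 2 X.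
Let N := (2 ^ lam.+1)%N.
Let tl := trunc_log 2.

(** Dyadic pieces: [tl d == i] places [d] between [2^i] and [2^(i+1)]. Bilinear estimates need
    rectangles, while the pairs fill the region [d e <= X]. *)
Definition al i d : R := wA d * ((T * T < d)%N && (tl d == i))%:R.
Definition be j e : R := wB e * ((T * T < e)%N && (tl e == j))%:R.
(* Nonnegative, and equal to tau d * tau e on admissible pairs: so wA d * wB e * VV d e majorizes
   the indicator of admissible pairs. *)
Definition VV d e : R :=
  \sum_(D1 <- divisors d) \sum_(E1 <- divisors e) jacR (w * e%:Z) D1 * jacR (u * d%:Z) E1.

Lemma VV_prod d e : VV d e =
  (\sum_(D1 <- divisors d) jacR (w * e%:Z) D1) * (\sum_(E1 <- divisors e) jacR (u * d%:Z) E1).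
Proof. by rewrite mulr_suml; apply: eq_bigr => D1 _; rewrite mulr_sumr. Qed.

Lemma VV_ge0 d e : (0 < d)%N -> (0 < e)%N -> 0 <= VV d e.
Proof.
move=> d0 e0; rewrite VV_prod mulr_ge0 //; apply: conv_one_ge0 => //;
  by [exact: jacR_M|exact: jacR_1|exact: jacR_cases].
Qed.

Lemma split_sum_tau (chi : nat -> R) n : (forall m n, chi (m * n)%N = chi m * chi n) -> chi 1%N = 1 ->
  split_only chi n -> \sum_(d <- divisors n) chi d = (tau n)%:R.
Proof.
move=> cM c1 s; have n0 : (0 < n)%N by case/andP: s.
rewrite big_seq (eq_bigr (fun=> 1)); last first.
  by move=> d; rewrite -dvdn_divisors // => dv; apply: (split_dvd cM c1 s).
by rewrite -big_seq big_const_seq count_predT iter_addr_0.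
Qed.

Lemma pairOK_weight d e : pairOK d e -> wA d * wB e * VV d e = 1.
Proof.
case/and5P => sd se g2 sw su; have d0 := sqf_gt0 (proj1 (andP sd)); have e0 := sqf_gt0 (proj1 (andP se)).
rewrite VV_prod !split_sum_tau ?jacR_1 //; try exact: jacR_M.
rewrite /wA /wB sd se g2 !mul1r; field.
by rewrite !pnatr_eq0 -!lt0n !tau_gt0.
Qed.

Lemma al_ge0 i d : 0 <= al i d. Proof. by rewrite mulr_ge0 ?wA_ge0. Qed.
Lemma be_ge0 i d : 0 <= be i d. Proof. by rewrite mulr_ge0 ?wB_ge0. Qed.

Definition Box i j : R :=
  \sum_(1 <= d < N.+1) \sum_(1 <= e < N.+1) al i d * be j e * VV d e.

Lemma X_lt_N : (X < N)%N. Proof. exact: trunc_log_ltn. Qed.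

Lemma tl_add d e : (0 < d)%N -> (0 < e)%N -> (d * e <= X)%N -> (tl d + tl e <= lam)%N.
Proof.
move=> d0 e0 de; apply: trunc_log_max => //; apply: leq_trans de.
by rewrite expnD leq_mul // trunc_logP.
Qed.

(** All terms are nonnegative, so every dyadic rectangle that meets the region may be counted in
    full; such rectangles have [i + j <= lam]. *)
Lemma large_le_boxes :
  \sum_(1 <= d < X.+1) \sum_(1 <= e < (X %/ d).+1) [&& pairOK d e, T * T < d & T * T < e]%N%:R <=
  \sum_(i < lam.+1) \sum_(j < lam.+1) (i + j <= lam)%N%:R * Box i j :> R.
Proof.
pose g d e : R := ([&& pairOK d e, T * T < d & T * T < e] && (d * e <= X))%N%:R.
apply: (@le_trans _ _ (\sum_(1 <= d < N.+1) \sum_(1 <= e < N.+1) g d e)).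
  apply: (@le_trans _ _ (\sum_(1 <= d < X.+1) \sum_(1 <= e < N.+1) g d e)); last first.
    by apply: sum_nat_le => [|d]; [rewrite ltnS ltnW // X_lt_N | apply: sumr_ge0].
  apply: ler_sum_nat => d /andP[d0 _].
  apply: (@le_trans _ _ (\sum_(1 <= e < (X %/ d).+1) g d e)).
    apply: ler_sum_nat => e /andP[e0 eX]; have deX : (d * e <= X)%N by rewrite mulnC -leq_divRL.
    by rewrite /g deX andbT.
  by apply: sum_nat_le => //; rewrite ltnS (leq_trans (leq_div _ _)) // ltnW // X_lt_N.
apply: (@le_trans _ _ (\sum_(1 <= d < N.+1) \sum_(1 <= e < N.+1)
    \sum_(i < lam.+1) \sum_(j < lam.+1) (i + j <= lam)%N%:R * (al i d * be j e * VV d e))).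
  apply: ler_sum_nat => d /andP[d0 _]; apply: ler_sum_nat => e /andP[e0 _].
  have nn (i j : nat) : 0 <= (i + j <= lam)%N%:R * (al i d * be j e * VV d e).
    by rewrite mulr_ge0 // mulr_ge0 ?VV_ge0 // mulr_ge0 ?al_ge0 ?be_ge0.
  rewrite /g; case: (boolP (_ && _)); last first.
    by move=> _; apply: sumr_ge0 => i _; apply: sumr_ge0 => j _; apply: nn.
  case/andP => /and3P[ok dT eT] deX; have tle := tl_add d0 e0 deX.
  have ld : (tl d < lam.+1)%N by lia. have le : (tl e < lam.+1)%N by lia.
  rewrite (bigD1 (Ordinal ld)) //= (bigD1 (Ordinal le)) //= tle.
  rewrite {1}/al {1}/be dT eT !eqxx /= !mulr1 pairOK_weight // mulr1 -addrA lerDl.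
  by rewrite addr_ge0 //; apply: sumr_ge0 => i _ //; apply: sumr_ge0 => j _.
rewrite (eq_bigr _ (fun d _ => exchange_big _ _ _ _ _ _)) exchange_big /=; apply: ler_sum => i _.
rewrite (eq_bigr _ (fun d _ => exchange_big _ _ _ _ _ _)) exchange_big /=; apply: ler_sum => j _.
rewrite /Box mulr_sumr; apply: ler_sum => d _; by rewrite mulr_sumr.
Qed.

(** * Expansion in four variables: linked and unlinked terms *)

Definition T4 i j D1 D0 E1 E0 : R :=
  al i (D1 * D0)%N * be j (E1 * E0)%N * (jacR (w * (E1 * E0)%N%:Z) D1 * jacR (u * (D1 * D0)%N%:Z) E1).

Definition sum4 (F : nat -> nat -> nat -> nat -> R) : R :=
  \sum_(1 <= D1 < N.+1) \sum_(1 <= D0 < (N %/ D1).+1)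
  \sum_(1 <= E1 < N.+1) \sum_(1 <= E0 < (N %/ E1).+1) F D1 D0 E1 E0.

Lemma Box_sum4 i j : Box i j = sum4 (T4 i j).
Proof.
rewrite /Box /sum4.
rewrite -(sum_divisors N (fun D1 D0 => \sum_(1 <= E1 < N.+1) \sum_(1 <= E0 < (N %/ E1).+1) T4 i j D1 D0 E1 E0)).
apply: eq_big_nat => d /andP[d0 _].
rewrite (eq_bigr (fun e => \sum_(D1 <- divisors d) \sum_(E1 <- divisors e)
    al i d * be j e * (jacR (w * e%:Z) D1 * jacR (u * d%:Z) E1))); last first.
  by move=> e _; rewrite /VV mulr_sumr; apply: eq_bigr => D1 _; rewrite mulr_sumr.
rewrite exchange_big; apply: eq_big_seq => D1; rewrite -dvdn_divisors // => dv.
rewrite -(sum_divisors N (fun E1 E0 => T4 i j D1 (d %/ D1) E1 E0)).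
apply: eq_big_nat => e /andP[e0 _]; apply: eq_big_seq => E1; rewrite -(dvdn_divisors _ e0) => ev.
by rewrite /T4 [(D1 * _)%N]mulnC [(E1 * _)%N]mulnC !divnK.
Qed.

(** The inner variables [D0] and [E1] are linked by a symbol; the outer [D1] and [E0] become the
    fixed divisors of [bil_bound]. *)
Lemma sum4_a F : sum4 F = \sum_(1 <= D1 < N.+1) \sum_(1 <= E0 < N.+1)
  \sum_(1 <= D0 < (N %/ D1).+1) \sum_(1 <= E1 < (N %/ E0).+1) F D1 D0 E1 E0.
Proof.
rewrite /sum4; apply: eq_bigr => D1 _; rewrite [RHS]exchange_big /=; apply: eq_bigr => D0 _.
exact: (sum_hyperbola N (fun E1 E0 => F D1 D0 E1 E0)).
Qed.

Lemma sum4_b F : sum4 F = \sum_(1 <= E1 < N.+1) \sum_(1 <= D0 < N.+1)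
  \sum_(1 <= E0 < (N %/ E1).+1) \sum_(1 <= D1 < (N %/ D0).+1) F D1 D0 E1 E0.
Proof.
rewrite /sum4 (sum_hyperbola N (fun D1 D0 => \sum_(1 <= E1 < N.+1) \sum_(1 <= E0 < (N %/ E1).+1) F D1 D0 E1 E0)).
rewrite [RHS]exchange_big /=; apply: eq_bigr => D0 _.
by rewrite exchange_big /=; apply: eq_bigr => E1 _; rewrite exchange_big.
Qed.

Lemma sum4_swap F : sum4 F = sum4 (fun D1 D0 E1 E0 => F D0 D1 E0 E1).
Proof.
rewrite /sum4 (sum_hyperbola N (fun D1 D0 => \sum_(1 <= E1 < N.+1) \sum_(1 <= E0 < (N %/ E1).+1) F D1 D0 E1 E0)).
apply: eq_bigr => D1 _; apply: eq_bigr => D0 _.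
exact: (sum_hyperbola N (fun E1 E0 => F D0 D1 E1 E0)).
Qed.

Lemma ler_sum4 F G :
  (forall D1 D0 E1 E0, (0 < D1)%N -> (0 < D0)%N -> (0 < E1)%N -> (0 < E0)%N ->
     F D1 D0 E1 E0 <= G D1 D0 E1 E0) -> sum4 F <= sum4 G.
Proof.
move=> h; apply: ler_sum_nat => D1 /andP[d1 _]; apply: ler_sum_nat => D0 /andP[d0 _].
by apply: ler_sum_nat => E1 /andP[e1 _]; apply: ler_sum_nat => E0 /andP[e0 _]; apply: h.
Qed.

Lemma sum4D F G : sum4 (fun D1 D0 E1 E0 => F D1 D0 E1 E0 + G D1 D0 E1 E0) = sum4 F + sum4 G.
Proof.
rewrite /sum4 -big_split; apply: eq_bigr => D1 _; rewrite -big_split; apply: eq_bigr => D0 _.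
by rewrite -big_split; apply: eq_bigr => E1 _; rewrite -big_split.
Qed.

Lemma wA_le1 d : wA d <= 1.
Proof.
rewrite /wA; have [->|t0] := posnP (tau d); first by rewrite invr0 mulr0.
by rewrite ler_pdivrMr ?ltr0n // mul1r ler_nat (leq_trans (leq_b1 _)).
Qed.

Lemma wB_le1 d : wB d <= 1.
Proof.
rewrite /wB; have [->|t0] := posnP (tau d); first by rewrite invr0 mulr0.
by rewrite ler_pdivrMr ?ltr0n // mul1r ler_nat (leq_trans (leq_b1 _)).
Qed.

Lemma al_norm i d : `|al i d| <= 1.
Proof. by rewrite ger0_norm ?al_ge0 // mulr_ile1 ?wA_ge0 ?wA_le1 // lern1 leq_b1. Qed.

Lemma be_norm i d : `|be i d| <= 1.
Proof. by rewrite ger0_norm ?be_ge0 // mulr_ile1 ?wB_ge0 ?wB_le1 // lern1 leq_b1. Qed.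

Lemma al_big i d : (2 ^ i.+1 < d)%N -> al i d = 0.
Proof.
move=> h; rewrite /al; have [e|_] := eqVneq (tl d) i; last by rewrite andbF mulr0.
by have := @trunc_log_ltn 2 d isT; rewrite -/tl e ltnNge ltnW.
Qed.

Lemma be_big i d : (2 ^ i.+1 < d)%N -> be i d = 0.
Proof.
move=> h; rewrite /be; have [e|_] := eqVneq (tl d) i; last by rewrite andbF mulr0.
by have := @trunc_log_ltn 2 d isT; rewrite -/tl e ltnNge ltnW.
Qed.

Lemma al_sqo i d : al i d != 0 -> sqo d.
Proof. by rewrite /al /wA; case: (sqo d) => //; rewrite !mul0r eqxx. Qed.

Lemma be_sqo i d : be i d != 0 -> sqo d.
Proof. by rewrite /be /wB; case: (sqo d) => //; rewrite !mul0r eqxx. Qed.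

Variable kappa : R.
Hypotheses (kappa0 : 0 <= kappa)
  (hkappa : 128 * (1 + 3 * ln (4 * X)%N%:R) ^+ 16 / T%:R <= kappa ^+ 6).

Lemma box_AB i j : (i + j <= lam)%N -> (2 ^ i.+1 * 2 ^ j.+1 <= 4 * X)%N.
Proof.
move=> h; have l := trunc_logP (isT : (1 < 2)%N) X0; rewrite -/lam in l.
apply: (@leq_trans (4 * 2 ^ lam)); last by rewrite leq_mul2l l orbT.
rewrite -expnD (_ : i.+1 + j.+1 = 2 + (i + j))%N; last by lia.
by rewrite expnD leq_mul2l leq_exp2l ?h ?orbT.
Qed.

Lemma N_le : (N <= 4 * X)%N.
Proof.
have l := trunc_logP (isT : (1 < 2)%N) X0; rewrite -/lam in l.
by rewrite /N expnS; lia.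
Qed.

Let S2 : R := (1 + ln (4 * X)%N%:R) ^+ 2.

Lemma harm2 (c : R) : 0 <= c ->
  \sum_(1 <= x < N.+1) \sum_(1 <= y < N.+1) c * (x%:R^-1 * y%:R^-1) <= c * S2.
Proof.
move=> c0; have N0 : (0 < N)%N by rewrite /N expn_gt0.
have h : \sum_(1 <= x < N.+1) x%:R^-1 <= 1 + ln (4 * X)%N%:R :> R.
  by apply: le_trans (harmonic_le _ N0) _; rewrite lerD2l ler_ln_nat // N_le.
have -> : \sum_(1 <= x < N.+1) \sum_(1 <= y < N.+1) c * (x%:R^-1 * y%:R^-1) =
   c * ((\sum_(1 <= x < N.+1) x%:R^-1) * (\sum_(1 <= y < N.+1) y%:R^-1)) :> R.
  rewrite mulr_suml mulr_sumr; apply: eq_bigr => x _; by rewrite !mulr_sumr.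
rewrite ler_wpM2l // /S2 expr2; apply: ler_pM => //; apply: sumr_ge0 => k _; by rewrite invr_ge0.
Qed.

(* D0 and E1 are linked by the symbol (D0 / E1), and both exceed T; in sum_b_le it is E0 and D1. *)
Lemma sum_a_le i j : (i + j <= lam)%N ->
  `|sum4 (fun D1 D0 E1 E0 => ((T < D0) && (T < E1))%N%:R * T4 i j D1 D0 E1 E0)| <=
  (4 * X)%:R * kappa * S2.
Proof.
move=> ij; rewrite sum4_a.
set A := (2 ^ i.+1)%N; set B := (2 ^ j.+1)%N; have AB := box_AB ij.
have AN : (A <= N)%N by rewrite leq_exp2l // ltnS (leq_trans (leq_addr j i)).
have BN : (B <= N)%N by rewrite leq_exp2l // ltnS (leq_trans (leq_addl i j)).
apply: le_trans (ler_norm_sum _ _ _) _.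
apply: (@le_trans _ _ (\sum_(1 <= x < N.+1) \sum_(1 <= y < N.+1) (A * B)%:R * kappa * (x%:R^-1 * y%:R^-1))); last first.
  apply: le_trans (harm2 _) _; first by rewrite mulr_ge0.
  by rewrite ler_wpM2r ?exprn_ge0 ?addr_ge0 ?ln_nat_ge0 // ler_wpM2r // ler_nat.
apply: ler_sum_nat => D1 /andP[D10 _]; apply: le_trans (ler_norm_sum _ _ _) _.
apply: ler_sum_nat => E0 /andP[E00 _].
(* For fixed [D1] and [E0], the symbol at [E1] splits into those of [u], [D1] and [D0]. Only the
   last joins the inner variables; every other factor depends on at most one of them. *)
pose a D0 : R := (T < D0)%N%:R * al i (D1 * D0)%N.
pose b E1 : R := (T < E1)%N%:R * (be j (E1 * E0)%N * (jacR u E1 * jacR D1%:Z E1 * jacR (w * (E1 * E0)%N%:Z) D1)).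
have fac D0 E1 : ((T < D0) && (T < E1))%N%:R * T4 i j D1 D0 E1 E0 = a D0 * b E1 * J D0 E1.
  rewrite /T4 /a /b -mulnb natrM; move: (jacR (w * _) D1) => k.
  rewrite (jacR_Ml _ u) PoszM jacR_Ml -[jacR D0%:Z E1]/(J D0 E1).
  by move: (al _ _) (be _ _) (J _ _) (jacR _ _) (jacR _ _) (_%:R) (_%:R) => *; ring.
rewrite (eq_bigr _ (fun D0 _ => eq_bigr _ (fun E1 _ => fac D0 E1))).
rewrite (sum_shrink (N := (A %/ D1)%N)) ?leq_div2r //; last first.
  move=> D0; rewrite ltn_divLR // mulnC => l; rewrite big1 // => E1 _.
  by rewrite /a al_big // mulr0 !mul0r.
rewrite (eq_bigr (fun D0 => \sum_(1 <= E1 < (B %/ E0).+1) a D0 * b E1 * J D0 E1)); last first.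
  move=> D0 _; apply: sum_shrink; first exact: leq_div2r.
  move=> E1; rewrite ltn_divLR // => l.
  by rewrite /b be_big // mul0r !mulr0 mul0r.
apply: bil_bound AB _ hkappa _ _ _ _ => //.
- by move=> D0; rewrite normrM mulr_ile1 ?al_norm // normr_nat lern1 leq_b1.
- move=> E1; rewrite normrM mulr_ile1 // ?normr_nat ?lern1 ?leq_b1 //.
  by rewrite normrM mulr_ile1 ?be_norm // !normrM !mulr_ile1 ?jacR_le1 // mulr_ge0.
- move=> D0; rewrite /a; case: (ltnP T D0) => h; rewrite ?mul0r ?eqxx // mul1r => /al_sqo s.
  by split=> //; apply: sqo_dvd s _; apply: dvdn_mull.
- move=> E1; rewrite /b; case: (ltnP T E1) => h; rewrite ?mul0r ?eqxx // mul1r mulf_eq0 negb_or => /andP[/be_sqo s _].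
  by split=> //; apply: sqo_dvd s _; apply: dvdn_mulr.
Qed.

Lemma sum_b_le i j : (i + j <= lam)%N ->
  `|sum4 (fun D1 D0 E1 E0 => (~~ ((T < D0) && (T < E1)) && ((T < D1) && (T < E0)))%N%:R * T4 i j D1 D0 E1 E0)| <=
  (4 * X)%:R * kappa * S2.
Proof.
move=> ij; rewrite sum4_b.
set A := (2 ^ i.+1)%N; set B := (2 ^ j.+1)%N; have AB := box_AB ij.
have AN : (A <= N)%N by rewrite leq_exp2l // ltnS (leq_trans (leq_addr j i)).
have BN : (B <= N)%N by rewrite leq_exp2l // ltnS (leq_trans (leq_addl i j)).
apply: le_trans (ler_norm_sum _ _ _) _.
apply: (@le_trans _ _ (\sum_(1 <= x < N.+1) \sum_(1 <= y < N.+1) (B * A)%:R * kappa * (x%:R^-1 * y%:R^-1))); last first.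
  apply: le_trans (harm2 _) _; first by rewrite mulr_ge0.
  by rewrite ler_wpM2r ?exprn_ge0 ?addr_ge0 ?ln_nat_ge0 // ler_wpM2r // ler_nat mulnC.
apply: ler_sum_nat => E1 /andP[E10 _]; apply: le_trans (ler_norm_sum _ _ _) _.
apply: ler_sum_nat => D0 /andP[D00 _].
pose a E0 : R := (T < E0)%N%:R * be j (E1 * E0)%N.
(* The condition that excludes the terms of [sum_a_le] involves only the fixed [D0] and [E1], so it
   is a constant coefficient. *)
pose b D1 : R := (T < D1)%N%:R * (al i (D1 * D0)%N *
  ((~~ ((T < D0) && (T < E1)))%N%:R * jacR w D1 * jacR E1%:Z D1 * jacR (u * (D1 * D0)%N%:Z) E1)).
have fac E0 D1 : (~~ ((T < D0) && (T < E1)) && ((T < D1) && (T < E0)))%N%:R * T4 i j D1 D0 E1 E0 =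
    a E0 * b D1 * J E0 D1.
  rewrite /T4 /a /b -!(mulnb (~~ _)) -(mulnb (T < D1)%N) !natrM; move: (jacR (u * _) E1) => k.
  rewrite (jacR_Ml _ w) PoszM jacR_Ml -[jacR E0%:Z D1]/(J E0 D1).
  by move: (al _ _) (be _ _) (J _ _) (jacR _ _) (jacR _ _) (_%:R) (_%:R) (_%:R) => *; ring.
rewrite (eq_bigr _ (fun E0 _ => eq_bigr _ (fun D1 _ => fac E0 D1))).
rewrite (sum_shrink (N := (B %/ E1)%N)) ?leq_div2r //; last first.
  move=> E0; rewrite ltn_divLR // mulnC => l; rewrite big1 // => D1 _.
  by rewrite /a be_big // mulr0 !mul0r.
rewrite (eq_bigr (fun E0 => \sum_(1 <= D1 < (A %/ D0).+1) a E0 * b D1 * J E0 D1)); last first.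
  move=> E0 _; apply: sum_shrink; first exact: leq_div2r.
  move=> D1; rewrite ltn_divLR // => l.
  by rewrite /b al_big // mul0r !mulr0 mul0r.
rewrite mulnC in AB.
apply: bil_bound AB _ hkappa _ _ _ _ => //.
- by move=> E0; rewrite normrM mulr_ile1 ?be_norm // normr_nat lern1 leq_b1.
- move=> D1; rewrite normrM mulr_ile1 // ?normr_nat ?lern1 ?leq_b1 //.
  rewrite normrM mulr_ile1 ?al_norm // !normrM !mulr_ile1 ?jacR_le1 ?mulr_ge0 // normr_nat lern1 leq_b1 //.
- move=> E0; rewrite /a; case: (ltnP T E0) => h; rewrite ?mul0r ?eqxx // mul1r => /be_sqo s.
  by split=> //; apply: sqo_dvd s _; apply: dvdn_mull.
- move=> D1; rewrite /b; case: (ltnP T D1) => h; rewrite ?mul0r ?eqxx // mul1r mulf_eq0 negb_or => /andP[/al_sqo s _].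
  by split=> //; apply: sqo_dvd s _; apply: dvdn_mulr.
Qed.

Definition cc D1 D0 E1 E0 := (~~ ((T < D0) && (T < E1)) && ~~ ((T < D1) && (T < E0)))%N.

(** Cancellation bounds the terms where a linked pair has both members above [T]; in the rest,
    selected by [cc], the product of symbols is replaced by 1. *)
Lemma Box_le i j : (i + j <= lam)%N ->
  Box i j <= 2 * ((4 * X)%:R * kappa * S2) +
    sum4 (fun D1 D0 E1 E0 => (cc D1 D0 E1 E0)%:R * (al i (D1 * D0)%N * be j (E1 * E0)%N)).
Proof.
move=> ij; rewrite Box_sum4.
have -> : sum4 (T4 i j) =
   sum4 (fun D1 D0 E1 E0 => ((T < D0) && (T < E1))%N%:R * T4 i j D1 D0 E1 E0) +
   sum4 (fun D1 D0 E1 E0 => (~~ ((T < D0) && (T < E1)) && ((T < D1) && (T < E0)))%N%:R * T4 i j D1 D0 E1 E0) +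
   sum4 (fun D1 D0 E1 E0 => (cc D1 D0 E1 E0)%:R * T4 i j D1 D0 E1 E0).
  rewrite -!sum4D /sum4; apply: eq_bigr => D1 _; apply: eq_bigr => D0 _.
  apply: eq_bigr => E1 _; apply: eq_bigr => E0 _; rewrite /cc.
  by case: ((T < D0) && (T < E1))%N; case: ((T < D1) && (T < E0))%N; rewrite /= ?mul1r ?mul0r ?addr0 ?add0r.
have ha := le_trans (ler_norm _) (sum_a_le ij); have hb := le_trans (ler_norm _) (sum_b_le ij).
rewrite mulr2n mulrDl mul1r; apply: lerD; first exact: lerD.
apply: ler_sum4 => D1 D0 E1 E0 _ _ _ _; rewrite ler_wpM2l //.
have j1 : jacR (w * (E1 * E0)%N%:Z) D1 * jacR (u * (D1 * D0)%N%:Z) E1 <= 1.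
  by apply: le_trans (ler_norm _) _; rewrite normrM mulr_ile1 ?jacR_le1.
have ab : 0 <= al i (D1 * D0)%N * be j (E1 * E0)%N by rewrite mulr_ge0 ?al_ge0 ?be_ge0.
by rewrite /T4 -[leRHS]mulr1 ler_wpM2l.
Qed.

Lemma ind_sum_le n (k : nat) : \sum_(i < n) (k == i)%:R <= 1 :> R.
Proof.
have [l|l] := ltnP k n.
  rewrite (bigD1 (Ordinal l)) //= eqxx big1 ?addr0 // => i ni.
  by case: eqP => // e; case/negP: ni; apply/eqP/val_inj.
by rewrite big1 // => i _; case: eqP => // e; have := ltn_ord i; rewrite -e ltnNge l.
Qed.

Let Q := (4 * X)%N.

(* As d, e > T ^ 2, the unlinked terms have D1, E1 <= T or D0, E0 <= T; the weights, being
   monotone for divisibility, then bound them trivially. *)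
Lemma sum_c_le : \sum_(i < lam.+1) \sum_(j < lam.+1) (i + j <= lam)%N%:R *
    sum4 (fun D1 D0 E1 E0 => (cc D1 D0 E1 E0)%:R * (al i (D1 * D0)%N * be j (E1 * E0)%N)) <=
  2 * \sum_(1 <= x < T.+1) \sum_(1 <= y < T.+1) HAB R (Q %/ (x * y)).
Proof.
pose F D1 D0 E1 E0 : R := ((D1 <= T) && (E1 <= T))%N%:R *
  ((D0 * E0 <= Q %/ (D1 * E1))%N%:R * (wA D0 * wB E0)).
have F0 D1 D0 E1 E0 : 0 <= F D1 D0 E1 E0.
  by rewrite /F mulr_ge0 // mulr_ge0 // mulr_ge0 ?wA_ge0 ?wB_ge0.
apply: (@le_trans _ _ (sum4 (fun D1 D0 E1 E0 => F D1 D0 E1 E0 + F D0 D1 E0 E1))).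
  apply: (@le_trans _ _ (sum4 (fun D1 D0 E1 E0 => \sum_(i < lam.+1) \sum_(j < lam.+1)
     (i + j <= lam)%N%:R * ((cc D1 D0 E1 E0)%:R * (al i (D1 * D0)%N * be j (E1 * E0)%N))))).
    rewrite /sum4; apply: eq_imp_le.
    rewrite [RHS](eq_bigr _ (fun D1 _ => eq_bigr _ (fun D0 _ => eq_bigr _ (fun E1 _ => exchange_big _ _ _ _ _ _)))).
    rewrite [RHS](eq_bigr _ (fun D1 _ => eq_bigr _ (fun D0 _ => exchange_big _ _ _ _ _ _))).
    rewrite [RHS](eq_bigr _ (fun D1 _ => exchange_big _ _ _ _ _ _)).
    rewrite [RHS]exchange_big; apply: eq_bigr => i _ /=.
    rewrite [RHS](eq_bigr _ (fun D1 _ => eq_bigr _ (fun D0 _ => eq_bigr _ (fun E1 _ => exchange_big _ _ _ _ _ _)))).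
    rewrite [RHS](eq_bigr _ (fun D1 _ => eq_bigr _ (fun D0 _ => exchange_big _ _ _ _ _ _))).
    rewrite [RHS](eq_bigr _ (fun D1 _ => exchange_big _ _ _ _ _ _)).
    rewrite [RHS]exchange_big; apply: eq_bigr => j _ /=.
    rewrite mulr_sumr; apply: eq_bigr => D1 _; rewrite mulr_sumr; apply: eq_bigr => D0 _.
    by rewrite mulr_sumr; apply: eq_bigr => E1 _; rewrite mulr_sumr.
  apply: ler_sum4 => D1 D0 E1 E0 D10 D00 E10 E00.
  set d := (D1 * D0)%N; set e := (E1 * E0)%N.
  have d0 : (0 < d)%N by rewrite muln_gt0 D10. have e0 : (0 < e)%N by rewrite muln_gt0 E10.
  (* At most one pair [(i, j)] contributes for given [d] and [e], so the dyadic cut disappears; what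
     it leaves, [tl d + tl e <= lam], implies [d e <= Q]. *)
  pose c : R := [&& cc D1 D0 E1 E0, T * T < d, T * T < e & tl d + tl e <= lam]%N%:R * (wA d * wB e).
  have c0 : 0 <= c by rewrite /c mulr_ge0 // mulr_ge0 ?wA_ge0 ?wB_ge0.
  apply: (@le_trans _ _ c).
    apply: (@le_trans _ _ (\sum_(i < lam.+1) (tl d == i)%:R * (\sum_(j < lam.+1) (tl e == j)%:R * c))).
      apply: ler_sum => i _; rewrite mulr_sumr; apply: ler_sum => j _.
      rewrite /c /al /be; have [<-|_] := eqVneq (tl d) i; last by rewrite andbF mulr0 mul0r !mulr0 mul0r.
      have [<-|_] := eqVneq (tl e) j; last by rewrite andbF !mulr0 mul0r mulr0.
      rewrite !andbT !mul1r; case: (cc _ _ _ _); case: (_ < d)%N; case: (_ < e)%N; case: (_ <= lam)%N;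
        by rewrite /= ?mulr1 ?mul1r ?mulr0 ?mul0r ?mulr0.
    rewrite -mulr_suml; apply: (@le_trans _ _ (1 * (\sum_(j < lam.+1) (tl e == j)%:R * c))).
      by rewrite ler_wpM2r ?ind_sum_le // sumr_ge0 // => j _; rewrite mulr_ge0.
    by rewrite mul1r -mulr_suml -[leRHS]mul1r ler_wpM2r ?ind_sum_le.
  rewrite /c; case: (boolP (_ && _)); last by rewrite mul0r addr_ge0.
  case/and4P => hc dT eT tt; rewrite mul1r.
  have deQ : (d * e <= Q)%N.
    apply: leq_trans (box_AB tt); apply: leq_mul; apply: ltnW; exact: trunc_log_ltn.
  have A1 : wA d <= wA D0 by apply: wA_dvd => //; apply: dvdn_mull.
  have A2 : wA d <= wA D1 by apply: wA_dvd => //; apply: dvdn_mulr.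
  have B1 : wB e <= wB E0 by apply: wB_dvd => //; apply: dvdn_mull.
  have B2 : wB e <= wB E1 by apply: wB_dvd => //; apply: dvdn_mulr.
  have q1 : (D0 * E0 <= Q %/ (D1 * E1))%N.
    by rewrite leq_divRL ?muln_gt0 ?D10 // (leq_trans _ deQ) // /d /e; nia.
  have q2 : (D1 * E1 <= Q %/ (D0 * E0))%N.
    by rewrite leq_divRL ?muln_gt0 ?D00 // (leq_trans _ deQ) // /d /e; nia.
  have [/andP[h1 h2]|h12] := boolP ((D1 <= T) && (E1 <= T))%N.
    apply: (@le_trans _ _ (F D1 D0 E1 E0)); last by rewrite lerDl.
    by rewrite /F h1 h2 q1 !mul1r; apply: ler_pM; rewrite ?wA_ge0 ?wB_ge0.
  have /andP[h1 h2] : ((D0 <= T) && (E0 <= T))%N.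
    move: hc h12; rewrite /cc !negb_and -!leqNgt -!ltnNge => /andP[hc1 hc2] h12.
    have X1 : ~~ ((D1 <= T) && (D0 <= T))%N.
      by apply/negP => /andP[l1 l2]; move: dT; rewrite ltnNge leq_mul.
    have X2 : ~~ ((E1 <= T) && (E0 <= T))%N.
      by apply/negP => /andP[l1 l2]; move: eT; rewrite ltnNge leq_mul.
    move: hc1 hc2 h12 X1 X2; rewrite !ltnNge.
    by case: (D1 <= T)%N; case: (E1 <= T)%N; case: (D0 <= T)%N; case: (E0 <= T)%N.
  apply: (@le_trans _ _ (F D0 D1 E0 E1)); last by rewrite lerDr.
  by rewrite /F h1 h2 q2 !mul1r; apply: ler_pM; rewrite ?wA_ge0 ?wB_ge0.
rewrite sum4D [X in _ + X](_ : _ = sum4 F); last by rewrite [RHS]sum4_swap.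
rewrite -mulr2n -[leLHS]mulr_natl ler_wpM2l // /sum4.
have sw : \sum_(1 <= D1 < N.+1) \sum_(1 <= D0 < (N %/ D1).+1) \sum_(1 <= E1 < N.+1)
     \sum_(1 <= E0 < (N %/ E1).+1) F D1 D0 E1 E0 =
   \sum_(1 <= D1 < N.+1) \sum_(1 <= E1 < N.+1) ((D1 <= T) && (E1 <= T))%N%:R *
     \sum_(1 <= D0 < (N %/ D1).+1) \sum_(1 <= E0 < (N %/ E1).+1)
      (D0 * E0 <= Q %/ (D1 * E1))%N%:R * (wA D0 * wB E0).
  apply: eq_bigr => D1 _; rewrite exchange_big; apply: eq_bigr => E1 _ /=.
  by rewrite mulr_sumr; apply: eq_bigr => D0 _; rewrite mulr_sumr.
rewrite sw; have H0 x : 0 <= HAB R x.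
  by apply: sumr_ge0 => a _; apply: sumr_ge0 => b _; rewrite mulr_ge0 ?wA_ge0 ?wB_ge0.
apply: (@le_trans _ _ (\sum_(1 <= x < N.+1) \sum_(1 <= y < N.+1) (x <= T)%N%:R * ((y <= T)%N%:R * HAB R (Q %/ (x * y))))).
  apply: ler_sum => x _; apply: ler_sum => y _; rewrite -mulnb natrM -mulrA.
  rewrite !ler_wpM2l //; apply: sum_prod_le => a b; by rewrite mulr_ge0 ?wA_ge0 ?wB_ge0.
have cut (f : nat -> R) : (forall x, 0 <= f x) ->
    \sum_(1 <= x < N.+1) (x <= T)%N%:R * f x <= \sum_(1 <= x < T.+1) f x.
  move=> f0; apply: (@le_trans _ _ (\sum_(1 <= x < (maxn N T).+1) (x <= T)%N%:R * f x)).
    by apply: sum_nat_le => [|x]; [rewrite ltnS leq_maxl | rewrite mulr_ge0].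
  rewrite (sum_shrink (N := T)) ?leq_maxr // => [|x l]; last by rewrite leqNgt l mul0r.
  by apply: ler_sum => x _; rewrite ler_piMl // lern1 leq_b1.
under eq_bigr do rewrite -mulr_sumr.
apply: le_trans (cut _ _) _ => [x|]; first by apply: sumr_ge0 => y _; rewrite mulr_ge0.
by apply: ler_sum => x _; apply: cut.
Qed.

Lemma large_pairs_le :
  \sum_(1 <= d < X.+1) \sum_(1 <= e < (X %/ d).+1) [&& pairOK d e, T * T < d & T * T < e]%N%:R <=
  (lam.+1 * lam.+1)%:R * (2 * (Q%:R * kappa * S2)) +
  2 * \sum_(1 <= x < T.+1) \sum_(1 <= y < T.+1) HAB R (Q %/ (x * y)).
Proof.
apply: le_trans large_le_boxes _; apply: le_trans (lerD (lexx _) sum_c_le).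
set c := 2 * _; have c0 : 0 <= c.
  apply: mulr_ge0 => //; apply: mulr_ge0; first exact: mulr_ge0.
  by rewrite exprn_ge0 // addr_ge0 // ln_nat_ge0.
apply: (@le_trans _ _ (\sum_(i < lam.+1) \sum_(j < lam.+1) (c + (i + j <= lam)%N%:R *
    sum4 (fun D1 D0 E1 E0 => (cc D1 D0 E1 E0)%:R * (al i (D1 * D0)%N * be j (E1 * E0)%N))))).
  apply: ler_sum => i _; apply: ler_sum => j _.
  have [h|_] := boolP (i + j <= lam)%N; last by rewrite !mul0r addr0.
  by rewrite !mul1r; apply: Box_le.
apply: eq_imp_le; under eq_bigr do rewrite big_split /=.
rewrite big_split /=; congr (_ + _).
rewrite !big_const !iter_addr_0 !card_ord -mulrnA -[LHS]mulr_natl; by [].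
Qed.
End Boxes.

Opaque split_only.

(** * Pairs with a small member *)

Section SmallPairs.
Variable R : realType.
Local Notation jacR := (@jacR R).
Local Notation pairOK := (@pairOK R).

(** The quotient exceeds [sqrt X], so its logarithm is at least half of [ln X]; the factor 4 in
    [4 d^2 <= X] absorbs the rounding of the division. *)
Lemma quot_sq_gt d X Q : (0 < d)%N -> (4 * d * d <= X)%N -> (X <= Q)%N -> (0 < X)%N ->
  (X < (Q %/ d) * (Q %/ d))%N.
Proof.
move=> d0 dX XQ X0; set Y := (Q %/ d)%N.
have Y0 : (0 < Y)%N by rewrite divn_gt0 //; nia.
have h1 : (X < 2 * Y * d)%N.
  have := ltn_ceil Q d0; rewrite -/Y; nia.
have h2 : (X * X < (2 * Y * d) * (2 * Y * d))%N by apply: ltn_mul.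
have h3 : ((2 * Y * d) * (2 * Y * d) <= Y * Y * X)%N.
  by rewrite (_ : (2 * Y * d) * (2 * Y * d) = Y * Y * (4 * d * d))%N ?leq_mul2l ?dX ?orbT //; ring.
by rewrite -(ltn_pmul2r X0) (leq_trans h2).
Qed.

Lemma ln_quot_ge d X Q : (0 < d)%N -> (4 * d * d <= X)%N -> (X <= Q)%N -> (0 < X)%N ->
  ln X%:R / 2 <= ln (Q %/ d)%:R :> R.
Proof.
move=> d0 dX XQ X0; have h := quot_sq_gt d0 dX XQ X0.
have Y0 : (0 < Q %/ d)%N by case: (Q %/ d)%N h.
have := ler_ln_nat R X0 (ltnW h); rewrite ln_natM //; lra.
Qed.

Lemma ler_divn (Q d : nat) : (0 < d)%N -> (Q %/ d)%:R <= Q%:R / d%:R :> R.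
Proof. by move=> d0; rewrite ler_pdivlMr ?ltr0n // -natrM ler_nat leq_divM. Qed.

Variables (D X : nat).
Hypotheses (D0 : (0 < D)%N) (DX : (4 * D * D <= X)%N).

Let X1 : (1 < X)%N. Proof. by nia. Qed.
Let X0 : (0 < X)%N. Proof. exact: ltnW X1. Qed.
Let lX : 0 < ln X%:R :> R. Proof. by rewrite ln_gt0 // ltr1n. Qed.

Definition sieveC : R := 2 * (1 + ln 4) * X%:R *
  Num.sqrt ((1 + 2 * ln X%:R) * (2 + ln (8 * D)%N%:R)) / ln X%:R.

Lemma sieveC_ge0 : 0 <= sieveC.
Proof.
have c0 : 0 <= 1 + ln 4 :> R by rewrite addr_ge0 // (ln_nat_ge0 R 4).
by rewrite /sieveC divr_ge0 ?(ltW lX) // !mulr_ge0 // sqrtr_ge0.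
Qed.

Lemma sieve_quot u d x : unit2 u -> sqo d -> u * d%:Z != 1 -> (d <= D)%N -> (0 < x)%N -> (x <= D)%N ->
  \sum_(1 <= m < (X %/ x).+1) (sqo m && split_only (jacR (u * d%:Z)) m)%:R <= sieveC / x%:R.
Proof.
move=> hu sd nu dD x0 xD.
have xX : (4 * x * x <= X)%N by apply: leq_trans DX; apply: leq_mul => //; rewrite leq_mul2l.
have q := quot_sq_gt x0 xX (leqnn X) X0.
have Y0 : (0 < X %/ x)%N by case: (X %/ x)%N q.
have lY := ln_quot_ge x0 xX (leqnn X) X0.
have h := sieve_count R hu sd nu Y0.
set S := \sum_(_ <= _ < _) _ in h *.
have S0 : 0 <= S by apply: sumr_ge0.
have c0 : 0 <= 1 + ln 4 :> R by rewrite addr_ge0 // (ln_nat_ge0 R 4).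
have d0 : (0 < d)%N by apply: sqf_gt0 (proj1 (andP sd)).
have xR : (0 : R) < x%:R by rewrite ltr0n.
have sq : Num.sqrt ((1 + ln ((X %/ x) * (X %/ x))%:R) * (2 + ln (8 * d)%:R)) <=
   Num.sqrt ((1 + 2 * ln X%:R) * (2 + ln (8 * D)%N%:R)) :> R.
  rewrite ler_sqrt; last by rewrite mulr_ge0 // addr_ge0 ?mulr_ge0 ?ln_nat_ge0.
  apply: ler_pM; rewrite ?addr_ge0 ?ln_nat_ge0 //.
    rewrite ln_natM // lerD2l; have := ler_ln_nat R Y0 (leq_div X x); lra.
  by rewrite lerD2l ler_ln_nat ?muln_gt0 ?d0 // leq_mul2l dD orbT.
have h2 : S * (ln X%:R / 2) <= (1 + ln 4) * (X%:R / x%:R) *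
    Num.sqrt ((1 + 2 * ln X%:R) * (2 + ln (8 * D)%N%:R)).
  apply: le_trans (ler_wpM2l S0 lY) _; apply: le_trans h _.
  apply: ler_pM; rewrite ?mulr_ge0 ?sqrtr_ge0 //.
  by rewrite ler_wpM2l // ler_divn.
rewrite -(ler_pM2r (x := ln X%:R / 2)) ?divr_gt0 //; apply: le_trans h2 _.
by apply: eq_imp_le; rewrite /sieveC; field; rewrite !gt_eqF.
Qed.

Lemma harm_cut (c : R) : 0 <= c -> \sum_(1 <= x < X.+1) (x <= D)%N%:R * (c / x%:R) <= c * (1 + ln D%:R).
Proof.
move=> c0; apply: (@le_trans _ _ (\sum_(1 <= x < D.+1) (c / x%:R))).
  have DX' : (D <= X)%N by nia.
  rewrite (sum_shrink DX') => [|i l]; last by rewrite leqNgt l mul0r.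
  by apply: ler_sum => i _; rewrite ler_piMl ?divr_ge0 // lern1 leq_b1.
by rewrite -mulr_sumr ler_wpM2l // harmonic_le.
Qed.

(** For fixed small [d], the variable [e] is sieved by the character of [u d], which is nonprincipal
    since [u d] differs from 1. *)
Lemma small_d_le u w : unit2 u ->
  \sum_(1 <= d < X.+1) \sum_(1 <= e < (X %/ d).+1) [&& (d <= D)%N, pairOK u w d e & u * d%:Z != 1]%:R <=
  sieveC * (1 + ln D%:R).
Proof.
move=> hu; apply: le_trans (harm_cut sieveC_ge0); apply: ler_sum_nat => d /andP[d0 _].
have [dD|_] := leqP d D; last by rewrite big1 // mul0r.
rewrite mul1r; have [nu|] := boolP (u * d%:Z != 1); last first.
  by move=> _; rewrite big1 => [|e _]; [apply: divr_ge0 => //; apply: sieveC_ge0 | rewrite !andbF].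
have [sd|ns] := boolP (sqo d); last first.
  by rewrite big1 => [|e _]; [apply: divr_ge0 => //; apply: sieveC_ge0 | rewrite /pairOK (negbTE ns)].
apply: le_trans (sieve_quot hu sd nu dD d0 dD); apply: ler_sum => e _.
by rewrite ler_nat; have [/and5P[_ -> _ _ ->]|_] := boolP (pairOK u w d e).
Qed.

(** For fixed small [e], the variable [d] is sieved by the character of 2 and not by that of [w e],
    which is principal when [w e = 1]. *)
Lemma small_e_le u w :
  \sum_(1 <= d < X.+1) \sum_(1 <= e < (X %/ d).+1) [&& (e <= D)%N & pairOK u w d e]%:R <=
  sieveC * (1 + ln D%:R).
Proof.
rewrite (sum_hyperbola X (fun d e => [&& (e <= D)%N & pairOK u w d e]%:R)).
apply: le_trans (harm_cut sieveC_ge0); apply: ler_sum_nat => e /andP[e0 _].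
have [eD|_] := leqP e D; last by rewrite big1 // mul0r.
rewrite mul1r; have := @sieve_quot 2 1 e isT isT isT D0 e0 eD; rewrite mulr1.
apply: le_trans; apply: ler_sum => d _.
rewrite ler_nat; have [/and5P[sd _ s2 _ _]|_] := boolP (pairOK u w d e) => //.
by rewrite lt0b sd; exact: s2.
Qed.
End SmallPairs.

(** * Choice of the parameters and the final estimate for pairs *)

Section Logarithms.
Variable R : realType.
Local Notation pairOK := (@pairOK R).

Definition pair_count (u w : int) (X : nat) : R :=
  \sum_(1 <= d < X.+1) \sum_(1 <= e < (X %/ d).+1) (pairOK u w d e && (u * d%:Z != 1))%:R.

(** As [x y <= T^2], the quotients stay above [sqrt X] and every term saves the same power of
    [ln X]; the sums over [x] and [y] cost [(1 + ln T)^2]. *)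
Lemma HAB_sum_le (T X : nat) : (0 < T)%N -> (4 * (T * T) * (T * T) <= X)%N -> (256 <= X)%N ->
  \sum_(1 <= x < T.+1) \sum_(1 <= y < T.+1) HAB R (4 * X %/ (x * y)) <=
  16 * (1 + ln 4) * (4 * X)%:R / ln X%:R * (KA R (4 * X) * KB R (4 * X)) * (1 + ln T%:R) ^+ 2.
Proof.
move=> T0 TX X256; have X0 : (0 < X)%N by lia.
have lX : 0 < ln X%:R :> R by rewrite ln_gt0 // ltr1n; lia.
have c0 : 0 <= 1 + ln 4 :> R by rewrite addr_ge0 // (ln_nat_ge0 R 4).
set K := KA R _ * KB R _; have K0 : 0 <= K by rewrite mulr_ge0 ?KA_ge0 ?KB_ge0.
set c := 16 * _ * _ / _ * _; have cc : 0 <= c by rewrite /c mulr_ge0 // divr_ge0 ?(ltW lX) // !mulr_ge0.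
apply: (@le_trans _ _ (\sum_(1 <= x < T.+1) \sum_(1 <= y < T.+1) c * (x%:R^-1 * y%:R^-1))); last first.
  have -> : \sum_(1 <= x < T.+1) \sum_(1 <= y < T.+1) c * (x%:R^-1 * y%:R^-1) =
     c * ((\sum_(1 <= x < T.+1) x%:R^-1) * (\sum_(1 <= y < T.+1) y%:R^-1)).
    rewrite mulr_suml mulr_sumr; apply: eq_bigr => x _; by rewrite !mulr_sumr.
  rewrite ler_wpM2l // expr2; apply: ler_pM; rewrite ?harmonic_le //;
    by apply: sumr_ge0 => k _; rewrite invr_ge0.
apply: ler_sum_nat => x /andP[x0 xT]; apply: ler_sum_nat => y /andP[y0 yT].
have xy0 : (0 < x * y)%N by rewrite muln_gt0 x0.
have xyT : (x * y <= T * T)%N by apply: leq_mul.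
have xyX : (4 * (x * y) * (x * y) <= X)%N.
  by apply: leq_trans TX; apply: leq_mul => //; rewrite leq_mul2l.
have XQ : (X <= 4 * X)%N by lia.
have q := quot_sq_gt xy0 xyX XQ X0; have lq := ln_quot_ge R xy0 xyX XQ X0.
set Y := (4 * X %/ (x * y))%N in q lq *.
have Y16 : (16 <= Y)%N by rewrite leqNgt; apply/negP => l; nia.
apply: le_trans (HAB_le R Y16 (leq_div _ _)) _; rewrite -/K.
have lY : 0 < ln Y%:R :> R by lra.
apply: (@le_trans _ _ (8 * (1 + ln 4) * ((4 * X)%:R / (x * y)%:R) / (ln X%:R / 2) * K)).
  rewrite ler_wpM2r //; apply: ler_pM; rewrite ?mulr_ge0 ?invr_ge0 ?(ltW lY) //.
    by rewrite ler_wpM2l ?mulr_ge0 // ler_divn.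
  by rewrite lef_pV2 ?posrE // divr_gt0.
apply: eq_imp_le; rewrite /c !natrM; field.
by rewrite !gt_eqF ?ltr0n.
Qed.

(** The term of degree [k + 1] of the exponential series alone exceeds [c t^k] once [t] is at least
    [c (k+1)!]. *)
Lemma poly_le_exp (k : nat) (c : R) : 0 <= c -> exists2 t0 : R, 1 <= t0 &
  forall t, t0 <= t -> c * t ^+ k <= expR t.
Proof.
move=> c0; exists (1 + c * (k.+1)`!%:R); first by rewrite lerDl mulr_ge0.
move=> t ht; have f0 : (0 : R) < (k.+1)`!%:R by rewrite ltr0n fact_gt0.
have t1 : 1 <= t by apply: le_trans ht; rewrite lerDl mulr_ge0.
have t0 : 0 <= t by lra.
apply: le_trans (_ : t ^+ k.+1 / (k.+1)`!%:R <= _); last first.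
  by apply: le_trans (expR_ge1Dxn k t0); rewrite lerDr.
rewrite ler_pdivlMr // exprS mulrAC ler_wpM2r ?exprn_ge0 //; lra.
Qed.

Lemma root16 (x : R) : 0 <= x -> exists2 t : R, 0 <= t & t ^+ 16 = x.
Proof.
move=> x0; exists (Num.sqrt (Num.sqrt (Num.sqrt (Num.sqrt x)))); first exact: sqrtr_ge0.
rewrite (_ : 16 = 2 * (2 * (2 * 2)))%N // exprM sqr_sqrtr ?sqrtr_ge0 //.
rewrite exprM sqr_sqrtr ?sqrtr_ge0 // exprM sqr_sqrtr ?sqrtr_ge0 //.
by rewrite sqr_sqrtr.
Qed.

End Logarithms.

Section PairCountBound.
Variable R : realType.
Local Notation pairOK := (@pairOK R).

Lemma pair_count_split u w X D : pair_count R u w X <=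
  \sum_(1 <= d < X.+1) \sum_(1 <= e < (X %/ d).+1) [&& (d <= D)%N, pairOK u w d e & u * d%:Z != 1]%:R +
  \sum_(1 <= d < X.+1) \sum_(1 <= e < (X %/ d).+1) [&& (e <= D)%N & pairOK u w d e]%:R +
  \sum_(1 <= d < X.+1) \sum_(1 <= e < (X %/ d).+1) [&& pairOK u w d e, D < d & D < e]%N%:R.
Proof.
rewrite -!big_split; apply: ler_sum => d _ /=; rewrite -!big_split; apply: ler_sum => e _ /=.
rewrite -!natrD ler_nat ltnNge (ltnNge D e); move: (pairOK _ _ _ _) (u * _ != 1) => b1 b2.
by case: (d <= D)%N; case: (e <= D)%N; case: b1; case: b2.
Qed.

Lemma ln2_bounds : 2^-1 <= ln 2 :> R /\ ln 2 <= 1 :> R.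
Proof.
split; first by have := @ln_step R 1 isT; rewrite ln1 subr0.
have := @le_ln1Dx R 1; rewrite (_ : 1 + 1 = 2) //; apply; lra.
Qed.

Lemma ln4E : ln 4 = 2 * ln 2 :> R.
Proof. by rewrite (_ : 4 = (2 * 2)%N%:R) // ln_natM //; ring. Qed.

Lemma ln8E : ln 8 = 3 * ln 2 :> R.
Proof. by rewrite (_ : 8 = (2 * (2 * 2))%N%:R) // !ln_natM //; ring. Qed.

Section Bounds.
Variables (X T : nat) (t : R).
Hypotheses (t6 : 6 <= t) (tX : t ^+ 16 = ln X%:R) (T0 : (0 < T)%N) (X0 : (0 < X)%N).
Hypotheses (lnT : ln T%:R <= t) (DX : (4 * (T * T) * (T * T) <= X)%N).

Let t0 : 0 <= t. Proof. by have := t6; lra. Qed.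
Let tp : 0 < t. Proof. by have := t6; lra. Qed.
Let L := ln (X%:R : R).
Let L1 : t <= L.
Proof. by rewrite /L -tX exprS ler_peMr // exprn_ege1 //; have := t6; lra. Qed.
Let L6 : 6 <= L. Proof. exact: le_trans L1. Qed.

Let lnQ : ln (4 * X)%N%:R <= 2 + L :> R.
Proof. by rewrite ln_natM // ln4E -/L; case: ln2_bounds; lra. Qed.

(** The square root is at most that of [3 L * 7 t], hence below [5 t^9], against [L = t^16] in the
    denominator. With the harmonic factor [3 t] the saving is [t^6], weakened to [t] to match the
    other estimates. *)
Lemma sieve_final : sieveC R (T * T) X * (1 + ln (T * T)%N%:R) <= 90 * X%:R / t.
Proof.
have ht0 := t0; have htp := tp; have hL1 := L1; have hL6 := L6; have hT := lnT; have h6 := t6; have hQ := lnQ.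
case: ln2_bounds => l2 l2'.
have T2 : ln (T * T)%N%:R <= 2 * t by rewrite ln_natM //; lra.
have sq : Num.sqrt ((1 + 2 * ln X%:R) * (2 + ln (8 * (T * T))%N%:R)) <= 5 * t ^+ 9.
  rewrite -[leRHS]ger0_norm ?mulr_ge0 ?exprn_ge0 // -sqrtr_sqr ler_sqrt ?sqr_ge0 //.
  rewrite exprMn -exprM (_ : 9 * 2 = 16 + 2)%N // exprD tX -/L.
  have T0' : (0 < T * T)%N by rewrite muln_gt0 T0.
  rewrite (ln_natM R (isT : (0 < 8)%N) T0') ln8E.
  apply: (@le_trans _ _ ((3 * L) * (7 * t))).
    apply: ler_pM; [by rewrite -/L; lra | | by rewrite -/L; lra | lra].
    by have := ln_nat_ge0 R (T * T); lra.
  have LL : 0 <= L by lra.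
  have : 0 <= L * (t * t - t) by rewrite mulr_ge0 // subr_ge0 ler_peMr //; lra.
  nra.
have tE : t ^+ 16 = t ^+ 9 * t * t * t ^+ 5 by rewrite -!exprSr -exprD.
have t5 : 1 <= t ^+ 5 by rewrite exprn_ege1 //; lra.
rewrite /sieveC -tX tE.
have p9 : 0 < t ^+ 9 by rewrite exprn_gt0. have p5 : 0 < t ^+ 5 by rewrite exprn_gt0.
have XR : 0 <= X%:R :> R by [].
apply: (@le_trans _ _ (6 * X%:R * (5 * t ^+ 9) / (t ^+ 9 * t * t * t ^+ 5) * (3 * t))).
  apply: ler_pM.
  - apply: divr_ge0; last by rewrite !mulr_ge0 // ltW.
    by rewrite mulr_ge0 ?sqrtr_ge0 // mulr_ge0 // mulr_ge0 // ln4E; lra.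
  - by have := ln_nat_ge0 R (T * T); lra.
  - rewrite ler_wpM2r ?invr_ge0 ?mulr_ge0 ?(ltW p9) ?(ltW p5) //.
    apply: ler_pM; rewrite ?sqrtr_ge0 //.
    + by rewrite mulr_ge0 // mulr_ge0 // ln4E; lra.
    + by rewrite ler_wpM2r // ln4E; lra.
    + by rewrite -tE tX sq.
  - lra.
rewrite [leLHS](_ : _ = 90 * X%:R / t * (t ^+ 5)^-1); last by field; rewrite !gt_eqF.
by rewrite ler_piMr ?divr_ge0 ?mulr_ge0 // invf_le1.
Qed.

Lemma lam_le : (trunc_log 2 X)%:R <= 2 * L.
Proof.
have ht0 := t0; have htp := tp; have hL1 := L1; have hL6 := L6; have hT := lnT; have h6 := t6; have hQ := lnQ.
have l := trunc_logP (isT : (1 < 2)%N) X0; case: ln2_bounds => l2 _.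
have p0 : (0 < 2 ^ trunc_log 2 X)%N by rewrite expn_gt0.
have := ler_ln_nat R p0 l; rewrite natrX lnXn // -/L -[_ *+ _ in leLHS]mulr_natr => h.
rewrite -ler_pdivrMl //; apply: le_trans h.
exact: ler_wpM2r.
Qed.

(** At most [(3 L)^2] boxes, each with a harmonic loss of at most [(4 L)^2], cost [L^4 = t^64] up to
    a constant; this is why [kappa] is [t^(-65)]. *)
Lemma box_final :
  ((trunc_log 2 X).+1 * (trunc_log 2 X).+1)%:R *
   (2 * ((4 * X)%N%:R * (t ^+ 65)^-1 * (1 + ln (4 * X)%N%:R) ^+ 2)) <= 1152 * X%:R / t.
Proof.
have ht0 := t0; have htp := tp; have hL1 := L1; have hL6 := L6; have hT := lnT; have h6 := t6; have hQ := lnQ.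
have hl := lam_le; have lq := lnQ; have lq0 := ln_nat_ge0 R (4 * X).
have l1 : (trunc_log 2 X).+1%:R <= 3 * L by rewrite -natr1; lra.
have XR : 0 <= X%:R :> R by [].
apply: (@le_trans _ _ ((3 * L) * (3 * L) * (2 * ((4 * X)%N%:R * (t ^+ 65)^-1 * (4 * L) ^+ 2)))).
  apply: ler_pM => //.
  - by rewrite mulr_ge0 // mulr_ge0 ?exprn_ge0 ?mulr_ge0 ?invr_ge0 ?exprn_ge0 // addr_ge0.
  - by rewrite natrM; apply: ler_pM.
  - rewrite ler_wpM2l // ler_wpM2l ?mulr_ge0 ?invr_ge0 ?exprn_ge0 //.
    by rewrite ler_pXn2r ?nnegrE //; lra.
have tE : t ^+ 65 = L * L * L * L * t by rewrite /L -tX -!exprD -exprSr.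
rewrite tE natrM; apply: eq_imp_le; field.
by rewrite !gt_eqF //; lra.
Qed.

(** [KA] times [KB] is at most [11 t^12], that is [(ln X)^(3/4)], while Hall's inequality divides by
    [t^16]. Of the [t^4] gained, the sums over [x, y <= T] give back [(2 t)^2]. *)
Lemma hab_final :
  2 * \sum_(1 <= x < T.+1) \sum_(1 <= y < T.+1) HAB R (4 * X %/ (x * y)) <= 16896 * X%:R / t.
Proof.
have ht0 := t0; have htp := tp; have hL1 := L1; have hL6 := L6; have hT := lnT; have h6 := t6; have hQ := lnQ.
case: ln2_bounds => l2 l2'; have lq := lnQ; have lq0 := ln_nat_ge0 R (4 * X).
have Q0 : (0 < 4 * X)%N by rewrite muln_gt0 X0.
have X256 : (256 <= X)%N.
  rewrite -(ler_nat R); apply: (@le_trans _ _ (t ^+ 4)).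
    apply: (@le_trans _ _ (6 ^+ 4)); last by rewrite ler_pXn2r ?nnegrE.
    by rewrite -natrX ler_nat.
  apply: (@le_trans _ _ L); last by apply: ltW; apply: ln_sublinear; rewrite ltr0n.
  by rewrite /L -tX; apply: ler_weXn2l => //; lra.
apply: le_trans (ler_wpM2l _ (HAB_sum_le R T0 DX X256)) _ => //.
have KK : KA R (4 * X) * KB R (4 * X) <= 11 * t ^+ 12.
  rewrite -(ler_pXn2r (n := 4)) ?nnegrE ?mulr_ge0 ?KA_ge0 ?KB_ge0 ?exprn_ge0 //.
  rewrite exprMn [leRHS]exprMn -exprM.
  apply: (@le_trans _ _ ((13 * L * 5) * (7 * L) ^+ 2)).
    apply: ler_pM; rewrite ?exprn_ge0 ?KA_ge0 ?KB_ge0 //.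
      apply: le_trans (KA_le R Q0) _; apply: ler_pM; rewrite ?ln8E; lra.
    rewrite (_ : 4 = 2 * 2)%N // exprM ler_pXn2r ?nnegrE ?exprn_ge0 ?KB_ge0 //; last lra.
    apply: le_trans (KB_le R Q0) _; lra.
  rewrite (_ : t ^+ (12 * 4) = L * L * L); last by rewrite /L -tX -!exprD.
  have : 0 <= L * L * L by rewrite !mulr_ge0 //; lra.
  nra.
have XR : 0 <= X%:R :> R by [].
have tE : ln X%:R = t ^+ 12 * t * t * t * t by rewrite -tX -!exprSr.
have p12 : 0 < t ^+ 12 by rewrite exprn_gt0.
apply: (@le_trans _ _ (2 * (16 * 3 * (4 * X)%N%:R / (t ^+ 12 * t * t * t * t) * (11 * t ^+ 12) * (2 * t) ^+ 2))).
  rewrite ler_wpM2l // tE; apply: ler_pM; rewrite ?exprn_ge0 ?addr_ge0 ?ln_nat_ge0 //.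
  - by rewrite !mulr_ge0 ?KA_ge0 ?KB_ge0 ?invr_ge0 ?mulr_ge0 ?(ltW p12) ?addr_ge0 ?(ln_nat_ge0 R 4).
  - apply: ler_pM => //; first by rewrite !mulr_ge0 ?invr_ge0 ?mulr_ge0 ?(ltW p12) ?addr_ge0 ?(ln_nat_ge0 R 4).
      by rewrite mulr_ge0 ?KA_ge0 ?KB_ge0.
    rewrite ler_wpM2r ?invr_ge0 ?mulr_ge0 ?(ltW p12) // ler_wpM2r // ler_wpM2l // ln4E; lra.
  - rewrite ler_pXn2r ?nnegrE ?addr_ge0 ?ln_nat_ge0 ?mulr_ge0 //; lra.
rewrite [leLHS](_ : _ = 16896 * X%:R / t * t^-1); last by rewrite natrM; field; rewrite !gt_eqF.
by rewrite ler_piMr ?divr_ge0 ?mulr_ge0 // invf_le1 //; lra.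
Qed.
End Bounds.

(** [10^16] comes from [1 + 3 ln (4 X) <= 10 ln X]; the exponent adds [(ln X)^16 = t^256] and the
    sixth power of [t^65]; 256 is 128 doubled by [expR t <= 2 T]. The constants enter through
    equations so that they stay symbolic. *)
Lemma kappa_bound (X T n : nat) (t c : R) : 0 < t -> 6 <= ln X%:R :> R -> t ^+ 16 = ln X%:R ->
  (0 < T)%N -> (0 < X)%N -> expR t <= 2 * T%:R -> c = 10 ^+ 16 -> n = (256 + 65 * 6)%N ->
  256 * c * t ^+ n <= expR t ->
  128 * (1 + 3 * ln (4 * X)%N%:R) ^+ 16 / T%:R <= (t ^+ 65)^-1 ^+ 6.
Proof.
move=> tt L6 tX T0 X0 eT cE nE h.
have q : (1 + 3 * ln (4 * X)%N%:R) ^+ 16 <= c * t ^+ 256 :> R.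
  rewrite (exprM t 16 16) tX cE -exprMn ler_pXn2r ?nnegrE.
  - by have := ln_nat_ge0 R (4 * X); rewrite ln_natM // ln4E; case: ln2_bounds => _; lra.
  - by have := ln_nat_ge0 R (4 * X); rewrite ln_natM // ln4E; case: ln2_bounds => _; lra.
  - by have := ln_nat_ge0 R (4 * X); rewrite ln_natM // ln4E; case: ln2_bounds => _; lra.
  - by have := ln_nat_ge0 R (4 * X); rewrite ln_natM // ln4E; case: ln2_bounds => _; lra.
have TR : 0 < T%:R :> R by rewrite ltr0n.
rewrite ler_pdivrMr // exprVn -exprM -[leRHS]mulrC ler_pdivlMr ?exprn_gt0 //.
apply: (@le_trans _ _ (128 * (c * t ^+ 256) * t ^+ (65 * 6))).
  by rewrite ler_wpM2r ?exprn_ge0 ?(ltW tt) // ler_wpM2l.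
rewrite -mulrA -[X in 128 * X]mulrA -exprD -nE.
move: h eT; clear; move: (t ^+ n) (expR t) => b d; lra.
Qed.

Lemma kappa_bound_large : exists2 t0 : R, 1 <= t0 & forall (X T : nat) (t : R), t0 <= t ->
  6 <= ln X%:R :> R -> t ^+ 16 = ln X%:R -> (0 < T)%N -> (0 < X)%N -> expR t <= 2 * T%:R ->
  128 * (1 + 3 * ln (4 * X)%N%:R) ^+ 16 / T%:R <= (t ^+ 65)^-1 ^+ 6.
Proof.
have [c cE] : exists c : R, c = 10 ^+ 16 by exists (10 ^+ 16).
have [n nE] : exists n, n = (256 + 65 * 6)%N by exists (256 + 65 * 6)%N.
have c0 : 0 <= 256 * c by rewrite cE mulr_ge0 // exprn_ge0.
have [t0 t01 ht0] := @poly_le_exp R n (256 * c) c0.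
exists t0 => // X T t tt0 L6 tX T0 X0 eT.
have tt : 0 < t by apply: lt_le_trans tt0; apply: lt_le_trans t01; exact: ltr01.
exact: (kappa_bound tt L6 tX T0 X0 eT cE nE (ht0 t tt0)).
Qed.

(* With t = (ln X) ^ (1 / 16), the linking threshold T = floor (exp t) is smaller than every power
   of X but beats every power of ln X. *)
Lemma threshold (X : nat) (t : R) : (0 < X)%N -> 6 <= t -> t ^+ 16 = ln X%:R ->
  exists T : nat, [/\ (0 < T)%N, expR t <= 2 * T%:R, ln T%:R <= t & (4 * (T * T) * (T * T) <= X)%N].
Proof.
move=> X0 t6; have XR : 0 < X%:R :> R by rewrite ltr0n.
have e1 := expR_ge1Dx t.
have t2 : t + (t + t + (t + t)) <= t ^+ 2 by rewrite expr2; nra.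
have t16 : t ^+ 2 <= t ^+ 16 by apply: ler_weXn2l => //; lra.
pose T := Num.truncn (expR t).
have T0 : (0 < T)%N by rewrite truncn_gt0; lra.
have Te : T%:R <= expR t by rewrite truncn_le expR_ge0.
move=> tX; exists T; split=> //.
- apply: ltW; apply: lt_le_trans (truncnS_gt _) _; rewrite -/T -natr1.
  by rewrite mulr2n mulrDl mul1r lerD2l ler1n.
- by rewrite -[leRHS]expRK ler_ln ?posrE ?ltr0n ?expR_gt0.
rewrite -(ler_nat R) !natrM; apply: (@le_trans _ _ (expR t * (expR t * expR t) * (expR t * expR t))).
  have e4 : 4 <= expR t by clear -e1 t6; lra.
  have TT : T%:R * T%:R <= expR t * expR t by apply: ler_pM.
  by apply: ler_pM; rewrite ?mulr_ge0 //; apply: ler_pM; rewrite ?mulr_ge0.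
rewrite -!expRD -(lnK (x := X%:R)) ?posrE // ler_expR -tX.
by apply: le_trans t16; rewrite -addrA.
Qed.

(** The cut at [T^2] leaves pairs with [d] small, with [e] small, and with both large. Each part is
    at most a constant times [X / t], and [t] grows with [X]. *)
Lemma pair_count_o u w : unit2 u -> forall eps : R, 0 < eps ->
  exists X1 : nat, forall X, (X1 <= X)%N -> pair_count R u w X <= eps * X%:R.
Proof.
move=> hu eps eps0.
have [K K0 hK] : exists2 K : R, 0 <= K & forall z s : R,
    90 * z / s + 90 * z / s + (1152 * z / s + 16896 * z / s) <= K * z / s.
  exists (90 + 90 + (1152 + 16896)); first by apply: addr_ge0; apply: addr_ge0; apply: ler0n.
  have frac (a b c z s : R) : a * z / s + a * z / s + (b * z / s + c * z / s) =
      (a + a + (b + c)) * z / s by rewrite !mulrDl.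
  by move=> z s; apply: eq_imp_le; apply: frac.
have [t0 t01 ht0] := kappa_bound_large.
(* Three thresholds at once: [t0] for [kappa_bound_large], 6 for the final estimates, [K / eps] for
   the conclusion. *)
have [t1 t1E] : exists t1 : R, t1 = t0 + 6 + K / eps by exists (t0 + 6 + K / eps).
have e0 : 0 <= K / eps by rewrite divr_ge0 // ltW.
exists (Num.truncn (expR (t1 ^+ 16))).+1 => X hX.
have XX : expR (t1 ^+ 16) <= X%:R.
  apply: ltW; apply: lt_le_trans (truncnS_gt _) _; by rewrite ler_nat.
have XR : 0 < X%:R :> R by apply: lt_le_trans XX; apply: expR_gt0.
have X0 : (0 < X)%N by rewrite ltr0n in XR.
have LX : t1 ^+ 16 <= ln X%:R by rewrite -[leLHS]expRK ler_ln ?posrE ?expR_gt0.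
have t10 : 0 <= t1 by clear -t1E t01 e0; lra.
have L0 : 0 <= ln X%:R :> R by apply: le_trans LX; rewrite exprn_ge0.
have [t tp tX] := root16 L0.
have t1t : t1 <= t by rewrite -(ler_pXn2r (n := 16)) ?nnegrE // tX.
have t6 : 6 <= t by clear -t1t t1E t01 e0; lra.
have t_ge1 : 1 <= t by clear -t6; lra.
have [T [T0 eT lnT DX]] := threshold X0 t6 tX.
pose kappa := (t ^+ 65)^-1.
have k0 : 0 <= kappa by rewrite invr_ge0 exprn_ge0.
have L6 : 6 <= ln X%:R :> R.
  by rewrite -tX; apply: (le_trans t6); rewrite -[leLHS]expr1; apply: ler_weXn2l.
have hk : 128 * (1 + 3 * ln (4 * X)%N%:R) ^+ 16 / T%:R <= kappa ^+ 6.
  by apply: (ht0 _ _ _ _ L6 tX T0 X0 eT); apply: le_trans t1t; clear -t1E e0; lra.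
have tK : K / eps <= t by clear -t1t t1E t01; lra.
have hL := large_pairs_le u w T0 X0 k0 hk.
have D0 : (0 < T * T)%N by rewrite muln_gt0 T0.
have h1 := le_trans (small_d_le R D0 DX w hu) (sieve_final t6 tX T0 X0 lnT).
have h2 := le_trans (small_e_le R D0 DX u w) (sieve_final t6 tX T0 X0 lnT).
have h3 := le_trans hL (lerD (box_final t6 tX X0 lnT) (hab_final t6 tX T0 X0 lnT DX)).
apply: le_trans (pair_count_split u w X (T * T)) _.
apply: le_trans (lerD (lerD h1 h2) h3) _.
apply: (@le_trans _ _ (K * X%:R / t)); first exact: hK.
rewrite ler_pdivrMr ?(lt_le_trans ltr01 t_ge1) // mulrAC; apply: ler_wpM2r; first exact: ltW.
by rewrite mulrC -ler_pdivrMr.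
Qed.
End PairCountBound.

(** * Transfer of the pair count to sums over [n] *)

Import Rstruct.

(* The excluded case u = d = 1 is the soluble form a = 1. *)
Definition okp (u w : int) (d e : nat) : bool :=
  [&& sqo d, sqo e, u * d%:Z != 1, spl 2 d, spl (w * e%:Z) d & spl (u * d%:Z) e].

Lemma okp_pairOK (R : realType) u w d e : okp u w d e = pairOK R u w d e && (u * d%:Z != 1).
Proof.
rewrite /okp /pairOK -!(split_only_spl R); case: (sqo d) => //=; case: (sqo e) => //=.
by rewrite andbC -!andbA.
Qed.

Definition okp_count (u w : int) (X : nat) : nat :=
  \sum_(1 <= d < X.+1) \sum_(1 <= e < (X %/ d).+1) okp u w d e.

Lemma okp_count_o u w k : unit2 u ->
  exists X1 : nat, forall X, (X1 <= X)%N -> (k * okp_count u w X <= X)%N.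
Proof.
move=> hu; pose R := Rdefinitions.R : realType.
(* [k + 1] in place of [k] keeps the reciprocal positive when [k = 0]. *)
have e0 : 0 < k.+1%:R^-1 :> R by rewrite invr_gt0 ltr0n.
have [X1 h] := pair_count_o w hu e0; exists X1 => X hX.
have := h X hX.
have -> : pair_count R u w X = (okp_count u w X)%:R.
  rewrite /pair_count /okp_count natr_sum; apply: eq_bigr => d _; rewrite natr_sum.
  by apply: eq_bigr => e _; rewrite (okp_pairOK R).
rewrite -ler_pdivrMl // invrK -natrM ler_nat; apply: leq_trans.
by rewrite leq_mul2r leqnSn orbT.
Qed.

(* Here n = K d e with K = |u| v. *)
Definition En (K : nat) (u w : int) (n : nat) : nat :=
  \sum_(d <- divisors n) ((K * d %| n)%N && okp u w d (n %/ (K * d))).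

(** Put [n = d m] with [m = K e]: the sum over [n <= X] runs over [d e <= X / K], a part of the
    range of [okp_count]. *)
Lemma En_sum K u w X : (0 < K)%N -> (\sum_(1 <= n < X.+1) En K u w n <= okp_count u w X)%N.
Proof.
move=> K0; pose F d m : nat := (K %| m)%N && okp u w d (m %/ K).
have -> : (\sum_(1 <= n < X.+1) En K u w n = \sum_(1 <= n < X.+1) \sum_(d <- divisors n) F d (n %/ d))%N.
  apply: eq_big_nat => n /andP[n0 _]; apply: eq_big_seq => d; rewrite -dvdn_divisors // => dv.
  have d0 := dvdn_gt0 n0 dv.
  by rewrite /F dvdn_divRL // -divnMA [(d * K)%N]mulnC.
rewrite [leqLHS](sum_divisors X F).
rewrite -[leqLHS]/(\sum_(1 <= a < X.+1) \sum_(1 <= b < (X %/ a).+1) F a b)%N; apply: leq_sum => d _.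
rewrite (bigID (fun m => K %| m)%N) /= [X in (_ + X)%N]big1 ?addn0; last first.
  by move=> m /negbTE h; rewrite /F h.
rewrite [leqLHS](sum_multiples _ (F d)) //.
rewrite -[leqLHS]/(\sum_(1 <= b < (X %/ d %/ K).+1) F d (K * b))%N.
apply: (@leq_trans (\sum_(1 <= b < (X %/ d %/ K).+1) okp u w d b)).
  by apply: leq_sum => b _; rewrite /F mulKn // dvdn_mulr.
have le : ((X %/ d %/ K).+1 <= (X %/ d).+1)%N by rewrite ltnS leq_div.
by rewrite [leqRHS](big_cat_nat _ (n := (X %/ d %/ K).+1)) //= leq_addr.
Qed.

(** * From forms to pairs *)

Local Notation iz := int_of_Z.
Local Notation "a '|Z' b" := (Z.divide a b) (at level 70).

Lemma izM x y : iz (x * y)%ZZ = iz x * iz y. Proof. exact: (rmorphM iz). Qed.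
Lemma izB x y : iz (x - y)%ZZ = iz x - iz y. Proof. exact: (rmorphB iz). Qed.
Lemma izN x : iz (- x)%ZZ = - iz x. Proof. exact: (rmorphN iz). Qed.
Lemma iz_nat n : iz (Z.of_nat n) = n%:Z. Proof. exact: (Z_of_intK n%:Z). Qed.

Lemma dvdZ_int p z : (Z.of_nat p |Z z) <-> (p%:Z %| iz z)%Z.
Proof.
split=> [[q ->]|/dvdzP [q e]].
  by rewrite izM iz_nat dvdz_mull.
exists (Z_of_int q); rewrite -[LHS]int_of_ZK e -[Z.of_nat p]/(Z_of_int p%:Z).
exact: (rmorphM Z_of_int).
Qed.

Lemma dvdn_Z p n : (p %| n)%N <-> (Z.of_nat p |Z Z.of_nat n).
Proof. by rewrite dvdZ_int iz_nat dvdzE. Qed.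

Lemma prime_nat_Z p : prime p -> Znumtheory.prime (Z.of_nat p).
Proof.
move=> pp; apply/Znumtheory.prime_alt; have p1 := prime_gt1 pp; split; first by lia.
move=> k [k1 kp] dv; have ek : k = Z.of_nat (Z.to_nat k) by lia.
move: dv; rewrite ek => /dvdn_Z dv; case/primeP: pp => _ /(_ _ dv) /orP[] /eqP e; lia.
Qed.

Lemma sqfree_sqf n : (0 < n)%N -> sqfree (Z.of_nat n) -> sqf n.
Proof.
move=> n0 h; apply: sqfP => // p pp; rewrite leqNgt; apply/negP => l.
have dv : (p ^ 2 %| n)%N by rewrite pfactor_dvdn.
apply: (h _ (prime_nat_Z pp)); move/dvdn_Z: dv; rewrite -mulnn.
by rewrite (_ : Z.of_nat (p * p) = (Z.of_nat p * Z.of_nat p)%ZZ) //; lia.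
Qed.

Lemma leg_of_Z p a k t : prime p -> (2 < p)%N -> ~ (Z.of_nat p |Z k) -> ~ (Z.of_nat p |Z a) ->
  (Z.of_nat p |Z (a * (k * k) - t * t)%ZZ) -> leg (iz a) p = 1.
Proof.
move=> pp p2 hk ha; rewrite dvdZ_int izB !izM => h.
have k0 : leg (iz k) p != 0 by rewrite leg_eq0 //; apply/negP => /dvdZ_int.
have a0 : leg (iz a) p != 0 by rewrite leg_eq0 //; apply/negP => /dvdZ_int.
have e : leg (iz a * (iz k * iz k)) p = 1.
  apply: (leg_sq pp p2 _ h); rewrite -(leg_eq0 _ pp p2) (legM _ _ pp) (legM _ _ pp).
  exact: mulf_neq0 a0 (mulf_neq0 k0 k0).
move: e k0; rewrite (legM _ _ pp) (legM _ _ pp).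
by case: (leg_cases (iz k) p) => ->; rewrite ?eqxx // ?mulrNN !mulr1.
Qed.

(** Applied to [A = |a|]: as [a c = n^2], the squarefree [a] divides [n], which makes the
    factorisation [n = |u| v d e] possible. *)
Lemma sqf_dvd_sq A n : sqf A -> (0 < n)%N -> (A %| n * n)%N -> (A %| n)%N.
Proof.
move=> sA n0 dv; rewrite (sqf_prod_primes sA); apply: prod_primes_dvd.
- exact: primes_uniq.
- by apply/allP => p; rewrite mem_primes => /andP[].
move=> p; rewrite mem_primes => /and3P[pp _ pA].
by have := dvdn_trans pA dv; rewrite Euclid_dvdM // orbb.
Qed.

Definition odd_part (A : nat) := if odd A then A else A./2.
Definition two_part (A : nat) := if odd A then 1%N else 2%N.

Lemma odd_two A : A = (two_part A * odd_part A)%N.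
Proof. by rewrite /two_part /odd_part; case: ifP => o; [rewrite mul1n | lia]. Qed.

Lemma odd_part_sqo A : sqf A -> sqo (odd_part A).
Proof.
move=> s; have A0 := sqf_gt0 s; apply/andP; split.
  by apply: sqf_dvd s _; rewrite {2}(odd_two A) dvdn_mull.
rewrite /odd_part; case: ifP => // /negbT ev; apply/negPn/negP => ev2.
have l := sqf_logn s (isT : prime 2).
have : (2 ^ 2 %| A)%N by apply/dvdnP; exists (A./2./2); lia.
by rewrite pfactor_dvdn // => l2; move: (leq_trans l2 l).
Qed.

Definition sgnu (u : int) : int := if 0 <= u then 1 else -1.
Definition wv (s : Z) (u : int) (v : nat) : int := - iz s * sgnu u * v%:Z.
(* The pairs (u, v) of 2-parts in a = u d, n = |u| v d e. *)
Definition combos : seq (int * nat) :=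
  [:: (1, 1%N); (1, 2%N); (-1, 1%N); (-1, 2%N); (2, 1%N); (2, 2%N); (-2, 1%N); (-2, 2%N)].

(** [d] and [u] are the odd part and the signed 2-part of [a]; [e] and [v] are the odd part and
    2-part of [n / |a|]. Primes of [d] fall under [local_dvd], primes of [e] under [local_coprime],
    and [leg_of_Z] turns the congruences into symbols. *)
Lemma local_conditions (s a c : Z) (n : nat) : (s * s)%ZZ = 1%ZZ -> (0 < n)%N -> sqfree (Z.of_nat n) ->
  (a * c = Z.of_nat n * Z.of_nat n)%ZZ -> sqfree a -> a <> 1%ZZ ->
  (forall p : Z, Znumtheory.prime p -> padic_soluble p a (s * 6 * Z.of_nat n) c) ->
  exists u v d, [/\ (u, v) \in combos, a = (Z_of_int u * Z.of_nat d)%ZZ, (d %| n)%N,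
     (`|u|%N * v * d %| n)%N & okp u (wv s u v) d (n %/ (`|u|%N * v * d))].
Proof.
move=> hs n0 sn hac sa a1 hloc; have sqn := sqfree_sqf n0 sn.
have a0 : a <> 0%ZZ by move=> e; subst a; lia.
pose A := Z.abs_nat a; have A0 : (0 < A)%N by rewrite /A; lia.
have sA : sqf A.
  apply: sqfree_sqf => // p pp [k hk]; apply: (sa p pp).
  have [e|e] : a = Z.of_nat A \/ a = (- Z.of_nat A)%ZZ by rewrite /A; lia.
    by exists k; lia.
  by exists (- k)%ZZ; lia.
have dvA : (A %| n)%N.
  apply: sqf_dvd_sq => //; apply/dvdnP; exists (Z.abs_nat c); rewrite /A; nia.
pose M := (n %/ A)%N; have nAM : n = (A * M)%N by rewrite /M mulnC divnK.
have M0 : (0 < M)%N by move: n0; rewrite nAM muln_gt0 => /andP[].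
have sM : sqf M by apply: sqf_dvd sqn _; rewrite nAM dvdn_mull.
pose sg : int := if (0 <=? a)%ZZ then 1 else -1.
pose d := odd_part A; pose e := odd_part M; pose v := two_part M; pose u := sg * (two_part A)%:Z.
have uv : (u, v) \in combos.
  by rewrite /u /v /sg /two_part; case: (odd A); case: (odd M); case: (Z.leb 0 a).
have uabs : `|u|%N = two_part A.
  by rewrite /u /sg /two_part; case: (odd A); case: (Z.leb 0 a).
have usg : sgnu u = sg by rewrite /u /sg /two_part; case: (odd A); case: (Z.leb 0 a).
have aE : iz a = u * d%:Z.
  rewrite /u -mulrA -PoszM -odd_two /sg; case: (Z.leb_spec0 0 a) => ha.
    by rewrite mul1r -iz_nat; congr iz; rewrite /A; lia.
  by rewrite mulN1r -iz_nat -izN; congr iz; rewrite /A; lia.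
have sd : sqo d := odd_part_sqo sA. have se : sqo e := odd_part_sqo sM.
have Kd : (`|u| * v * d = A * v)%N by rewrite uabs mulnAC -odd_two.
have KdM : n = (`|u| * v * d * e)%N by rewrite Kd -mulnA -odd_two.
have Kd0 : (0 < `|u| * v * d)%N by move: n0; rewrite KdM muln_gt0 => /andP[].
have npp p : prime p -> ~ (Z.of_nat p * Z.of_nat p |Z Z.of_nat n) by move=> pp; apply: sn; apply: prime_nat_Z.
have oddp (x p : nat) : odd x -> p \in primes x -> [/\ prime p, (2 < p)%N & (p %| x)%N].
  move=> ox; rewrite mem_primes => /and3P[pp _ px]; split=> //.
  have op : odd p by move: ox; rewrite -(divnK px) oddM => /andP[].
  by move: op (prime_gt1 pp); clear; lia.
(* [m] carries the sign of [a], so that [n = a m], as [local_dvd] requires, and [- s m] becomes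
   [wv s u v] times [e]. *)
pose m := (Z_of_int sg * Z.of_nat M)%ZZ.
have nam : Z.of_nat n = (a * m)%ZZ.
  have e1 : Z.of_nat n = (Z.of_nat A * Z.of_nat M)%ZZ by rewrite nAM; lia.
  have e2 : a = (Z_of_int sg * Z.of_nat A)%ZZ.
    by rewrite /sg /A; case: (Z.leb_spec0 0 a) => ha; rewrite ?[Z_of_int _]/=; lia.
  rewrite e1 /m {1}e2; have : (Z_of_int sg * Z_of_int sg)%ZZ = 1%ZZ by rewrite /sg; case: (Z.leb 0 a).
  move=> hsg; rewrite Z.mul_assoc (Z.mul_comm _ (Z_of_int sg)) Z.mul_assoc hsg.
  by rewrite Z.mul_1_l.
have wE : iz (- s * m)%ZZ = wv s u v * e%:Z.
  rewrite izM izN /m izM iz_nat Z_of_intK /wv usg {1}(odd_two M) PoszM -/v -/e; ring.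
exists u, v, d; split=> //.
- by rewrite -[LHS]int_of_ZK aE -[Z.of_nat d]/(Z_of_int d%:Z); exact: (rmorphM Z_of_int).
- by rewrite {1}KdM -mulnA dvdn_mull // dvdn_mulr.
- by rewrite {1}KdM dvdn_mulr.
rewrite {1}KdM mulKn //.
have [/andP[sd1 od] /andP[se1 oe]] := (sd, se).
have dd p : p \in primes d -> leg 2 p = 1 /\ leg (wv s u v * e%:Z) p = 1.
  move=> /(oddp d _ od) [pp p2 pd]; have hp := prime_nat_Z pp.
  have pa : (Z.of_nat p |Z a).
    by rewrite dvdZ_int aE dvdz_mull // dvdzE.
  have np2 : Z.of_nat p <> 2%ZZ by clear -p2; lia.
  have [t [z [k [r [ht [h1 [hk h2]]]]]]] :=
    @local_dvd _ a (Z.of_nat n) c m s hp np2 hs (hloc _ hp) hac nam (npp p pp) pa.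
  split.
    apply: (leg_of_Z (a := 2%ZZ) pp p2 ht _ h1).
    by move=> /dvdZ_int; rewrite dvdzE /= => /(dvdn_leq (isT : (0 < 2)%N)); rewrite leqNgt p2.
  rewrite -wE; apply: (leg_of_Z pp p2 hk _ h2) => h.
  case: h => q hq; case: pa => b hb; apply: (npp p pp); rewrite nam; exists (b * (- s * q))%ZZ.
  have -> : m = (- s * (- s * m))%ZZ.
    by rewrite Z.mul_assoc Z.mul_opp_opp hs Z.mul_1_l.
  by rewrite hq hb; clear; lia.
have ee p : p \in primes e -> leg (u * d%:Z) p = 1.
  move=> /(oddp e _ oe) [pp p2 pe]; have hp := prime_nat_Z pp.
  have pM : (p %| M)%N by rewrite (odd_two M) dvdn_mull.
  have pn : (Z.of_nat p |Z Z.of_nat n) by apply/dvdn_Z; rewrite nAM dvdn_mull.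
  have npa : ~ (Z.of_nat p |Z a).
    move=> pa; apply: (npp p pp); rewrite nam; case: pa => b ->.
    move/dvdn_Z: pM => [q hq]; rewrite /m hq; exists (b * Z_of_int sg * q)%ZZ; clear; lia.
  have pB : (Z.of_nat p |Z s * 6 * Z.of_nat n)%ZZ by apply: Z.divide_mul_r.
  have [k [t [hk h]]] := @local_coprime _ a (Z.of_nat n) c _ hp (hloc _ hp) hac pn (npp p pp) npa pB.
  by rewrite -aE; apply: (leg_of_Z pp p2 hk npa h).
have d0 := sqf_gt0 sd1. have e0 := sqf_gt0 se1.
apply/and5P; split=> //; last apply/andP; last split.
- apply/eqP => h; apply: a1; by rewrite -[LHS]int_of_ZK aE h.
- rewrite /spl d0; apply/allP => p pd; have [pp p2 _] := oddp d p od pd.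
  by rewrite jac_prime // (proj1 (dd p pd)).
- rewrite /spl d0; apply/allP => p pd; have [pp p2 _] := oddp d p od pd.
  by rewrite jac_prime // (proj2 (dd p pd)).
- rewrite /spl e0; apply/allP => p pe; have [pp p2 _] := oddp e p oe pe.
  by rewrite jac_prime // ee.
Qed.

(** * Counting locally soluble forms and squarefree integers *)

Lemma In_mem (T : eqType) (x : T) (s : seq T) : x \in s -> In x s.
Proof. by elim: s => //= y s IH; rewrite in_cons => /orP[/eqP -> |/IH]; [left|right]. Qed.

Lemma length_filter (T : Type) (P : T -> bool) (s : seq T) : length (List.filter P s) = (\sum_(x <- s) P x)%N.
Proof. by elim: s => [|x s IH] /=; rewrite ?big_nil // big_cons -IH; case: (P x). Qed.

Lemma length_flat_map (T U : Type) (f : T -> seq U) (s : seq T) :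
  length (flat_map f s) = (\sum_(x <- s) length (f x))%N.
Proof. by elim: s => [|x s IH] /=; rewrite ?big_nil // big_cons -IH length_app. Qed.

Lemma decPP (P : Prop) : reflect P (Defs.decP P).
Proof. by rewrite /Defs.decP; case: ClassicalEpsilon.excluded_middle_informative => h; constructor. Qed.

Lemma Zrange_NoDup M : NoDup (Zrange M).
Proof.
apply: Injective_map_NoDup; last exact: seq_NoDup.
by move=> x y e; lia.
Qed.

(** By [local_conditions] every counted [a] other than 1 is some [u d] with [(u, v)] in [combos] and
    [d] dividing [n]. The counted [a] are distinct, so inclusion in this list bounds their number;
    the summand 1 is the form with [a = 1]. *)
Lemma count_ls_le (s : Z) (n : nat) : (s * s)%ZZ = 1%ZZ -> (0 < n)%N -> sqfree (Z.of_nat n) ->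
  (count_ls (s * 6 * Z.of_nat n)%ZZ (Z.of_nat n ^ 2)%ZZ <=
   1 + \sum_(c <- combos) En (`|c.1| * c.2) c.1 (wv s c.1 c.2) n)%N.
Proof.
move=> hs n0 sn; rewrite /count_ls /countF.
pose P (c : int * nat) (d : nat) := ((`|c.1| * c.2 * d %| n) && okp c.1 (wv s c.1 c.2) d (n %/ (`|c.1| * c.2 * d)))%N.
pose l0 := flat_map (fun c => List.map (fun d => (Z_of_int c.1 * Z.of_nat d)%ZZ)
   (List.filter (P c) (divisors n))) combos.
pose l := 1%ZZ :: l0.
have -> : (1 + \sum_(c <- combos) En (`|c.1| * c.2) c.1 (wv s c.1 c.2) n)%N = length l.
  rewrite -[RHS]/(1 + length l0)%N /l0 length_flat_map; congr addn; apply: eq_bigr => c _.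
  by rewrite length_map length_filter.
apply/ssrnat.leP; apply: NoDup_incl_length; first exact/List.NoDup_filter/Zrange_NoDup.
move=> a /filter_In [_ /decPP [[[c hc] sa] [_ hl]]].
have a0 : a <> 0%ZZ by move=> e; move: hc; rewrite e; nia.
have e : (Z.of_nat n ^ 2 / a)%ZZ = c by rewrite -hc Z.mul_comm Z.div_mul.
rewrite e in hl; have hac : (a * c = Z.of_nat n * Z.of_nat n)%ZZ by rewrite hc; lia.
have [->|a1] := Z.eq_dec a 1; first by left.
right; have [u [v [d [uv ea dv Kd ok]]]] := local_conditions hs n0 sn hac sa a1 hl.
apply/in_flat_map; exists (u, v); split; first exact: In_mem.
apply/in_map_iff; exists d; split=> //; apply/filter_In; split.
  by apply: In_mem; rewrite -dvdn_divisors.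
by rewrite /P /= Kd.
Qed.

Definition sqfreeb (n : nat) : bool := Defs.decP (sqfree (Z.of_nat n)).

Definition excess (s : Z) (n : nat) : nat :=
  \sum_(c <- combos) En (`|c.1| * c.2) c.1 (wv s c.1 c.2) n.

(** Each of the eight [combos] receives the share [X / (8 k)]; the induction over sublists collects
    a common threshold. *)
Lemma excess_o (s : Z) (k : nat) : exists X1 : nat, forall X, (X1 <= X)%N ->
  (k * \sum_(1 <= n < X.+1) excess s n <= X)%N.
Proof.
have H (cs : seq (int * nat)) : {subset cs <= combos} -> exists X1 : nat, forall X, (X1 <= X)%N ->
    (8 * k * \sum_(1 <= n < X.+1) \sum_(c <- cs) En (`|c.1| * c.2) c.1 (wv s c.1 c.2) n <= size cs * X)%N.
  elim: cs => [|[u v] cs IH] sub.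
    by exists 0%N => X _; rewrite big1 ?muln0 // => n _; rewrite big_nil.
  have sub' : {subset cs <= combos} by move=> c hc; apply: sub; rewrite in_cons hc orbT.
  have [X1 h1] := IH sub'.
  have huv := sub _ (mem_head _ _).
  have hu : unit2 u by move: huv; rewrite !inE; do 7 (case/orP => [/eqP[-> _] //|]); move=> /eqP[-> _].
  have K0 : (0 < `|u|%N * v)%N by move: huv; rewrite !inE; do 7 (case/orP => [/eqP[-> ->] //|]); move=> /eqP[-> ->].
  have [X2 h2] := okp_count_o (wv s u v) (8 * k) hu.
  exists (maxn X1 X2) => X; rewrite geq_max => /andP[/h1 l1 /h2 l2].
  under eq_bigr do rewrite big_cons /=.
  rewrite big_split /= mulnDr mulSn leq_add //.
  by apply: leq_trans l2; rewrite leq_mul2l En_sum ?orbT.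
have [X1 h] := H combos (fun _ h => h); exists X1 => X /h.
by rewrite /= -mulnA leq_pmul2l.
Qed.

(** Telescoping with [1 / k^2 <= 1 / (k - 1) - 1 / k]; the constant 3/4 makes [K = 2] an
    equality. *)
Lemma inv_sq_sum (R : realFieldType) K : (2 <= K)%N ->
  \sum_(2 <= k < K.+1) (k * k)%:R^-1 <= 3 / 4 - K%:R^-1 :> R.
Proof.
elim: K => // K IH; rewrite leq_eqVlt => /orP[/eqP [<-]|K2].
  by rewrite big_nat1; lra.
have K0 : (0 < K)%N by case: K K2 {IH}.
have p0 : (0 : R) < K%:R by rewrite ltr0n.
have p1 : (0 : R) < K.+1%:R by rewrite ltr0n.
have e : (K * K.+1)%:R^-1 = K%:R^-1 - K.+1%:R^-1 :> R.
  have k0 : K%:R != 0 :> R by rewrite gt_eqF.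
  have k1 : K%:R + 1 != 0 :> R by rewrite natr1 gt_eqF.
  by rewrite natrM -natr1; field; rewrite k0 k1.
have l : (K.+1 * K.+1)%:R^-1 <= (K * K.+1)%:R^-1 :> R.
  by rewrite lef_pV2 ?posrE ?ltr0n ?muln_gt0 ?K0 // ler_nat leq_mul2r leqnSn orbT.
rewrite big_nat_recr //=; apply: le_trans (lerD (IH K2) l) _.
by rewrite e; apply: eq_imp_le; ring.
Qed.

(* At most \sum_(k >= 2) Y / k ^ 2 <= 3 / 4 Y of the n <= Y are not squarefree. *)
Lemma sqfree_density Y : (Y <= 4 * \sum_(1 <= n < Y.+1) sqfreeb n)%N.
Proof.
pose R := Rdefinitions.R : realType.
have cover n : (0 < n)%N -> (n <= Y)%N -> (1 <= sqfreeb n + \sum_(2 <= k < Y.+1) (k * k %| n)%N)%N.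
  move=> n0 nY; rewrite /sqfreeb; case: (decPP (sqfree (Z.of_nat n))) => [//|h].
  have [p [hp hd]] : exists p, Znumtheory.prime p /\ Z.divide (p * p) (Z.of_nat n).
    by apply: NNPP => H; apply: h => p hp hd; apply: H; exists p.
  have p2 := prime_ge_2 p hp; pose k := Z.to_nat p.
  have ek : p = Z.of_nat k by rewrite /k; lia.
  have dv : (k * k %| n)%N.
    apply/dvdn_Z; rewrite (_ : Z.of_nat (k * k) = (p * p)%ZZ) //; rewrite ek; lia.
  have k2 : (2 <= k)%N by rewrite /k; lia.
  have kY : (k < Y.+1)%N.
    by rewrite ltnS (leq_trans _ nY) // (leq_trans _ (dvdn_leq n0 dv)) // leq_pmulr; lia.
  rewrite add0n (big_cat_nat _ (n := k)) //=; last by lia.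
  by rewrite [X in (_ + X)%N]big_ltn // dv; lia.
have [Y2|Y2] := ltnP Y 2.
  case: Y Y2 cover => [|[|]] // _ /(_ 1%N isT isT); rewrite big_geq // big_nat1 addn0; lia.
have S : (Y <= \sum_(1 <= n < Y.+1) sqfreeb n + \sum_(2 <= k < Y.+1) Y %/ (k * k))%N.
  have -> : (\sum_(2 <= k < Y.+1) Y %/ (k * k))%N = (\sum_(1 <= n < Y.+1) \sum_(2 <= k < Y.+1) (k * k %| n)%N)%N.
    rewrite exchange_big; apply: eq_big_nat => k /andP[k2 _] /=.
    rewrite [RHS](eq_bigr (fun n => if (k * k %| n)%N then 1%N else 0%N)); last by move=> n _; case: (_ %| _)%N.
    rewrite -big_mkcond sum_multiples; last by rewrite muln_gt0; lia.
    by rewrite sum_nat_const_nat muln1 subn1.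
  rewrite -big_split /=; apply: (@leq_trans (\sum_(1 <= n < Y.+1) 1)).
    by rewrite sum_nat_const_nat muln1 subn1.
  by rewrite !big_nat; apply: leq_sum => n /andP[n0 nY]; apply: cover.
have T : (4 * \sum_(2 <= k < Y.+1) Y %/ (k * k) <= 3 * Y)%N.
  rewrite -(ler_nat R) !natrM natr_sum.
  have l : \sum_(2 <= k < Y.+1) (Y %/ (k * k))%:R <= Y%:R * (3 / 4) :> R.
    apply: (@le_trans _ _ (\sum_(2 <= k < Y.+1) Y%:R * (k * k)%:R^-1)).
      apply: ler_sum_nat => k /andP[k2 _]; apply: ler_divn; rewrite muln_gt0; lia.
    rewrite -mulr_sumr ler_wpM2l //; apply: le_trans (inv_sq_sum R Y2) _.
    by rewrite gerBl invr_ge0.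
  lra.
lia.
Qed.

Lemma seq_iota m n : List.seq m n = iota m n.
Proof. by elim: n m => //= n IH m; rewrite IH. Qed.

Lemma fold_add_sum (T : Type) (g : T -> nat) (s : seq T) :
  fold_right Nat.add 0%N (List.map g s) = (\sum_(x <- s) g x)%N.
Proof. by elim: s => [|x s IH] /=; rewrite ?big_nil // big_cons IH. Qed.

(** [f] will be the cutoff [n < X] and [m] the integer [up X]. The excess is summed over all
    [n <= m], so the threshold does not depend on [f]. *)
Lemma ls_excess_list (s : Z) (k : nat) : (s * s)%ZZ = 1%ZZ ->
  exists X1 : nat, forall (m : nat) (f : nat -> bool), (X1 <= m)%coq_nat ->
   let l := List.filter (fun n => Defs.decP (sqfree (Z.of_nat n)) && f n) (List.seq 1 m) in
   (k * fold_right Nat.add 0 (List.map (fun n => count_ls (s * 6 * Z.of_nat n)%ZZ (Z.of_nat n ^ 2)%ZZ) l)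
     <= k * length l + m)%coq_nat.
Proof.
move=> hs; have [X1 h] := excess_o s k; exists X1 => m f /ssrnat.leP /h hm l.
apply/ssrnat.leP; rewrite ?plusE ?multE.
rewrite fold_add_sum; apply: leq_trans (leq_add (leqnn _) hm).
rewrite -mulnDr leq_mul2l; apply/orP; right.
have -> : length l = (\sum_(x <- l) 1)%N by rewrite sum1_size.
have P x : x \in l -> (0 < x)%N /\ sqfree (Z.of_nat x).
  move=> /In_mem /filter_In [/in_seq [h1 _] /andP[/decPP h2 _]]; split=> //; lia.
apply: (@leq_trans (\sum_(x <- l) (1 + excess s x))%N).
  rewrite big_seq [leqRHS]big_seq; apply: leq_sum => x /P [x0 sx].
  exact: count_ls_le.
rewrite big_split leq_add2l /index_iota subn1 /= -seq_iota /l.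
elim: (List.seq 1 m) => [|x t IH] /=; first by rewrite big_nil.
by case: (_ && _); rewrite !big_cons ?leq_add2l // (leq_trans IH) // leq_addl.
Qed.

Lemma sqfree_density_list (m Y : nat) (f : nat -> bool) : (Y <= m)%coq_nat ->
  (forall n, (n <= Y)%coq_nat -> f n) ->
  (Y <= 4 * length (List.filter (fun n => Defs.decP (sqfree (Z.of_nat n)) && f n) (List.seq 1 m)))%coq_nat.
Proof.
move=> /ssrnat.leP Ym hf; apply/ssrnat.leP; rewrite ?multE.
apply: leq_trans (sqfree_density Y) _; rewrite leq_mul2l /= length_filter seq_iota.
have -> : iota 1 m = index_iota 1 m.+1 by rewrite /index_iota subn1.
rewrite [leqRHS](big_cat_nat _ (n := Y.+1)) //=.
apply: leq_trans (leq_addr _ _); rewrite !big_nat; apply: leq_sum => n /andP[n0 nY].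
by rewrite /sqfreeb hf ?andbT //; apply/ssrnat.leP.
Qed.

End LocallySolubleCount.
Import LocallySolubleCount.

(** * The limit of the ratio *)

Lemma fold_add_le (g h : nat -> nat) (l : list nat) :
  (forall n, In n l -> (g n <= h n)%nat) ->
  (fold_right Nat.add 0%nat (map g l) <= fold_right Nat.add 0%nat (map h l))%nat.
Proof.
  induction l as [|n l IH]; simpl; intros H; auto.
  apply Nat.add_le_mono; [apply H|apply IH; intros; apply H]; auto.
Qed.

Lemma fold_add_one (l : list nat) : fold_right Nat.add 0%nat (map (fun _ => 1%nat) l) = length l.
Proof. induction l; simpl; auto. Qed.

Lemma sqfree_below_filter (X : R) :
  sqfree_below X = filter (fun n => andb (decP (sqfree (Z.of_nat n))) (decP (INR n < X)%R))
    (seq 1 (Z.to_nat (up X))).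
Proof.
  unfold sqfree_below. apply filter_ext. intros n. apply Bool.eq_true_iff_eq.
  rewrite Bool.andb_true_iff, !decP_true. reflexivity.
Qed.

(** With [N] squarefree integers in range, numerator [A] and denominator [B] satisfy
    [N <= A <= B <= N + 8 N / k], so the ratio differs from 1 by at most [8 / k]; the choice
    [k > 16 / eps] leaves a margin. *)
Lemma ratio_limit (s : Z) : (s * s = 1)%Z -> lim_infty (ratio s) 1%R.
Proof.
  intros hs eps heps.
  destruct (archimed (16 / eps)) as [hk _]. set (k := Z.to_nat (up (16 / eps))).
  assert (hk0 : (16 / eps < INR k)%R).
  { unfold k. rewrite INR_IZR_INZ, Z2Nat.id; [lra|]. apply le_IZR.
    assert (0 < 16 / eps)%R by (apply Rdiv_lt_0_compat; lra). simpl; lra. }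
  destruct (@ls_excess_list s k hs) as [X1 hX1].
  exists (INR X1 + 4)%R. intros X hX.
  destruct (archimed X) as [hu1 hu2]. set (m := Z.to_nat (up X)).
  pose proof (pos_INR X1) as hX0.
  assert (hm : INR m = IZR (up X)).
  { unfold m. rewrite INR_IZR_INZ, Z2Nat.id; auto. apply le_IZR. simpl; lra. }
  assert (hm4 : (4 <= m)%nat).
  { apply INR_le. rewrite hm. replace (INR 4) with 4%R by (simpl; ring). lra. }
  assert (hmX : (X1 <= m)%nat) by (apply INR_le; rewrite hm; lra).
  set (cs := fun n => count_sol (s * 6 * Z.of_nat n) (Z.of_nat n ^ 2)).
  set (cl := fun n => count_ls (s * 6 * Z.of_nat n) (Z.of_nat n ^ 2)).
  set (l := sqfree_below X).
  assert (hl : forall n, In n l -> (1 <= n)%nat).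
  { intros n h. apply filter_In in h. destruct h as [h _]. apply in_seq in h. lia. }
  set (A := fold_right Nat.add 0%nat (map cs l)). set (B := fold_right Nat.add 0%nat (map cl l)).
  assert (hNA : (length l <= A)%nat).
  { rewrite <- fold_add_one. apply fold_add_le. intros n h. apply count_sol_ge1.
    apply hl in h. nia. }
  assert (hAB : (A <= B)%nat) by (apply fold_add_le; intros n _; apply count_sol_le_ls).
  assert (hBN : (k * B <= k * length l + m)%nat).
  { unfold B, l. rewrite sqfree_below_filter.
    apply (hX1 m (fun n => decP (INR n < X)%R) hmX). }
  (* [up X] may equal [X + 1], so [n <= m - 2] is what guarantees [n < X]. *)
  assert (hN : (m - 2 <= 4 * length l)%nat).
  { unfold l. rewrite sqfree_below_filter.
    apply (@sqfree_density_list m (m - 2) (fun n => decP (INR n < X)%R)); [lia|].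
    intros n hn. apply (proj2 (decP_true _)). apply le_INR in hn.
    rewrite minus_INR, hm in hn by lia. simpl in hn. lra. }
  assert (hN0 : (1 <= length l)%nat) by lia.
  (* As [m >= 4], [m <= 2 (m - 2)], which is at most 8 times [length l]. *)
  assert (hk8 : (k * B <= k * length l + 8 * length l)%nat) by lia.
  unfold ratio, sum_sqfree. fold l. fold cs. fold cl. fold A. fold B.
  apply le_INR in hNA, hAB, hk8, hN0. rewrite plus_INR, !mult_INR in hk8.
  replace (INR 8) with 8%R in hk8 by (simpl; ring). simpl (INR 1) in hN0.
  revert hNA hAB hk8 hN0 hk0. generalize (INR A) (INR B) (INR (length l)) (INR k).
  clear - heps. intros a b n k h1 h2 h3 h4 h5.
  assert (hb : (0 < b)%R) by lra.
  assert (hk : (16 < eps * k)%R).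
  { apply (Rmult_lt_compat_l eps) in h5; auto. replace (eps * (16 / eps))%R with 16%R in h5 by (field; lra). lra. }
  assert (hk1 : (0 < k)%R) by nra.
  assert (h6 : (k * (b - a) <= 8 * b)%R) by nra.
  replace (a / b - 1)%R with (- ((b - a) / b))%R by (field; lra).
  rewrite Rabs_Ropp, Rabs_pos_eq by (apply Rmult_le_pos; [lra|left; apply Rinv_0_lt_compat; lra]).
  apply (Rmult_lt_reg_r b); auto. replace ((b - a) / b * b)%R with (b - a)%R by (field; lra).
  apply (Rmult_lt_reg_l k); auto. nra.
Qed.

Theorem theorem4p3 :
  lim_infty (ratio 1%Z) 1%R /\ lim_infty (ratio (-1)%Z) 1%R.
Proof. split; apply ratio_limit; reflexivity. Qed.
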